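(* Let $d\in\mathbb N$, $r_1>1/2$, $r_2>0$. Then there is a constant $C=C(r_1,r_2,d)$ such that for all integers $m\ge2$ $$ \sup_{K\in \mathbf W^{\mathbf r}_2} \sigma_m(K,\mathcal{LK})_{2} \le C\, m^{-r_1-r_2}(\log m)^{(d-1)(r_1+r_2)+1/2}. $$
   Context: $\mathbb T^v=[0,2\pi)^v$ (functions are $2\pi$-periodic in each variable) with normalized Lebesgue measure; $\|\cdot\|_2$ is the $L_2$ norm with respect to it. For $a>0$ let $F_a(x)=1+2\sum_{k=1}^\infty k^{-a}\cos(kx-a\pi/2)$, and for $\mathbf a\in\mathbb R^v_+$ let $F_{\mathbf a}(\mathbf x)=\prod_{j=1}^vF_{a_j}(x_j)$. Set $\mathbf W^{\mathbf a}_2=\{f: f=\varphi*F_{\mathbf a},\ \|\varphi\|_{L_2(\mathbb T^v)}\le1\}$, where $(F_{\mathbf a}*\varphi)(\mathbf x)=(2\pi)^{-v}\int_{\mathbb T^v}F_{\mathbf a}(\mathbf x-\mathbf y)\varphi(\mathbf y)d\mathbf y$. The class $\mathbf W^{\mathbf r}_2=\mathbf W^{r_1,r_2}_2$ is this class with $v=2d$, $a_j=r_1$ and $a_{j+d}=r_2$ for $j=1,\dots,d$. Its elements are written $K(\mathbf x,\mathbf y)$, $\mathbf x,\mathbf y\in\mathbb T^d$; since $r_1>1/2$, the convolution defines $K(\mathbf x,\cdot)\in L_2(\mathbb T^d)$ for every $\mathbf x$. The adaptive system $\mathcal{LK}=\mathcal{LK}(2)$ determined by $K$ is the set of functions $u(\mathbf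 x)K(\mathbf z,\mathbf y)$ with $\mathbf z\in\mathbb T^d$, $u\in L_2(\mathbb T^d)$ ($u$ may depend on $\mathbf z$), and $$\sigma_m(K,\mathcal{LK})_2=\inf_{\xi^1,\dots,\xi^m\in\mathbb T^d}\ \inf_{u_1,\dots,u_m\in L_2(\mathbb T^d)}\Big\|K(\mathbf x,\mathbf y)-\sum_{j=1}^m u_j(\mathbf x)K(\xi^j,\mathbf y)\Big\|_{L_2(\mathbb T^{2d})}.$$ *)

(* Defs.v *)
(* MathComp-Analysis, with complex numbers R[i] from mathcomp-real-closed. *)
From HB Require Import structures.
From mathcomp Require Export all_boot all_order all_algebra.
From mathcomp Require Export all_classical all_reals all_analysis.
From mathcomp Require Export complex.

Set Implicit Arguments.
Unset Strict Implicit.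
Unset Printing Implicit Defensive.
Import Order.TTheory GRing.Theory Num.Theory.
Import numFieldNormedType.Exports.

Local Open Scope classical_set_scope.
Local Open Scope ring_scope.

(* Points of T^v are v-tuples of reals; T^v itself is the cube [0, 2pi)^v. *)
Definition torus (R : realType) (v : nat) : set (v.-tuple R) :=
  [set x | forall i : 'I_v, 0 <= tnth x i < 2 * pi].

Lemma two_pi_gt0 (R : realType) : (0 : R) < 2 * pi.
Proof. by rewrite mulr_gt0// pi_gt0. Qed.

(* uniform_prob lives on measurableTypeR R, which is R with the same
   sigma-algebra but another measure display. *)
Definition cons_tuple (R : realType) (v : nat)
    (p : measurableTypeR R * v.-tuple R) : v.+1.-tuple R :=
  [tuple of (p.1 : R) :: p.2].

Lemma measurable_cons_tuple (R : realType) (v : nat) :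
  measurable_fun [set: measurableTypeR R * v.-tuple R] (@cons_tuple R v).
Proof.
apply: (@measurable_cons _ _ (measurableTypeR R * v.-tuple R)%type R
  (fun p => p.1) v (fun p => p.2)).
- exact: (@measurable_fst _ _ (measurableTypeR R) (v.-tuple R)).
- exact: (@measurable_snd _ _ (measurableTypeR R) (v.-tuple R)).
Qed.

HB.instance Definition _ (R : realType) (v : nat) :=
  isMeasurableFun.Build _ _ _ _ (@cons_tuple R v)
    (@measurable_cons_tuple R v).

(* Normalized Lebesgue measure on T^v, as a measure on v.-tuple R carried by
   the cube: the v-fold product of the uniform probability on [0, 2pi]. *)
Fixpoint torus_measure (R : realType) (v : nat) : probability (v.-tuple R) R :=
  if v is n.+1 then
    distribution
      (uniform_prob (two_pi_gt0 R) \x torus_measure R n : probability _ R)%E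
      (@cons_tuple R n : {mfun _ >-> _})
  else \d_ [tuple].

(* Functions are complex valued. This contains the real-valued case: if K is
   real, replacing the u_j in sigma_LK by their real parts does not increase
   the error. *)
Section L2.
Context {R : realType} {v : nat}.
Implicit Types f g : v.-tuple R -> R[i].

Definition norm2 f : \bar R :=
  ('N[torus_measure R v]_2%:E [EFin \o (@Normc.normc R \o f)])%E.

Definition L2 : set (v.-tuple R -> R[i]) :=
  [set f | [/\ measurable_fun setT (fun x => complex.Re (f x)),
               measurable_fun setT (fun x => complex.Im (f x)) &
               (norm2 f < +oo)%E]].

Definition integral_torus f : R[i] :=
  Complex (\int[torus_measure R v]_x complex.Re (f x))
          (\int[torus_measure R v]_x complex.Im (f x)).

Definition tuple_sub (x y : v.-tuple R) : v.-tuple R :=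
  [tuple tnth x i - tnth y i | i < v].

(* The factor (2 pi)^-v is part of the normalized measure. *)
Definition convolution (F : v.-tuple R -> R) f : v.-tuple R -> R[i] :=
  fun x => integral_torus (fun y => Complex (F (tuple_sub x y)) 0 * f y).

End L2.

(* F_a. The series converges for x outside 2 pi Z; the value of limn on that null
   set does not affect any of the integrals. *)
Definition bernoulli_kernel (R : realType) (a x : R) : R :=
  1 + 2 * limn (fun n : nat =>
    \sum_(1 <= k < n.+1) k%:R `^ (- a) * cos (k%:R * x - a * pi / 2)).

Definition bernoulli_kernel_prod (R : realType) (v : nat) (a : 'I_v -> R)
    (x : v.-tuple R) : R :=
  \prod_(j < v) bernoulli_kernel (a j) (tnth x j).

Definition W2 (R : realType) (v : nat) (a : 'I_v -> R) :
    set (v.-tuple R -> R[i]) :=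
  [set convolution (bernoulli_kernel_prod a) phi |
    phi in [set phi | L2 phi /\ (norm2 phi <= 1)%E]].

Definition pair_exponent (R : realType) (d : nat) (r1 r2 : R) :
    'I_(d + d) -> R :=
  fun i => if (i < d)%N then r1 else r2.

Definition fst_half (R : realType) (d : nat) (z : (d + d).-tuple R) :
    d.-tuple R := [tuple tnth z (lshift d i) | i < d].

Definition snd_half (R : realType) (d : nat) (z : (d + d).-tuple R) :
    d.-tuple R := [tuple tnth z (rshift d i) | i < d].

(* K is used pointwise: for a kernel in W2 with r1 > 1/2 the convolution integral
   at (x, y) converges absolutely for every x and almost every y. *)
Definition sigma_LK (R : realType) (d m : nat)
    (K : (d + d).-tuple R -> R[i]) : \bar R :=
  ereal_inf [set
    ereal_inf [set
      norm2 (fun z => K z - \sum_(j < m)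
        u j (fst_half z) * K (cat_tuple (xi j) (snd_half z)))
      | u in [set u : 'I_m -> d.-tuple R -> R[i] | forall j, L2 (u j)]]
    | xi in [set xi : 'I_m -> d.-tuple R | forall j, torus (xi j)]].

(* Main.v *)
(* Write K = F * phi and truncate the Fourier series of F at a large order N. In an orthonormal
   trigonometric basis the truncated kernel is a matrix V = W Phi W', with diagonal weights W, W'
   that decay along dyadic hyperbolic crosses and with |Phi|_HS <= 1 by Bessel. The points xi^j are
   chosen adaptively: subtracting the rank-one term through xi replaces the Gram operator
   G(x, x') = <K(x, .), K(x', .)> by its Schur complement at xi. Averaging over xi shows that as
   long as the trace of G exceeds twice the best possible tail tau of a rank p projection, some
   xi multiplies the trace by at most 1 - 1/(8p), while the pivot G(xi, xi) stays bounded below.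
   Running through the dyadic levels p_j ~ 2^j j^(d-1), tau_j = 2^(-2j(r1+r2)) costs O(p_J) points
   for a squared error 2 tau_J. Because the pivots are bounded below, the coefficients u_j are
   bounded independently of N, so the truncation error, which is o(1) relative to a majorant that
   is square integrable in y for every x (this uses r1 > 1/2), can be made negligible. *)
Require Import Defs.
From mathcomp Require Import zify ring lra measurable_realfun.
Set Implicit Arguments.
Unset Strict Implicit.
Unset Printing Implicit Defensive.
Import Order.TTheory GRing.Theory Num.Theory.
Import numFieldNormedType.Exports.
Local Open Scope classical_set_scope.
Local Open Scope ring_scope.

(** * Greedy pivoting on Gram matrices *)

Section LinearAlgebra.
Variable R : realFieldType.

(** Sampling at points loses only a constant factor for two reasons. Subtracting the rank-one term
    is an orthogonal projection of the functions K(x, .), so Gram operators only decrease: the tail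
    bound of a fixed projection and the bound on G(x, x) for the initial kernel survive all later
    steps. And the target is lowered level by level: from trace 2 tau_(j-1) to 2 tau_j the trace
    shrinks by a fixed ratio only, which takes a multiple of p_j points, and the p_j grow
    geometrically. Aiming at tau_J at once, with the factor 1 - 1/(8 p_J), would cost a further
    factor J, that is, log m.

    The points must serve K itself, at given x and not for almost every x, whereas the greedy choice
    sees a truncation. An error in K(xi^j, .) enters multiplied by u_j, whence the order of choices:
    levels, then the bound on the coefficients, then the truncation order. A complex kernel is
    treated as two real ones side by side, with common points and real coefficients. Finally m is of
    order 2^J J^(d-1), so 2^(-J(r1+r2)) is of order m^(-r1-r2) (log m)^((d-1)(r1+r2)). *)

Definition psd n (A : 'M[R]_n) := forall v : 'rV_n, 0 <= (v *m A *m v^T) 0 0.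

Lemma mxtrace_mul_tr m n (A B : 'M[R]_(m, n)) :
  \tr (A *m B^T) = \sum_i \sum_j A i j * B i j.
Proof.
by rewrite /mxtrace; apply: eq_bigr => i _; rewrite mxE; apply: eq_bigr => j _; rewrite mxE.
Qed.

Lemma mxtrace_mul_tr_ge0 m n (A : 'M[R]_(m, n)) : 0 <= \tr (A *m A^T).
Proof.
by rewrite mxtrace_mul_tr; apply: sumr_ge0 => i _; apply: sumr_ge0 => j _; rewrite -expr2 sqr_ge0.
Qed.

Lemma mxtrace_mul_tr_eq0 m n (A : 'M[R]_(m, n)) : \tr (A *m A^T) = 0 -> A = 0.
Proof.
rewrite mxtrace_mul_tr => A0; apply/matrixP => i j; rewrite mxE.
have Aij_ge0 k l : 0 <= A k l * A k l by rewrite -expr2 sqr_ge0.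
have rowpos (k : 'I_m) : true -> 0 <= \sum_j A k j * A k j.
  by move=> _; apply: sumr_ge0 => l _.
have Ai0 := psumr_eq0P rowpos A0 (i := i) isT.
have := psumr_eq0P (fun l _ => Aij_ge0 i l) Ai0 (i := j) isT.
by move/eqP; rewrite mulf_eq0 orbb => /eqP.
Qed.

(** The sign of [z] is left open. If [z] is negative, a large [t] with t y <= 0 contradicts the
    assumption; if positive, the minimizer -y/z gives the claim; if zero, a linear function bounded
    below is constant, so y = 0. *)
Lemma discriminant_le (x y z : R) :
  (forall t, 0 <= x + 2 * t * y + t ^+ 2 * z) -> y ^+ 2 <= x * z.
Proof.
move=> H.
have [z0|z0|z0] := ltgtP z 0.
- have x0 : 0 <= x by have := H 0; rewrite mulr0 mul0r expr0n/= mul0r !addr0.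
  have [y0|y0] := leP 0 y.
    have h0 : 0 <= x / - z by rewrite divr_ge0// oppr_ge0 ltW.
    have h1 : 0 <= y / - z by rewrite divr_ge0// oppr_ge0 ltW.
    have := H (- (1 + x / - z)).
    have -> : x = (x / - z) * - z by rewrite divfK// oppr_eq0 lt_eqF.
    rewrite mulfK ?oppr_eq0 ?lt_eqF//.
    set w := x / - z in h0 *.
    nra.
  have h0 : 0 <= x / - z by rewrite divr_ge0// oppr_ge0 ltW.
  have := H ((1 + x / - z)).
  have -> : x = (x / - z) * - z by rewrite divfK// oppr_eq0 lt_eqF.
  rewrite mulfK ?oppr_eq0 ?lt_eqF//.
  set w := x / - z in h0 *.
  nra.
- have := H (- y / z).
  have -> : x + 2 * (- y / z) * y + (- y / z) ^+ 2 * z = (x * z - y ^+ 2) / z.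
    by field; rewrite gt_eqF.
  by rewrite pmulr_lge0 ?invr_gt0// subr_ge0.
- rewrite z0 mulr0.
  have [->|y0] := eqVneq y 0; first by rewrite expr0n.
  have := H (- (x + 1) / (2 * y)).
  rewrite z0 mulr0 addr0.
  have -> : x + 2 * (- (x + 1) / (2 * y)) * y = - 1 by field.
  by rewrite ler0N1.
Qed.

Lemma mxtrace_cauchy_schwarz m n (A B : 'M[R]_(m, n)) :
  (\tr (A *m B^T)) ^+ 2 <= \tr (A *m A^T) * \tr (B *m B^T).
Proof.
apply: discriminant_le => t.
have := mxtrace_mul_tr_ge0 (A + t *: B).
rewrite linearD/= linearZ/= !mulmxDl !mulmxDr -!scalemxAl -!scalemxAr.
rewrite !linearD/= !linearZ/=.
have -> : \tr (B *m A^T) = \tr (A *m B^T) by rewrite -mxtrace_tr trmx_mul trmxK.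
by set a := \tr _; set b := \tr _; set c := \tr _ => h; rewrite (le_trans h)//; lra.
Qed.

Lemma psd_cauchy_schwarz n (A : 'M[R]_n) (v w : 'rV_n) : psd A -> A^T = A ->
  ((v *m A *m w^T) 0 0) ^+ 2 <= (v *m A *m v^T) 0 0 * (w *m A *m w^T) 0 0.
Proof.
move=> psdA symA; apply: discriminant_le => t.
have := psdA (v + t *: w).
rewrite linearD/= linearZ/= !mulmxDl !mulmxDr -!scalemxAl -!scalemxAr.
have -> : w *m A *m v^T = v *m A *m w^T.
  rewrite [RHS]mx11_scalar -tr_scalar_mx -mx11_scalar.
  by rewrite !trmx_mul trmxK symA mulmxA.
move=> h; rewrite (le_trans h)// !mxE.
set a := \sum_j _; set b := \sum_j _; set c := \sum_j _.
by rewrite le_eqVlt; apply/orP; left; apply/eqP; ring.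
Qed.

Lemma norm_le1D (t u : R) : t ^+ 2 <= u -> `|t| <= 1 + u.
Proof. by move=> tu; rewrite ler_norml; apply/andP; split; nra. Qed.

Lemma psd_gram m n (V : 'M[R]_(m, n)) : psd (V *m V^T).
Proof.
move=> v; rewrite mulmxA -mulmxA -trmx_mul mxE; apply: sumr_ge0 => i _.
by rewrite [_^T _ _]mxE -expr2 sqr_ge0.
Qed.

Lemma trmx_gram m n (V : 'M[R]_(m, n)) : (V *m V^T)^T = V *m V^T.
Proof. by rewrite trmx_mul trmxK. Qed.

Lemma mxtrace_psd_conj_ge0 m n (A : 'M[R]_n) (B : 'M[R]_(m, n)) :
  psd A -> 0 <= \tr (B *m A *m B^T).
Proof.
move=> psdA; apply: sumr_ge0 => i _.
suff -> : (B *m A *m B^T) i i = (row i B *m A *m (row i B)^T) 0 0 by exact: psdA.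
by rewrite -row_mul [LHS]mxE [RHS]mxE; apply: eq_bigr => j _; congr (_ * _); rewrite !mxE.
Qed.

Definition orthoproj n (P : 'M[R]_n) := P^T = P /\ P *m P = P.

Lemma orthoprojB n (P : 'M[R]_n) : orthoproj P -> orthoproj (1%:M - P).
Proof.
move=> [symP idP]; split; first by rewrite linearB/= tr_scalar_mx symP.
by rewrite mulmxBl !mulmxBr !mul1mx mulmx1 idP subrr subr0.
Qed.

Lemma mxtrace_orthoproj_conj n (P A : 'M[R]_n) : orthoproj P ->
  \tr (P *m A *m P^T) = \tr (P *m A).
Proof.
by move=> [symP idP]; rewrite symP -mulmxA mxtrace_mulC -mulmxA idP mxtrace_mulC.
Qed.

Lemma mxtrace_orthoproj_psd_le n (P A A0 : 'M[R]_n) : orthoproj P ->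
  psd (A0 - A) -> \tr (P *m A) <= \tr (P *m A0).
Proof.
move=> projP psdA; rewrite -subr_ge0 -linearB/= -mulmxBr.
by rewrite -mxtrace_orthoproj_conj// mxtrace_psd_conj_ge0.
Qed.

(** With the rows of [U] a basis of the row space of V^T, the projection is U^T (U U^T)^-1 U. The
    Gram matrix U U^T is invertible because v U U^T = 0 forces |v U|^2 = 0. *)
Lemma orthoproj_colspace m n (V : 'M[R]_(m, n)) : exists P : 'M[R]_m,
  [/\ orthoproj P, \tr P = (\rank V)%:R & P *m V = V].
Proof.
have [r [U [freeU VU ->]]] : exists r (U : 'M[R]_(r, m)),
    [/\ row_free U, (V^T <= U)%MS & \rank V = r].
  by exists (\rank V^T), (row_base V^T); rewrite row_base_free eq_row_base mxrank_tr.
pose W := U *m U^T.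
have Wunit : W \in unitmx.
  rewrite -row_free_unit -kermx_eq0; apply/rowV0P => v /sub_kermxP vW0.
  have : v *m U = 0.
    apply: mxtrace_mul_tr_eq0.
    by rewrite trmx_mul mulmxA -(mulmxA v) -/W vW0 mul0mx mxtrace0.
  by move/eqP; rewrite mulmx_free_eq0// => /eqP.
have symW : (invmx W)^T = invmx W by rewrite trmx_inv /W trmx_gram.
exists (U^T *m invmx W *m U); split.
- split; first by rewrite !trmx_mul trmxK symW mulmxA.
  by rewrite !mulmxA -(mulmxA _ U) -/W mulmxKV.
- by rewrite mxtrace_mulC mulmxA mulmxV// mxtrace1.
- have /submxP[E VE] := VU.
  have -> : V = U^T *m E^T by rewrite -trmx_mul -VE trmxK.
  by rewrite mulmxA -(mulmxA _ U) -/W mulmxKV.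
Qed.

Lemma mxtrace_orthoproj_sqr_le n (P A : 'M[R]_n) : orthoproj P -> A^T = A ->
  (\tr (P *m A)) ^+ 2 <= \tr P * \tr (A *m A).
Proof.
move=> [symP idP] symA.
by have := mxtrace_cauchy_schwarz P A; rewrite symP symA idP.
Qed.

(** This is G^2 <= tr(G) G for G = V V^T. With d = c V, the left side is the sum of the squared
    products of d with the rows of V, and Cauchy-Schwarz is applied to each row. *)
Lemma gram_sqr_le m n (V : 'M[R]_(m, n)) (c : 'rV_m) :
  (c *m (V *m V^T) *m (V *m V^T) *m c^T) 0 0 <=
  \tr (V *m V^T) * (c *m (V *m V^T) *m c^T) 0 0.
Proof.
have trE (B : 'M[R]_1) : B 0 0 = \tr B by rewrite -trace_mx11.
pose d := c *m V.
have -> : c *m (V *m V^T) *m c^T = d *m d^T by rewrite /d trmx_mul !mulmxA.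
have -> : c *m (V *m V^T) *m (V *m V^T) *m c^T = (d *m V^T) *m (d *m V^T)^T.
  by rewrite /d !trmx_mul trmxK !mulmxA.
rewrite trE (mxtrace_mul_tr (d *m V^T)) big_ord1 [(d *m d^T) 0 0]trE [\tr (V *m V^T)]/mxtrace mulr_suml.
apply: ler_sum => i _.
have -> : (d *m V^T) 0 i = \tr (d *m (row i V)^T).
  by rewrite -trE !mxE; apply: eq_bigr => j _; rewrite !mxE.
rewrite -expr2 (le_trans (mxtrace_cauchy_schwarz _ _))// mulrC.
rewrite le_eqVlt; apply/orP; left; apply/eqP; congr (_ * _).
by rewrite -trE !mxE; apply: eq_bigr => j _; rewrite !mxE.
Qed.

Section Pivoting.
Variables (X : eqType) (D : X -> Prop) (N M : nat) (c : X -> 'rV[R]_N) (V : 'M[R]_(N, M)).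

(* Holds for c(x) a row of functions that are orthonormal for a probability measure carried
   by D, since then tr A is the mean of c(x) A c(x)^T. *)
Definition averaging := forall (A : 'M[R]_N) (t : R),
  (forall x, D x -> (c x *m A *m (c x)^T) 0 0 <= t) -> \tr A <= t.

(* The row c(x) V encodes the function K(x, .), and a pair (xi, a) in s stands for the term
   u(x) K(xi, .) with u(x) = c(x) a. *)
Definition residual (s : seq (X * 'cV[R]_N)) : 'M[R]_(N, M) :=
  V - (\sum_(p <- s) p.2 *m c p.1) *m V.

Definition bounded_coefs (b : R) (s : seq (X * 'cV[R]_N)) := forall p, p \in s ->
  D p.1 /\ forall x, D x -> `|(c x *m p.2) 0 0| <= b.

Hypothesis avg : averaging.
Variable kappa : R.
Hypothesis kappaP : forall x, D x -> (c x *m (V *m V^T) *m (c x)^T) 0 0 <= kappa.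

(** A step at [xi] lowers the trace by w/q, where w = |G c(xi)^T|^2 and q is the pivot; on average w
    and q are S = tr G^2 and T = tr G. Cauchy-Schwarz against [P] gives S/T >= T/(4p), and half of
    this gain is given up to keep the pivot away from 0. *)
Lemma pivot_exists (W : 'M[R]_(N, M)) (P : 'M[R]_N) (p tau : R) :
  psd (V *m V^T - W *m W^T) -> orthoproj P -> \tr P <= p -> 0 < p -> 0 < tau ->
  \tr ((1%:M - P) *m (V *m V^T)) <= tau -> 2 * tau < \tr (W *m W^T) ->
  let G := W *m W^T in
  exists xi, [/\ D xi, tau / (8 * p) <= (c xi *m G *m (c xi)^T) 0 0 &
    (\tr G) / (8 * p) * (c xi *m G *m (c xi)^T) 0 0 <= (c xi *m G *m G *m (c xi)^T) 0 0].
Proof.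
move=> psdW projP trP p0 tau0 tail Tgt G.
set T := \tr (W *m W^T) in Tgt.
have T0 : 0 < T by nra.
pose S := \tr (G *m G).
have symG : G^T = G by exact: trmx_gram.
(* The part of G off [P] has trace at most [tau], because G is dominated by V V^T. As T > 2 tau,
   more than half of the trace lies on [P]. *)
have PG : T - tau <= \tr (P *m G).
  have := le_trans (mxtrace_orthoproj_psd_le (orthoprojB projP) psdW) tail.
  by rewrite mulmxBl mul1mx linearB/= -/G -/T; lra.
have S_ge : T ^+ 2 / 4 <= p * S.
  have S0 : 0 <= S by rewrite /S -{2}symG mxtrace_mul_tr_ge0.
  have := mxtrace_orthoproj_sqr_le projP symG; rewrite -/S => h.
  have : \tr P * S <= p * S by rewrite ler_wpM2r.
  nra.
have S0 : 0 < S by nra.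
(* Averaging q (w/q - rho/2) keeps half of the mean S of w = |G c(x)^T|^2 while forcing the
   pivot q = c(x) G c(x)^T to be at least of size rho. *)
pose rho := S / T.
have rho0 : 0 < rho by rewrite divr_gt0.
pose A := G *m G - (rho / 2) *: G.
have trA : \tr A = S / 2.
  by rewrite linearB/= linearZ/= -/S -/T /rho; field; rewrite gt_eqF.
have [xi Dxi] : exists2 xi, D xi & S / 4 < (c xi *m A *m (c xi)^T) 0 0.
  apply: contrapT => /forall2NP H.
  have : \tr A <= S / 4.
    apply: avg => x Dx; rewrite leNgt; apply/negP => lt.
    by case: (H x).
  by rewrite trA; lra.
rewrite /A mulmxBr mulmxBl -scalemxAr -scalemxAl mulmxA.
rewrite [X in _ < X]mxE [X in _ < _ + X]mxE [X in _ < _ - X]mxE.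
(* The inequality w <= T q turns the lower bound S/4 on w into the lower bound rho/4 on the
   pivot. *)
have := gram_sqr_le W (c xi); rewrite -/G -/T.
set q := (c xi *m G *m (c xi)^T) 0 0; set w := (_ *m G *m G *m _) 0 0.
move=> wq lt.
have q0 : 0 <= q by exact: psd_gram.
have rhoT : rho * T = S by rewrite /rho divfK// gt_eqF.
have rhoge : T / (4 * p) <= rho.
  by rewrite ler_pdivrMr ?mulr_gt0// -(ler_pM2r T0); nra.
have qge : rho / 4 <= q by rewrite -(ler_pM2r T0); nra.
exists xi; split=> //; rewrite -/q -/w.
- rewrite (le_trans _ qge)// -(ler_pM2r (ltr0n _ 4)) divfK ?pnatr_eq0//.
  rewrite (le_trans _ rhoge)//.
  rewrite [_ / (8 * p) * 4](_ : _ = (2 * tau) / (4 * p)); last by field; rewrite gt_eqF.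
  by rewrite ler_pM2r ?invr_gt0 ?mulr_gt0// ltW.
- apply: (@le_trans _ _ (rho / 2 * q)); last by nra.
  have -> : T / (8 * p) = T / (4 * p) / 2 by field; rewrite gt_eqF.
  by rewrite ler_wpM2r// ler_pM2r ?invr_gt0.
Qed.

(** The column [b] holds the coefficients of the orthogonal projection of the rows of [W] onto the
    row v W, so the new Gram matrix is the Schur complement of G at [v]. *)
Lemma gram_pivot (W : 'M[R]_(N, M)) (v : 'rV_N) : let G := W *m W^T in
  let q := (v *m G *m v^T) 0 0 in let b := q^-1 *: (G *m v^T) in q != 0 ->
  (W - b *m (v *m W)) *m (W - b *m (v *m W))^T = G - q^-1 *: (G *m v^T *m (v *m G)).
Proof.
move=> G q b q0; have symG : G^T = G by exact: trmx_gram.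
have bq : b *m (v *m G *m v^T) = G *m v^T.
  by rewrite [v *m G *m v^T]mx11_scalar -/q mul_mx_scalar /b scalerA mulfV// scale1r.
have vG : b *m (v *m G) = q^-1 *: (G *m v^T *m (v *m G)) by rewrite -scalemxAl.
have Gv : (G *m v^T) *m b^T = q^-1 *: (G *m v^T *m (v *m G)).
  by rewrite /b linearZ/= -scalemxAr trmx_mul trmxK symG.
have Wd : W *m (v *m W)^T = G *m v^T by rewrite trmx_mul mulmxA.
have dW : (v *m W) *m W^T = v *m G by rewrite -mulmxA.
have dd : (v *m W) *m (v *m W)^T = v *m G *m v^T by rewrite -mulmxA Wd mulmxA.
rewrite linearB/= [(b *m _)^T]trmx_mul mulmxBl !mulmxBr -/G.
rewrite (mulmxA W) Wd Gv -(mulmxA b _ W^T) dW vG -(mulmxA b) (mulmxA (v *m W)) dd (mulmxA b) bq Gv.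
by rewrite subrr subr0.
Qed.

(** The subtracted term involves the current residual at [xi], which is itself a combination of [V]
    at [xi] and at the earlier points. Expanding it corrects every earlier coefficient column by a
    multiple of [b], at the price of a factor 1 + L in the bound. *)
Lemma residual_pivot (s : seq (X * 'cV[R]_N)) (B L : R) (xi : X) (b : 'cV_N) :
  bounded_coefs B s -> D xi -> (forall x, D x -> `|(c x *m b) 0 0| <= L) -> 1 <= B ->
  exists s', [/\ size s' = (size s).+1, bounded_coefs (B * (1 + L)) s' &
    residual s' = residual s - b *m (c xi *m residual s)].
Proof.
move=> Bs Dxi bL B1.
have L0 : 0 <= L by rewrite (le_trans _ (bL _ Dxi)).
exists ((xi, b) :: [seq (p.1, p.2 - (c xi *m p.2) 0 0 *: b) | p <- s]); split.
- by rewrite /= size_map.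
- move=> p; rewrite inE => /orP[/eqP ->/=|/mapP[u us ->/=]].
    by split=> // x Dx; rewrite (le_trans (bL x Dx))//; nra.
  have [Du uB] := Bs _ us; split=> // x Dx.
  rewrite mulmxBr -scalemxAr mxE [X in _ + X]mxE [X in _ - X]mxE.
  rewrite (le_trans (ler_normB _ _))// normrM mulrDr mulr1 lerD ?uB//.
  by rewrite ler_pM// ?uB// bL.
- rewrite /residual big_cons big_map/=.
  have -> : \sum_(p <- s) (p.2 - (c xi *m p.2) 0 0 *: b) *m c p.1 =
     \sum_(p <- s) p.2 *m c p.1 - b *m (c xi *m (\sum_(p <- s) p.2 *m c p.1)).
    rewrite !mulmx_sumr -sumrB; apply: eq_bigr => p _.
    rewrite mulmxBl; congr (_ - _); rewrite (mulmxA (c xi)) [c xi *m p.2]mx11_scalar.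
    by rewrite mul_scalar_mx mxE eqxx mulr1n -scalemxAl -scalemxAr.
  set Z := \sum_(p <- s) _; rewrite mulmxDl mulmxBl !mulmxBr !mulmxA.
  by rewrite !opprD !opprK !addrA; rewrite [V - b *m c xi *m V - _]addrAC.
Qed.

(** The new coefficient function at x is G(x, xi)/q. Its square is at most G(x, x)/q by
    Cauchy-Schwarz, hence at most kappa divided by the lower bound tau/(8p) of the pivot. The
    domination of the residual Gram matrix by V V^T is kept as an invariant, since both the tail and
    the bound [kappa] are known for [V] only. *)
Lemma greedy_step (s : seq (X * 'cV[R]_N)) (P : 'M[R]_N) (p tau B : R) :
  psd (V *m V^T - residual s *m (residual s)^T) -> orthoproj P -> \tr P <= p -> 0 < p ->
  0 < tau -> \tr ((1%:M - P) *m (V *m V^T)) <= tau ->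
  2 * tau < \tr (residual s *m (residual s)^T) ->
  bounded_coefs B s -> 1 <= B ->
  exists s', [/\ size s' = (size s).+1,
    bounded_coefs (B * (2 + 8 * p * kappa / tau)) s',
    psd (V *m V^T - residual s' *m (residual s')^T) &
    \tr (residual s' *m (residual s')^T) <=
      (1 - (8 * p)^-1) * \tr (residual s *m (residual s)^T)].
Proof.
move=> psdW projP trP p0 tau0 tail Tgt Bs B1.
have [xi [Dxi qge dec]] := pivot_exists psdW projP trP p0 tau0 tail Tgt.
set W := residual s in psdW Tgt qge dec *.
set G := W *m W^T in psdW Tgt qge dec *; set q := (c xi *m G *m _) 0 0 in qge dec.
have q0 : 0 < q by rewrite (lt_le_trans _ qge)// divr_gt0// mulr_gt0.
pose b := q^-1 *: (G *m (c xi)^T).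
have symG : G^T = G by exact: trmx_gram.
have bL x : D x -> `|(c x *m b) 0 0| <= 1 + 8 * p * kappa / tau.
  move=> Dx.
  have Gk : (c x *m G *m (c x)^T) 0 0 <= kappa.
    rewrite (le_trans _ (kappaP Dx))// -subr_ge0.
    by have := psdW (c x); rewrite mulmxBr mulmxBl [X in 0 <= X]mxE [X in 0 <= _ + X]mxE.
  have k0 : 0 <= kappa by rewrite (le_trans _ Gk)//; exact: psd_gram.
  have := psd_cauchy_schwarz (c x) (c xi) (@psd_gram _ _ W) symG; rewrite -/G -/q.
  have -> : (c x *m G *m (c xi)^T) 0 0 = (c x *m b) 0 0 * q.
    rewrite /b -scalemxAr [X in _ = X * _]mxE mulrAC mulVf ?gt_eqF// mul1r.
    by rewrite (mulmxA (c x) G).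
  set t := (c x *m b) 0 0 => CS.
  have t2 : t ^+ 2 * q <= kappa.
    rewrite -(ler_pM2r q0) (le_trans _ (ler_wpM2r (ltW q0) Gk))// (le_trans _ CS)//.
    by rewrite exprMn -mulrA -expr2.
  have t2' : t ^+ 2 * (tau / (8 * p)) <= kappa.
    by rewrite (le_trans _ t2)// ler_wpM2l// sqr_ge0.
  set u := 8 * p * kappa / tau.
  have t2'' : t ^+ 2 <= u.
    move: t2'; rewrite mulrA ler_pdivrMr ?mulr_gt0// => h.
    by rewrite /u ler_pdivlMr// (le_trans h)// mulrC.
  have u0 : 0 <= u by rewrite (le_trans _ t2'')// sqr_ge0.
  exact: norm_le1D.
have [s' [sz Bs' resE]] := residual_pivot Bs Dxi bL B1.
have gramE : residual s' *m (residual s')^T = G - q^-1 *: (G *m (c xi)^T *m (c xi *m G)).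
  by rewrite resE gram_pivot// gt_eqF.
have -> : 2 + 8 * p * kappa / tau = 1 + (1 + 8 * p * kappa / tau) by ring.
exists s'; split; [exact: sz|exact: Bs'| |].
- rewrite gramE opprB addrCA addrC => v.
  rewrite mulmxDr mulmxDl mxE addr_ge0//.
  rewrite -scalemxAr -scalemxAl mxE; apply: mulr_ge0; first by rewrite invr_ge0 ltW.
  have -> : G *m (c xi)^T *m (c xi *m G) = (G *m (c xi)^T) *m (G *m (c xi)^T)^T.
    by rewrite [in RHS]trmx_mul trmxK symG.
  exact: psd_gram.
- rewrite gramE linearB/= linearZ/=.
  have -> : \tr (G *m (c xi)^T *m (c xi *m G)) = (c xi *m G *m G *m (c xi)^T) 0 0.
    by rewrite mxtrace_mulC -trace_mx11 !mulmxA.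
  by rewrite mulrBl mul1r lerD2l lerN2 [leLHS]mulrC [leRHS]mulrC ler_pdivlMr.
Qed.

(** The disjunction records an early stop: below 2 tau no good pivot is guaranteed, and the
    remaining steps leave [s] unchanged. The coefficient bound stays valid because each factor is at
    least 1. *)
Lemma greedy_iter (P : 'M[R]_N) (p tau B T0 : R) (k : nat) (s : seq (X * 'cV[R]_N)) :
  psd (V *m V^T - residual s *m (residual s)^T) -> orthoproj P -> \tr P <= p -> 1 <= p ->
  0 < tau -> \tr ((1%:M - P) *m (V *m V^T)) <= tau -> 0 <= kappa ->
  \tr (residual s *m (residual s)^T) <= T0 ->
  bounded_coefs B s -> 1 <= B ->
  exists s', [/\ (size s' <= size s + k)%N,
    bounded_coefs (B * (2 + 8 * p * kappa / tau) ^+ k) s',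
    psd (V *m V^T - residual s' *m (residual s')^T) &
    \tr (residual s' *m (residual s')^T) <= 2 * tau \/
    \tr (residual s' *m (residual s')^T) <= (1 - (8 * p)^-1) ^+ k * T0].
Proof.
move=> psdW projP trP p1 tau0 tail k0 TT0 Bs B1.
have p0 : 0 < p by lra.
set L := 2 + _.
have L1 : 1 <= L by rewrite /L (_ : 8 * p * kappa / tau = 8 * p * (kappa / tau)) ?mulrA//;
  have : 0 <= kappa / tau by [rewrite divr_ge0// ltW]; nra.
elim: k => [|k [s1 [sz1 B1s psd1 [done1|T1]]]].
- by exists s; split; rewrite ?addn0 ?expr0 ?mulr1//; right; rewrite mul1r.
- exists s1; split=> //; last by left.
    by rewrite (leq_trans sz1)// addnS.
  move=> u us; have [Du uB] := B1s u us; split=> // x Dx.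
  rewrite (le_trans (uB x Dx))// ler_pM2l; last lra.
  by rewrite exprS ler_peMl// exprn_ge0//; lra.
- have [le|gt] := leP (\tr (residual s1 *m (residual s1)^T)) (2 * tau).
    exists s1; split=> //; last by left.
      by rewrite (leq_trans sz1)// addnS.
    move=> u us; have [Du uB] := B1s u us; split=> // x Dx.
    rewrite (le_trans (uB x Dx))// ler_pM2l; last lra.
    by rewrite exprS ler_peMl// exprn_ge0//; lra.
  have BL1 : 1 <= B * L ^+ k by rewrite mulr_ege1// exprn_ege1.
  have [s2 [sz2 B2s psd2 T2]] := greedy_step psd1 projP trP p0 tau0 tail gt B1s BL1.
  exists s2; split=> //; first by rewrite sz2 addnS ltnS.
    by rewrite exprSr mulrA.
  right; rewrite (le_trans T2)// exprS -mulrA ler_wpM2l// subr_ge0.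
  by rewrite invf_le1 ?mulr_gt0//; lra.
Qed.

(** The form (1 - x)^k <= 1/(1 + k x) of exponential decay is enough, because each level lowers the
    trace by a fixed ratio only. *)
Lemma expr_one_minus_le (x : R) k : 0 <= x -> x <= 1 -> (1 - x) ^+ k * (1 + k%:R * x) <= 1.
Proof.
move=> x0 x1; elim: k => [|k IH]; first by rewrite expr0 mul0r addr0 mul1r.
have h : 0 <= (1 - x) ^+ k by rewrite exprn_ge0// subr_ge0.
have k0 : 0 <= k%:R :> R by [].
have kx : 0 <= k%:R * x by rewrite mulr_ge0.
rewrite (le_trans _ IH)// exprSr -mulrA ler_wpM2l// -natr1.
nra.
Qed.

(** After 8 r p steps with factor 1 - 1/(8p) the trace has shrunk by at least 1 + r, which more than
    compensates the initial excess [r]. *)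
Lemma greedy_level (P : 'M[R]_N) (p : nat) (r : nat) (tau B : R) (s : seq (X * 'cV[R]_N)) :
  psd (V *m V^T - residual s *m (residual s)^T) -> orthoproj P -> \tr P <= p%:R ->
  (0 < p)%N -> 0 < tau -> \tr ((1%:M - P) *m (V *m V^T)) <= tau -> 0 <= kappa ->
  \tr (residual s *m (residual s)^T) <= r%:R * (2 * tau) ->
  bounded_coefs B s -> 1 <= B ->
  exists s', [/\ (size s' <= size s + 8 * r * p)%N,
    bounded_coefs (B * (2 + 8 * p%:R * kappa / tau) ^+ (8 * r * p)) s',
    psd (V *m V^T - residual s' *m (residual s')^T) &
    \tr (residual s' *m (residual s')^T) <= 2 * tau].
Proof.
move=> psdW projP trP p0 tau0 tail k0 T0 Bs B1.
have p1 : 1 <= p%:R :> R by rewrite ler1n.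
have [s' [sz Bs' psd' T']] := greedy_iter (8 * r * p) psdW projP trP p1 tau0 tail k0 T0 Bs B1.
exists s'; split=> //; case: T' => // T'; rewrite (le_trans T')//.
have x0 : 0 <= (8 * p%:R)^-1 :> R by rewrite invr_ge0; lra.
have x1 : (8 * p%:R)^-1 <= 1 :> R by rewrite invf_le1; lra.
have := expr_one_minus_le (8 * r * p) x0 x1.
have -> : (8 * r * p)%:R * (8 * p%:R)^-1 = r%:R :> R.
  by rewrite !natrM; field; rewrite pnatr_eq0 -lt0n.
set z := (1 - _) ^+ _ => zr.
have z0 : 0 <= z by rewrite exprn_ge0// subr_ge0.
nra.
Qed.

End Pivoting.

(* B depends neither on the dimensions N, M nor on V: this allows the truncation of the
   Fourier series to be refined after B is known. *)
Lemma greedy_levels (kappa : R) (r : nat) (p : nat -> nat) (tau : nat -> R) (J : nat) :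
  0 <= kappa -> (forall j, (0 < p j)%N) -> (forall j, 0 < tau j) ->
  (forall j, tau j <= r%:R * tau j.+1) ->
  exists B : R, forall (X : eqType) (D : X -> Prop) (N M : nat) (c : X -> 'rV[R]_N)
    (V : 'M[R]_(N, M)),
  averaging D c -> (forall x, D x -> (c x *m (V *m V^T) *m (c x)^T) 0 0 <= kappa) ->
  (forall j, (j <= J)%N -> exists P, [/\ orthoproj P, \tr P <= (p j)%:R &
    \tr ((1%:M - P) *m (V *m V^T)) <= tau j]) ->
  \tr (V *m V^T) <= 2 * tau 0 ->
  exists s, [/\ (size s <= \sum_(1 <= j < J.+1) 8 * r * p j)%N,
    bounded_coefs D c B s &
    \tr (residual c V s *m (residual c V s)^T) <= 2 * tau J].
Proof.
move=> k0 p0 tau0 tauS.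
(* The induction on the level also carries B >= 1 and the domination of the residual Gram matrix,
   both needed to start the next level. *)
suff [B [B1 H]] : exists B : R, 1 <= B /\ forall (X : eqType) (D : X -> Prop) (N M : nat)
    (c : X -> 'rV[R]_N) (V : 'M[R]_(N, M)),
  averaging D c -> (forall x, D x -> (c x *m (V *m V^T) *m (c x)^T) 0 0 <= kappa) ->
  (forall j, (j <= J)%N -> exists P, [/\ orthoproj P, \tr P <= (p j)%:R &
    \tr ((1%:M - P) *m (V *m V^T)) <= tau j]) ->
  \tr (V *m V^T) <= 2 * tau 0 ->
  exists s, [/\ (size s <= \sum_(1 <= j < J.+1) 8 * r * p j)%N,
    bounded_coefs D c B s, psd (V *m V^T - residual c V s *m (residual c V s)^T) &
    \tr (residual c V s *m (residual c V s)^T) <= 2 * tau J].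
  exists B => X D N M c V avg kV proj tr0.
  by have [s [sz Bs _ T]] := H X D N M c V avg kV proj tr0; exists s.
elim: J => [|J [B [B1 IH]]].
  exists 1; split=> // X D N M c V avg kV proj tr0; exists [::].
  have -> : residual c V [::] = V by rewrite /residual big_nil mul0mx subr0.
  by split=> //; rewrite subrr => v; rewrite mulmx0 mul0mx mxE.
exists (B * (2 + 8 * (p J.+1)%:R * kappa / tau J.+1) ^+ (8 * r * p J.+1)); split.
  rewrite mulr_ege1// exprn_ege1//.
  have : 0 <= 8 * (p J.+1)%:R * kappa / tau J.+1 by rewrite divr_ge0 ?mulr_ge0// ltW.
  lra.
move=> X D N M c V avg kV proj tr0.
have [|s [sz Bs psds T]] := IH X D N M c V avg kV _ tr0.
  by move=> j jJ; apply: proj; rewrite leqW.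
have [P [projP trP tail]] := proj J.+1 (leqnn _).
have T' : \tr (residual c V s *m (residual c V s)^T) <= r%:R * (2 * tau J.+1).
  by rewrite (le_trans T)// mulrCA ler_pM2l.
have [s' [sz' Bs' psd' T'']] := greedy_level avg kV psds projP trP (p0 _) (tau0 _) tail k0 T' Bs B1.
exists s'; split=> //; rewrite (leq_trans sz')// big_nat_recr//=.
by rewrite leq_add2r.
Qed.

Lemma mxtrace_orthoproj_gram_ge0 m n (P : 'M[R]_m) (V : 'M[R]_(m, n)) : orthoproj P ->
  0 <= \tr (P *m (V *m V^T)).
Proof.
move=> projP; rewrite -mxtrace_orthoproj_conj//.
exact: mxtrace_psd_conj_ge0 (psd_gram V).
Qed.

Lemma rank_row_support m n (V : 'M[R]_(m, n)) (A : {set 'I_m}) :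
  (forall i j, i \notin A -> V i j = 0) -> (\rank V <= #|A|)%N.
Proof.
move=> V0.
have -> : V = (\matrix_(i < m, k < #|A|) (i == enum_val k)%:R) *m
              (\matrix_(k < #|A|, j < n) V (enum_val k) j).
  apply/matrixP => i j; rewrite mxE.
  have [iA|iA] := boolP (i \in A).
    rewrite (bigD1 (enum_rank_in iA i))//= big1 => [|k ki].
      by rewrite !mxE enum_rankK_in// eqxx mul1r addr0.
    rewrite !mxE; case: eqP => [e|]; rewrite ?mul0r//.
    by have ek := enum_valK_in iA k; move: ki; rewrite -{1}ek -e eqxx.
  rewrite V0// big1// => k _; rewrite !mxE; case: eqP => [e|]; rewrite ?mul0r//.
  by move: iA; rewrite e enum_valP.
exact: mulmx_max_rank.
Qed.

(** The rows in [A], and in the other rows the columns in [A'], form a matrix of rank at most #|A| +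
    #|A'|, and [P] projects onto its column space. What remains carries both small weights at once,
    so the decay of the two variables multiplies; this is the origin of the exponent r1 + r2. *)
Lemma orthoproj_weighted m n (w : 'I_m -> R) (w' : 'I_n -> R) (Phi : 'M[R]_(m, n))
    (A : {set 'I_m}) (A' : {set 'I_n}) (a a' : R) :
  \tr (Phi *m Phi^T) <= 1 -> (forall i, 0 <= w i) -> (forall j, 0 <= w' j) ->
  (forall i, i \notin A -> w i <= a) -> (forall j, j \notin A' -> w' j <= a') ->
  let V := \matrix_(i, j) (w i * Phi i j * w' j) in
  exists P, [/\ orthoproj P, \tr P <= (#|A| + #|A'|)%:R &
    \tr ((1%:M - P) *m (V *m V^T)) <= (a * a') ^+ 2].
Proof.
move=> Phi1 w0 w'0 wA wA' V.
pose V1 := \matrix_(i, j) (if i \in A then V i j else 0).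
pose V2 := \matrix_(i, j) (if (i \notin A) && (j \in A') then V i j else 0).
pose E := \matrix_(i, j) (if (i \notin A) && (j \notin A') then V i j else 0).
have VE : V = (V1 + V2) + E.
  apply/matrixP => i j; rewrite [RHS]mxE [X in _ = X + _]mxE [V1 i j]mxE [V2 i j]mxE [E i j]mxE.
  by case: (i \in A); case: (j \in A') => /=; rewrite ?addr0 ?add0r.
have [P [projP trP PV]] := orthoproj_colspace (V1 + V2).
exists P; split=> //.
  rewrite trP ler_nat (leq_trans (mxrank_add _ _))// leq_add//.
    by apply: rank_row_support => i j /negbTE iA; rewrite mxE iA.
  rewrite -mxrank_tr; apply: rank_row_support => i j /negbTE iA.
  by rewrite !mxE iA andbF.
have projQ := orthoprojB projP; set Q := 1%:M - P in projQ *.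
have QV : Q *m V = Q *m E.
  by rewrite VE mulmxDr [Q *m (V1 + V2)]mulmxBl mul1mx PV subrr add0r.
have -> : \tr (Q *m (V *m V^T)) = \tr (Q *m (E *m E^T)).
  have h (B : 'M[R]_(m, n)) : \tr (Q *m (B *m B^T)) = \tr ((Q *m B) *m (Q *m B)^T).
    by rewrite -mxtrace_orthoproj_conj// [in RHS]trmx_mul !mulmxA.
  by rewrite !h QV.
apply: (@le_trans _ _ (\tr (E *m E^T))).
  by rewrite mulmxBl mul1mx linearB/= lerBlDr lerDl mxtrace_orthoproj_gram_ge0.
have sq0 : 0 <= (a * a') ^+ 2 by rewrite sqr_ge0.
rewrite -[leRHS]mulr1 (le_trans _ (ler_wpM2l sq0 Phi1))//.
rewrite !mxtrace_mul_tr mulr_sumr ler_sum// => i _; rewrite mulr_sumr ler_sum// => j _.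
rewrite !mxE; case: (boolP (i \in A)) => iA; first by rewrite mul0r mulr_ge0// -expr2 sqr_ge0.
case: (boolP (j \in A')) => jA; first by rewrite mul0r mulr_ge0// -expr2 sqr_ge0.
rewrite /= -!expr2 mulrAC exprMn ler_wpM2r ?sqr_ge0//.
have wwa : w i * w' j <= a * a' by rewrite ler_pM ?wA ?wA'.
have aa0 : 0 <= a * a' by rewrite (le_trans _ wwa)// mulr_ge0.
by rewrite lerXn2r// nnegrE// mulr_ge0.
Qed.

End LinearAlgebra.

(** * Counting in dyadic hyperbolic crosses *)

Section HyperbolicCross.
Local Open Scope nat_scope.

(** Index 0 is the constant function, and 2k - 1 and 2k are the cosine and the sine of frequency k.
    The constant is given frequency 1, hence weight 1 and dyadic level 0. *)
Definition freq (n : nat) : nat := maxn 1 (n.+1)./2.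
Definition dyadic (n : nat) : nat := trunc_log 2 (freq n).

Lemma freq_gt0 n : (0 < freq n)%N.
Proof. by rewrite leq_max. Qed.

Lemma dyadic_le n : (2 ^ dyadic n <= freq n)%N.
Proof. by rewrite trunc_logP// freq_gt0. Qed.

Lemma dyadic_lt n k : (dyadic n <= k)%N -> (n < 4 * 2 ^ k)%N.
Proof.
move=> nk; have : (freq n < 2 ^ k.+1)%N.
  by rewrite (leq_trans (@trunc_log_ltn 2 (freq n) isT))// leq_exp2l.
rewrite gtn_max => /andP[_]; rewrite expnS; lia.
Qed.

Lemma count_ord_lt M (P : pred 'I_M) b :
  (forall n, P n -> (n < b)%N) -> (\sum_n P n <= b)%N.
Proof.
move=> Pb; have [bM|Mb] := leqP M b.
  rewrite (leq_trans _ bM)// -[leqRHS]card_ord -sum1_card leq_sum// => i _.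
  by case: (P i).
rewrite -(big_mkcond _ (fun=> 1%N)) /= sum1_card.
rewrite -[leqRHS]card_ord.
pose g (i : 'I_b) : 'I_M := widen_ord (ltnW Mb) i.
have ginj : injective g by move=> i j /(congr1 val)/= /val_inj.
rewrite -(card_codom ginj) subset_leq_card//; apply/fintype.subsetP => n Pn.
by apply/codomP; exists (Ordinal (Pb _ Pn)); apply: val_inj.
Qed.

(* The first d levels are fixed to the profile g; the last one is then only bounded above,
   which costs a geometric sum instead of a further factor J + 1. *)
Lemma card_hyperbolic_cross d M J :
  (#|[pred f : {ffun 'I_d.+1 -> 'I_M} | (\sum_i dyadic (f i) <= J)%N]| <=
    4 ^ d.+1 * 2 ^ J * J.+1 ^ d)%N.
Proof.
pose h (g : {ffun 'I_d -> 'I_J.+1}) (i : 'I_d.+1) (n : 'I_M) : bool :=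
  if unlift ord_max i is Some j then dyadic n == g j
  else (dyadic n + \sum_j g j <= J)%N.
have hS g (i : 'I_d) n : h g (widen_ord (leqnSn d) i) n = (dyadic n == g i).
  have -> : widen_ord (leqnSn d) i = lift ord_max i.
    by apply: val_inj; rewrite /= /bump leqNgt ltn_ord.
  by rewrite /h liftK.
have hm g n : h g ord_max n = (dyadic n + \sum_j g j <= J)%N by rewrite /h unlift_none.
rewrite -sum1_card big_mkcond/=.
(* Each [f] in the cross is counted at least once, by the profile [g] of the levels of its first [d]
   coordinates. *)
apply: (@leq_trans (\sum_(g : {ffun 'I_d -> 'I_J.+1}) \sum_(f : {ffun 'I_d.+1 -> 'I_M})
    \prod_i (h g i (f i) : nat))%N).
  rewrite exchange_big/= leq_sum// => f _; rewrite inE; case: ifPn => // fJ.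
  have lt (i : 'I_d) : (dyadic (f (widen_ord (leqnSn d) i)) < J.+1)%N.
    rewrite ltnS (leq_trans _ fJ)//.
    by rewrite (bigD1 (widen_ord (leqnSn d) i))//= leq_addr.
  rewrite (bigD1 [ffun i => Ordinal (lt i)])//= big_ord_recr/= hm.
  rewrite big1 => [|i _]; last by rewrite hS ffunE/= eqxx.
  rewrite mul1n addnC; rewrite big_ord_recr/= in fJ.
  have -> : \sum_(j < d) [ffun i => Ordinal (lt i)] j
          = \sum_(i < d) dyadic (f (widen_ord (leqnSn d) i)).
    by apply: eq_bigr => i _; rewrite ffunE.
  by rewrite addnC [(dyadic _ + _)%N]addnC fJ.
apply: (@leq_trans (\sum_(g : {ffun 'I_d -> 'I_J.+1}) 4 ^ d.+1 * 2 ^ J)).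
  rewrite leq_sum// => g _.
  rewrite -(bigA_distr_bigA (fun i n => nat_of_bool (h g i n))) big_ord_recr/=.
  have [gJ|gJ] := leqP (\sum_j g j) J; last first.
    rewrite [X in (_ * X)%N]big1 ?muln0// => n _; rewrite hm.
    by rewrite leqNgt (leq_trans gJ)// leq_addl.
  (* The dyadic block sizes telescope: every admissible profile contributes the same 4^(d+1) 2^J,
     and there are (J+1)^d profiles. *)
  have -> : (4 ^ d.+1 * 2 ^ J = (\prod_(i < d) (4 * 2 ^ g i)) * (4 * 2 ^ (J - \sum_j g j)))%N.
    rewrite big_split/= prod_nat_const card_ord -expn_sum expnS.
    by rewrite -[in LHS](subnKC gJ) expnD [(4 * 4 ^ d)%N]mulnC mulnACA.
  rewrite leq_mul//.
    rewrite leq_prod// => i _; apply: count_ord_lt => n.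
    by rewrite hS => /eqP <-; exact: dyadic_lt.
  apply: count_ord_lt => n; rewrite hm => nJ; apply: dyadic_lt.
  by rewrite leq_subRL// addnC.
by rewrite sum_nat_const card_ffun !card_ord mulnC.
Qed.

End HyperbolicCross.

(** * The Bernoulli kernel and its partial sums *)

Section Kernel.
Context {R : realType}.
Implicit Types (a eps th u x y : R).

Lemma abel_sum (f g : nat -> R) n m : (n <= m)%N ->
  \sum_(n <= k < m) f k * g k = f m * (\sum_(n <= k < m) g k) +
    \sum_(n <= k < m) (f k - f k.+1) * (\sum_(n <= j < k.+1) g j).
Proof.
move=> nm; rewrite -(subnKC nm); elim: (m - n)%N => [|k IH].
  by rewrite addn0 !big_geq// mulr0 addr0.
rewrite addnS big_nat_recr ?leq_addr//= IH [in RHS]big_nat_recr ?leq_addr//=.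
rewrite [in X in _ = _ + X]big_nat_recr ?leq_addr//=.
rewrite [\sum_(n <= j < (n + k).+1) g j]big_nat_recr ?leq_addr//=.
by ring.
Qed.

(** Telescoping of 2 sin(u/2) cos v = sin(v + u/2) - sin(v - u/2). *)
Lemma cos_sum_sin n m th u : (n <= m)%N ->
  2 * sin (u / 2) * (\sum_(n <= k < m) cos (k%:R * u - th)) =
  sin (m%:R * u - u / 2 - th) - sin (n%:R * u - u / 2 - th).
Proof.
move=> nm; rewrite -(subnKC nm); elim: (m - n)%N => [|k IH].
  by rewrite addn0 big_geq// mulr0 subrr.
rewrite addnS big_nat_recr ?leq_addr//= mulrDr IH.
set v := (n + k)%:R * u - th.
have -> : (n + k)%:R * u - u / 2 - th = v - u / 2 by rewrite /v; ring.
have -> : (n + k).+1%:R * u - u / 2 - th = v + u / 2 by rewrite /v -natr1; field.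
rewrite (sinB v) (sinD v); ring.
Qed.

(** Interpolates between the trivial bound m and the bound 1/|sin(u/2)| of the closed form, by
    writing t = t^eps t^(1-eps). The second bound alone is not integrable in u; the power eps - 1
    is. *)
Lemma norm_cos_sum_le n m th u eps : (0 < n)%N -> (n <= m)%N -> 0 < eps -> eps < 1 ->
  sin (u / 2) != 0 ->
  `|\sum_(n <= k < m.+1) cos (k%:R * u - th)| <= m%:R `^ eps * `|sin (u / 2)| `^ (eps - 1).
Proof.
move=> n0 nm e0 e1 s0; set t := `|_|.
have tm : t <= m%:R.
  rewrite /t (le_trans (ler_norm_sum _ _ _))//.
  apply: (@le_trans _ _ (\sum_(n <= k < m.+1) 1)).
    by apply: ler_sum => k _; rewrite ler_norml cos_geN1 cos_le1.
  by rewrite sumr_const_nat ler_nat subSn// -subSn// leq_subLR; lia.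
have s_gt0 : 0 < `|sin (u / 2)| by rewrite normr_gt0.
have ts : t <= `|sin (u / 2)|^-1.
  rewrite -[leRHS]mul1r ler_pdivlMr//.
  have := @cos_sum_sin n m.+1 th u (leqW nm).
  move/(congr1 Num.norm); rewrite !normrM mulrAC -/t ger0_norm// => E.
  have : `|sin (m.+1%:R * u - u / 2 - th) - sin (n%:R * u - u / 2 - th)| <= 2.
    rewrite (le_trans (ler_normB _ _))// -[leRHS]/(1 + 1) lerD//;
    by rewrite ler_norml sin_geN1 sin_le1.
  by rewrite -E; lra.
have [->|t0] := eqVneq t 0; first by rewrite mulr_ge0// powR_ge0.
have t_ge0 : 0 <= t by rewrite /t.
have -> : t = t `^ eps * t `^ (1 - eps).
  by rewrite -powRD ?t0 ?implybT// addrC subrK powRr1.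
have -> : `|sin (u / 2)| `^ (eps - 1) = `|sin (u / 2)|^-1 `^ (1 - eps).
  by rewrite -(powR_inv1 (ltW s_gt0)) -powRrM mulN1r opprB.
rewrite ler_pM ?powR_ge0//; apply: ge0_ler_powR; rewrite ?nnegrE ?invr_ge0//; lra.
Qed.

(** With q = k/(k+1) and t = q^b the claim reduces to 1 - q^a <= C (1 - t), which follows from q^a
    >= t^C and Bernoulli's inequality. It makes the differences produced by Abel summation, once
    weighted by k^(a-b), telescope again. *)
Lemma powR_diff_le (a b : R) C k : 0 < b -> b < a -> a <= C%:R * b -> (0 < k)%N ->
  (k%:R `^ (- a) - k.+1%:R `^ (- a)) * k%:R `^ (a - b) <=
  C%:R * (k%:R `^ (- b) - k.+1%:R `^ (- b)).
Proof.
move=> b0 ba aC k0.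
have kR : 0 < k%:R :> R by rewrite ltr0n.
pose q : R := k%:R / k.+1%:R.
have q0 : 0 < q by rewrite divr_gt0.
have q1 : q <= 1 by rewrite ler_pdivrMr// mul1r ler_nat.
have kSE c : k.+1%:R `^ (- c) = k%:R `^ (- c) * q `^ c.
  rewrite [in RHS]powRM ?invr_ge0// mulrA -powRD ?pnatr_eq0 -?lt0n ?k0 ?implybT//.
  by rewrite addNr powRr0 mul1r -powR_inv1// -powRrM mulN1r.
rewrite !kSE.
have -> : (k%:R `^ (- a) - k%:R `^ (- a) * q `^ a) * k%:R `^ (a - b) =
   k%:R `^ (- b) * (1 - q `^ a).
  have -> : k%:R `^ (- b) = k%:R `^ (- a) * k%:R `^ (a - b) :> R.
    by rewrite -powRD ?pnatr_eq0 -?lt0n ?k0 ?implybT//; congr (_ `^ _); ring.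
  by ring.
have -> : C%:R * (k%:R `^ (- b) - k%:R `^ (- b) * q `^ b) =
   k%:R `^ (- b) * (C%:R * (1 - q `^ b)) by ring.
rewrite ler_wpM2l ?powR_ge0//.
set t := q `^ b.
have t0 : 0 <= t by rewrite powR_ge0.
have t1 : t <= 1.
  have <- : 1 `^ b = 1 :> R by rewrite powR1.
  by rewrite ge0_ler_powR ?nnegrE// ltW.
have qa : t ^+ C <= q `^ a.
  by rewrite -powR_mulrn// -powRrM ger_powR// ?q0// mulrC.
suff : 1 - t ^+ C <= C%:R * (1 - t) by lra.
elim: C {aC qa} => [|n IH]; first by rewrite expr0 mul0r subrr.
rewrite exprS -natr1; have : t ^+ n <= 1 by rewrite exprn_ile1.
nra.
Qed.

Lemma norm_cos_series_le (a eps : R) : 0 < eps -> eps < 1 -> eps < a ->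
  exists2 C : R, 1 <= C & forall th u n m, (0 < n)%N -> (n <= m)%N -> sin (u / 2) != 0 ->
  `|\sum_(n <= k < m) k%:R `^ (- a) * cos (k%:R * u - th)| <=
    C * n%:R `^ (- (a - eps)) * `|sin (u / 2)| `^ (eps - 1).
Proof.
move=> e0 e1 ea; have b0 : 0 < a - eps by lra.
pose C := (Num.trunc (a / (a - eps))).+1.
have aC : a <= C%:R * (a - eps).
  by rewrite -ler_pdivrMr// ltW// /C truncnS_gt.
exists C%:R; first by rewrite ler1n.
move=> th u n m n0 nm s0.
have m0 : (0 < m)%N by rewrite (leq_trans n0).
set g := `|sin _| `^ _; have g0 : 0 <= g by rewrite powR_ge0.
have decr k : (0 < k)%N -> 0 <= k%:R `^ (- a) - k.+1%:R `^ (- a).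
  move=> k0; rewrite subr_ge0 !powRN lef_pV2 ?posrE ?powR_gt0 ?ltr0n//.
  by rewrite ge0_ler_powR ?nnegrE// ?ler_nat//; lra.
rewrite abel_sum// (le_trans (ler_normD _ _))//.
(* The bound is split in the shape of Abel summation, as a boundary term plus a telescoping sum, and
   then compared term by term. *)
have -> : C%:R * n%:R `^ (- (a - eps)) * g =
   C%:R * m%:R `^ (- (a - eps)) * g +
   \sum_(n <= k < m) C%:R * (k%:R `^ (- (a - eps)) - k.+1%:R `^ (- (a - eps))) * g.
  rewrite -mulr_suml -mulr_sumr -mulrDl -mulrDr.
  by rewrite (telescope_sumr_eq (fun k => - (k%:R `^ (- (a - eps))))) ?opprK//
    => [|i _]; [congr (_ * _ * _); ring|ring].
rewrite lerD//.
- move: m0 nm; case: m => // m m0; rewrite leq_eqVlt => /orP[/eqP ->|].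
    by rewrite big_geq// mulr0 normr0 !mulr_ge0// powR_ge0.
  rewrite ltnS => nm.
  apply: (@le_trans _ _ (m.+1%:R `^ (- (a - eps)) * g)); last first.
    by rewrite -mulrA ler_peMl ?ler1n// mulr_ge0 ?powR_ge0.
  rewrite normrM ger0_norm ?powR_ge0//.
  have := norm_cos_sum_le th n0 nm e0 e1 s0; rewrite -/g => h.
  have -> : m.+1%:R `^ (- (a - eps)) * g = m.+1%:R `^ (- a) * (m.+1%:R `^ eps * g).
    rewrite mulrA -powRD ?pnatr_eq0 ?implybT//; congr (_ `^ _ * _); ring.
  rewrite ler_wpM2l ?powR_ge0// (le_trans h)// ler_wpM2r//.
  by rewrite ge0_ler_powR ?nnegrE// ?ler_nat// ltW.
- rewrite (le_trans (ler_norm_sum _ _ _))// !big_seq ler_sum// => k.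
  rewrite mem_index_iota => /andP[nk km].
  have k0 : (0 < k)%N by rewrite (leq_trans n0).
  rewrite normrM ger0_norm ?decr//.
  have := norm_cos_sum_le th n0 nk e0 e1 s0; rewrite -/g => h.
  rewrite (le_trans (ler_wpM2l (decr k k0) h))// mulrA ler_wpM2r//.
  have := @powR_diff_le a (a - eps) C k b0 _ aC k0.
  by rewrite [a - (a - eps)](_ : _ = eps); [apply; lra|ring].
Qed.

End Kernel.

Section Bernoulli.
Context {R : realType}.
Implicit Types (a eps th u x y : R).

Definition bernoulli_sum a (N : nat) u : R :=
  1 + 2 * \sum_(1 <= k < N.+1) k%:R `^ (- a) * cos (k%:R * u - a * pi / 2).

(** For every [th] an orthonormal system, with the phase shifted by [th] in each frequency. By the
    addition formula F_a(x - y) is diagonal between phase 0 in x and phase a pi / 2 in y, which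
    absorbs the shift in F_a without complex exponentials. *)
Definition trig th (n : nat) x : R :=
  if n == 0%N then 1 else
  Num.sqrt 2 * (if odd n then cos ((freq n)%:R * x + th) else sin ((freq n)%:R * x + th)).

Definition weight a (n : nat) : R := (freq n)%:R `^ (- a).

Lemma bernoulli_sumE a N x y : bernoulli_sum a N (x - y) =
  \sum_(i < N.*2.+1) weight a i * trig 0 i x * trig (a * pi / 2) i y.
Proof.
rewrite /bernoulli_sum; elim: N => [|N IH].
  by rewrite big_geq// mulr0 addr0 big_ord1 /weight /trig /= powR1 !mulr1.
rewrite doubleS 2!big_ord_recr/= -IH big_nat_recr//= mulrDr [LHS]addrA -[RHS]addrA.
congr (_ + _); rewrite /weight /trig/= odd_double/=.
have fE1 : freq N.*2.+1 = N.+1 by rewrite /freq; lia.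
have fE2 : freq N.*2.+2 = N.+1 by rewrite /freq; lia.
rewrite fE1 fE2 !addr0.
set th := a * pi / 2; set n := N.+1%:R.
have -> : n * (x - y) - th = n * x - (n * y + th) by ring.
have sq2 : Num.sqrt 2 * Num.sqrt 2 = 2 :> R by rewrite -expr2 sqr_sqrtr.
rewrite cosB -{1}sq2; ring.
Qed.

Lemma powRN_small (d e : R) : 0 < d -> 0 < e ->
  exists N, forall n, (N <= n)%N -> n.+1%:R `^ (- d) <= e.
Proof.
move=> d0 e0; exists (Num.trunc (e^-1 `^ d^-1)) => n Nn.
rewrite powRN invf_ple ?posrE ?powR_gt0//.
have -> : e^-1 = (e^-1 `^ d^-1) `^ d.
  by rewrite -powRrM mulVf ?gt_eqF// powRr1// invr_ge0 ltW.
rewrite ge0_ler_powR ?nnegrE ?powR_ge0// ?ltW//.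
by rewrite (lt_le_trans (truncnS_gt _))// ler_nat ltnS.
Qed.

(** A single majorant [G], integrable in u, serves the kernel, all its partial sums and, with a
    decaying factor, the truncation error. This common form passes to products over the
    coordinates. *)
Lemma bernoulli_kernel_approx a eps : 0 < eps -> eps < 1 -> eps < a ->
  exists2 C, 1 <= C & forall u, sin (u / 2) != 0 ->
  let G := C * (1 + `|sin (u / 2)| `^ (eps - 1)) in
  [/\ bernoulli_sum a ^~ u @ \oo --> bernoulli_kernel a u,
      `|bernoulli_kernel a u| <= G,
      (forall N, `|bernoulli_sum a N u| <= G) &
      (forall N, `|bernoulli_kernel a u - bernoulli_sum a N u| <=
         N.+1%:R `^ (- (a - eps)) * G)].
Proof.
move=> e0 e1 ea; have [C C1 HC] := norm_cos_series_le e0 e1 ea.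
exists (4 * C); first by lra.
move=> u su G; pose g := `|sin (u / 2)| `^ (eps - 1); have g0 : 0 <= g by rewrite powR_ge0.
pose f k := k%:R `^ (- a) * cos (k%:R * u - a * pi / 2).
pose P N := \sum_(1 <= k < N.+1) f k.
have Pdiff N M : (N <= M)%N -> `|P M - P N| <= C * N.+1%:R `^ (- (a - eps)) * g.
  move=> NM; rewrite /P (big_cat_nat _ (n := N.+1))//=.
  by rewrite [X in `|X|]addrAC subrr add0r; apply: HC => //; rewrite ltnS.
have b0 : 0 < a - eps by lra.
have Pcvg : cvgn P.
  suff : cauchy_ex (P @ \oo) by move=> /cauchy_exP /cauchy_cvg.
  move=> e e_gt0; rewrite /fmapE -ball_normE /ball_/=.
  have Cg2 : 0 < 2 * (C * (1 + g)) by nra.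
  have [N HN] := powRN_small b0 (divr_gt0 e_gt0 Cg2).
  exists (P N); near=> M; rewrite /= distrC.
  have NM : (N <= M)%N by near: M; exists N.
  rewrite (le_lt_trans (Pdiff N M NM))//.
  have := HN N (leqnn _); set t := _ `^ _ => tN.
  have t0 : 0 <= t by rewrite powR_ge0.
  have Cg : 0 < C * (1 + g) by nra.
  move: tN; rewrite ler_pdivlMr//; nra.
have PlimE N : `|limn P - P N| <= C * N.+1%:R `^ (- (a - eps)) * g.
  have cv : (fun M => `|P M - P N|) @ \oo --> `|limn P - P N|.
    by apply: cvg_norm; apply: cvgB => //; exact: cvg_cst.
  rewrite -(cvg_lim _ cv)//; apply: limr_le; first by apply/cvg_ex; exists `|limn P - P N|.
  by exists N => // M /= NM; exact: Pdiff.
have bE : bernoulli_kernel a u = 1 + 2 * limn P by [].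
have sE N : bernoulli_sum a N u = 1 + 2 * P N by [].
have diffE N : `|bernoulli_kernel a u - bernoulli_sum a N u| <=
   N.+1%:R `^ (- (a - eps)) * (2 * C * g).
  rewrite bE sE (_ : _ - _ = 2 * (limn P - P N)); last by ring.
  rewrite normrM ger0_norm//.
  have -> : N.+1%:R `^ (- (a - eps)) * (2 * C * g) = 2 * (C * N.+1%:R `^ (- (a - eps)) * g).
    by ring.
  by rewrite ler_wpM2l// PlimE.
have sumE N : `|bernoulli_sum a N u| <= 1 + 2 * C * g.
  rewrite sE (le_trans (ler_normD _ _))// normr1 lerD2l normrM ger0_norm// -mulrA ler_wpM2l//.
  have := Pdiff 0%N N (leq0n _).
  by rewrite {2}/P big_geq// subr0 powR1 mulr1.
(* The factor 4 in the constant covers the partial sums, at most 1 + 2 C g, together with the error,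
   at most 2 C g. *)
have G1 : 1 + 2 * C * g + 2 * C * g <= G by rewrite /G -/g; nra.
have Cg0 : 0 <= 2 * C * g by nra.
split.
- rewrite bE; apply: cvgD; first exact: cvg_cst.
  by apply: cvgM; [exact: cvg_cst|exact: Pcvg].
- have := diffE 0%N; rewrite powR1 mul1r => d0.
  rewrite -[bernoulli_kernel a u](subrK (bernoulli_sum a 0 u)).
  by rewrite (le_trans (ler_normD _ _))// (le_trans (lerD d0 (sumE 0%N)))//; lra.
- by move=> N; rewrite (le_trans (sumE N))//; lra.
- by move=> N; rewrite (le_trans (diffE N))// ler_wpM2l ?powR_ge0//; lra.
Unshelve. all: by end_near. Qed.

(** The condition sin(u/2) = 0 stands for u in 2 pi Z; induction on k avoids naming the integer. *)
Lemma sin_half_eq0 u : sin (u / 2) = 0 -> forall k, cos (k%:R * u) = 1 /\ sin (k%:R * u) = 0.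
Proof.
move=> s0.
have uE : u = u / 2 + u / 2 by field.
have c1 : cos u = 1.
  by rewrite uE cosD -!expr2 cos2sin2 s0; ring.
have su : sin u = 0 by rewrite uE sinD s0; ring.
elim=> [|k [ck sk]]; first by rewrite mul0r cos0 sin0.
rewrite -natr1 mulrDl mul1r cosD sinD ck sk c1 su; split; ring.
Qed.

Lemma measurable_sin : measurable_fun setT (@sin R).
Proof. apply: continuous_measurable_fun; exact: continuous_sin. Qed.

Lemma measurable_cos : measurable_fun setT (@cos R).
Proof. apply: continuous_measurable_fun; exact: continuous_cos. Qed.

Lemma measurable_affine (f : R -> R) (p q : R) : measurable_fun setT f ->
  measurable_fun setT (fun x => f (p * x + q)).
Proof.
move=> mf; apply: (measurableT_comp mf).
by apply: measurable_funD => //; apply: measurable_funM.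
Qed.

Lemma measurable_sin_half : measurable_fun setT (fun u : R => sin (u / 2)).
Proof.
have := @measurable_affine _ (2^-1) 0 measurable_sin.
by under eq_fun do rewrite addr0 mulrC.
Qed.

Lemma measurable_bernoulli_sum a N : measurable_fun setT (bernoulli_sum a N).
Proof.
apply: measurable_funD => //; apply: measurable_funM => //.
apply: measurable_sum => k; apply: measurable_funM => //.
exact: measurable_affine measurable_cos.
Qed.

Lemma measurable_bernoulli_kernel a : 0 < a -> measurable_fun setT (bernoulli_kernel a).
Proof.
move=> a0; pose eps := Num.min a 1 / 2.
have m0 : 0 < Num.min a 1 by rewrite lt_min a0 ltr01.
have ma : Num.min a 1 <= a by rewrite ge_min lexx.
have m1 : Num.min a 1 <= 1 by rewrite ge_min lexx orbT.
have [||| C C1 HC] := @bernoulli_kernel_approx a eps; rewrite /eps; try lra.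
pose D := [set u : R | sin (u / 2) != 0].
have mD : measurable D.
  have -> : D = [set: R] `&` (fun u => sin (u / 2)) @^-1` (~` [set 0]).
    rewrite setTI; apply/seteqP; split=> u /=; [by move/eqP|by move/eqP].
  by apply: measurable_sin_half => //; apply: measurableC.
rewrite -(setUv D); apply/measurable_funU => //; first exact: measurableC.
split.
- apply: (@measurable_fun_cvg _ _ _ _ (fun N u => bernoulli_sum a N u)).
    by move=> N; apply: measurable_funTS; exact: measurable_bernoulli_sum.
  by move=> u Du; have [] := HC u Du.
(* On 2 pi Z the series agrees term by term with the one at 0, so the kernel is constant there,
   whatever value [limn] takes. *)
- pose c := bernoulli_kernel a 0.
  apply: (eq_measurable_fun (cst c)); last exact: measurable_cst.
  move=> u; rewrite inE/= => /negP; rewrite negbK => /eqP s0.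
  rewrite /c /bernoulli_kernel; congr (_ + _ * _); congr (limn _); apply/funext => n.
  apply: eq_bigr => k _; congr (_ * _).
  by have [ck sk] := sin_half_eq0 s0 k; rewrite !cosB ck sk mulr0 cos0 sin0.
Qed.

End Bernoulli.

(** * Integrals on the torus *)

Section Sine.
Context {R : realType}.
Implicit Types (t u v x y : R).

Lemma cos_sqr_ge_half t : 0 <= t -> t <= pi / 4 -> 0 <= cos t /\ 1 / 2 <= cos t ^+ 2.
Proof.
move=> t0 t4; have p0 := pi_gt0 R; split.
  by apply: cos_ge0_pihalf; apply/andP; split; lra.
have : 0 <= cos (t *+ 2).
  by apply: cos_ge0_pihalf; rewrite -mulr_natr; apply/andP; split; lra.
by rewrite cos_mulr2n -[_ ^+ 2 *+ 2]mulr_natr; lra.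
Qed.

(** Write sin v = 2 cos(v/2) sin(v/2) and sin(v/2) = (v/2) cos c with c < v/2; both cosines are at
    least 1/sqrt 2 since v/2 <= pi/4. *)
Lemma sin_ge_half v : 0 <= v -> v <= pi / 2 -> v / 2 <= sin v.
Proof.
move=> v0 vpi; have [->|vn0] := eqVneq v 0; first by rewrite mul0r sin0.
have t0 : 0 < v / 2 by lra.
have ds (x : R) : x \in `]0, v / 2[%R -> is_derive x 1 sin (cos x) by move=> _; exact: is_derive_sin.
have cs : {within `[0, v / 2], continuous (@sin R)}.
  by apply: continuous_subspaceT; exact: continuous_sin.
have [c cI E] := MVT t0 ds cs.
have /andP[c0 c1] : 0 < c < v / 2 by rewrite in_itv in cI.
have [|| C1 C2] := @cos_sqr_ge_half c; try lra.
have [|| D1 D2] := @cos_sqr_ge_half (v / 2); try lra.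
have cd : 1 / 2 <= cos c * cos (v / 2).
  by rewrite -ler_sqr ?nnegrE ?mulr_ge0// exprMn; nra.
have -> : sin v = 2 * (cos (v / 2) * sin (v / 2)).
  by rewrite -[in LHS](_ : (v / 2) *+ 2 = v) ?sin_mulr2n ?mulr_natl// mulr2n; field.
rewrite sin0 !subr0 in E; rewrite E; nra.
Qed.

(** The sine of w/2 is at least a quarter of the distance of w to 0 or of |w| to 2 pi, the only
    multiples of 2 pi in reach. *)
Lemma norm_sin_half_ge (w : R) : `|w| <= 2 * pi ->
  `|w| <= 4 * `|sin (w / 2)| \/ 2 * pi - `|w| <= 4 * `|sin (w / 2)|.
Proof.
have -> : `|sin (w / 2)| = `|sin (`|w| / 2)|.
  have [w0|w0] := leP 0 w; first by rewrite (ger0_norm w0).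
  by rewrite (ltr0_norm w0) mulNr sinN normrN.
set z := `|w| => z2; have z0 : 0 <= z by exact: normr_ge0.
have [le|gt] := leP (z / 2) (pi / 2); [left|right].
  have := @sin_ge_half (z / 2) _ le; have := ler_norm (sin (z / 2)); lra.
have -> : sin (z / 2) = sin (pi - z / 2).
  by rewrite sinB sinpi cospi; ring.
have := @sin_ge_half (pi - z / 2); have := ler_norm (sin (pi - z / 2)).
have := pi_gt0 R; lra.
Qed.

End Sine.

Section UniformIntegrals.
Context {R : realType}.
Implicit Types (x y th : R).

Local Notation U := (uniform_prob (two_pi_gt0 R)).

Lemma integral_uniformE (f : R -> \bar R) : measurable_fun [set: R] f ->
  (forall x, (0 <= f x)%E) ->
  (\int[U]_x f x = ((2 * pi)^-1)%:E * \int[lebesgue_measure]_(x in `[0%R, (2 * pi)%R]) f x)%E.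
Proof.
by move=> mf f0; have := @integral_uniform R 0 (2 * pi) (two_pi_gt0 R) f mf f0; rewrite subr0.
Qed.

Lemma uniform_prob_le (A : set R) : measurable A ->
  (U A <= @lebesgue_measure R A)%E.
Proof.
move=> mA; have <- : (\int[U]_x (\1_A x)%:E = U A)%E by rewrite integral_indic// setIT.
rewrite integral_uniformE; last 2 first.
- exact/measurable_EFinP/measurable_indic.
- by move=> x; rewrite lee_fin.
rewrite integral_indic//.
apply: (@le_trans _ _ (1 * lebesgue_measure A)%E); last by rewrite mul1e.
apply: lee_pmul => //.
- by rewrite lee_fin invr_ge0 ltW// two_pi_gt0.
- by rewrite lee_fin invf_le1 ?two_pi_gt0//; have := pi_ge2 R; lra.
- by apply: le_measure; rewrite ?inE//; exact: measurableI.
Qed.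

Lemma uniform_prob_sin_small (t d : R) : 0 <= t <= 2 * pi -> 0 <= d ->
  (U [set y | (`|sin ((t - y) / 2)| <= d)%R] <= (16 * d)%:E)%E.
Proof.
move=> /andP[t0 t2] d0.
pose I := [set y : R | 0 <= y <= 2 * pi].
pose S := [set y : R | `|sin ((t - y) / 2)| <= d].
have mS : measurable S.
  have mf : measurable_fun setT (fun y : R => `|sin ((t - y) / 2)|).
    apply: measurableT_comp => //.
    have -> : (fun y => sin ((t - y) / 2)) = (fun y => sin (- 2^-1 * y + t / 2)).
      by apply/funext => y; congr sin; field.
    exact: measurable_affine measurable_sin.
  rewrite (_ : S = [set: R] `&` (fun y => `|sin ((t - y) / 2)|) @^-1` `]-oo, d]).
    exact: mf.
  by rewrite setTI; apply/seteqP; split=> y; rewrite /S/= in_itv.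
(* The points y for which t - y is close to 0, 2 pi and -2 pi. The lengths 8d, 4d and 4d add up to
   16d, and the uniform density is below 1. *)
pose A1 := [set` `[t - 4 * d, t + 4 * d]] : set R.
pose A2 := [set` `[t - 2 * pi, t - 2 * pi + 4 * d]] : set R.
pose A3 := [set` `[t + 2 * pi - 4 * d, t + 2 * pi]] : set R.
have mA1 : measurable A1 by exact: measurable_itv.
have mA2 : measurable A2 by exact: measurable_itv.
have mA3 : measurable A3 by exact: measurable_itv.
have mA12 : measurable (A1 `|` A2) by exact: measurableU.
have mA123 : measurable (A1 `|` A2 `|` A3) by exact: measurableU.
have mI : measurable I.
  have -> : I = [set` `[0, 2 * pi]] by rewrite set_itvcc.
  exact: measurable_itv.
have sub : S `&` I `<=` A1 `|` A2 `|` A3.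
  move=> y [Sy /andP[y0 y2]].
  have w2 : `|t - y| <= 2 * pi by rewrite ler_norml; apply/andP; split; lra.
  have := norm_sin_half_ge w2; rewrite /S/= in Sy.
  have [ty|ty] := leP y t.
    rewrite (ger0_norm (_ : 0 <= t - y)) ?subr_ge0// => -[] h.
      by left; left; rewrite /A1/= in_itv/=; apply/andP; split; lra.
    by left; right; rewrite /A2/= in_itv/=; apply/andP; split; lra.
  rewrite (ltr0_norm (_ : t - y < 0)) ?subr_lt0// => -[] h.
    by left; left; rewrite /A1/= in_itv/=; apply/andP; split; lra.
  by right; rewrite /A3/= in_itv/=; apply/andP; split; lra.
have U0 : U (~` I) = 0%E.
  have -> : U (~` I) = (\int[U]_x (\1_(~` I) x)%:E)%E.
    by rewrite integral_indic ?setIT//; exact: measurableC.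
  rewrite integral_uniformE; last 2 first.
  - by apply/measurable_EFinP/measurable_indic; exact: measurableC.
  - by move=> x; rewrite lee_fin.
  rewrite integral0_eq ?mule0// => x; rewrite /= in_itv/= => xI.
  by rewrite indicE memNset//= => /(_ xI).
apply: (@le_trans _ _ (U (A1 `|` A2 `|` A3 `|` ~` I))).
  apply: le_measure; rewrite ?inE//.
    by apply: measurableU => //; exact: measurableC.
  move=> y Sy; have [Iy|nIy] := pselect (I y); last by right.
  by left; apply: sub.
have Uitv (a b : R) : a <= b -> (U [set` `[a, b]] <= (b - a)%:E)%E.
  move=> ab; apply: (le_trans (uniform_prob_le _)) => //.
  rewrite lebesgue_measure_itv/= lte_fin; case: ifPn => // _.
  by rewrite lee_fin subr_ge0.
apply: (@le_trans _ _ (U A1 + U A2 + U A3 + U (~` I))%E).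
  apply: (le_trans (measureU2 _ _ _)).
  - exact: mA123.
  - exact: measurableC.
  rewrite leeD2r//; apply: (le_trans (measureU2 _ _ _)) => //.
  by rewrite leeD2r//; apply: (le_trans (measureU2 _ _ _)).
rewrite U0 adde0.
have h1 := Uitv (t - 4 * d) (t + 4 * d); have h2 := Uitv (t - 2 * pi) (t - 2 * pi + 4 * d).
have h3 := Uitv (t + 2 * pi - 4 * d) (t + 2 * pi).
have g1 : t - 4 * d <= t + 4 * d by lra.
have g2 : t - 2 * pi <= t - 2 * pi + 4 * d by lra.
have g3 : t + 2 * pi - 4 * d <= t + 2 * pi by lra.
apply: le_trans (leeD (leeD (h1 g1) (h2 g2)) (h3 g3)) _.
by rewrite -!EFinD lee_fin; lra.
Qed.

Lemma uniform_prob_sin_eq0 (t : R) : 0 <= t <= 2 * pi ->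
  U [set y | sin ((t - y) / 2) = 0] = 0%E.
Proof.
move=> t02; apply/eqP; rewrite eq_le measure_ge0 andbT.
have := @uniform_prob_sin_small t 0 t02 (lexx _); rewrite mulr0; congr (_ <= _)%E.
congr (U _); apply/seteqP; split=> y /=; rewrite normr_le0; first by move/eqP.
by move=> ->.
Qed.

(** Dyadic decomposition in s = |sin((t - y)/2)|: on the shell below 2^-j the power is at most
    (2^(j+1))^(1-e), on a set of measure at most 16 2^-j. The products are 32 q^(j+1) with q = 2^-e
    < 1, a geometric series. *)
Lemma integral_sin_powR (e : R) : 0 < e -> e < 1 -> exists2 C : R, 0 <= C &
  forall t, 0 <= t <= 2 * pi ->
  (\int[U]_y (`|sin ((t - y) / 2)| `^ (e - 1))%:E <= C%:E)%E.
Proof.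
move=> e0 e1; pose q : R := 2 `^ (- e).
have q0 : 0 < q by rewrite powR_gt0.
have q1 : q < 1.
  rewrite /q powRN invf_lt1 ?powR_gt0// /powR pnatr_eq0/=.
  by rewrite expR_gt1 mulr_gt0// ln_gt0// ltr1n.
pose A (t : R) (j : nat) := [set y : R | `|sin ((t - y) / 2)| <= (2 ^+ j)^-1].
have mS t : measurable_fun setT (fun y : R => `|sin ((t - y) / 2)|).
  apply: measurableT_comp => //.
  have -> : (fun y => sin ((t - y) / 2)) = (fun y => sin (- 2^-1 * y + t / 2)).
    by apply/funext => y; congr sin; field.
  exact: measurable_affine measurable_sin.
have mA t j : measurable (A t j).
  rewrite (_ : A t j = [set: R] `&` (fun y => `|sin ((t - y) / 2)|) @^-1` `]-oo, (2 ^+ j)^-1]).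
    exact: mS.
  by rewrite setTI; apply/seteqP; split=> y; rewrite /A/= in_itv.
pose c j : R := (2 ^+ j.+1) `^ (1 - e).
have c0 j : 0 <= c j by rewrite powR_ge0.
pose C : R := 32 / (1 - q).
have C0 : 0 <= C by rewrite divr_ge0// subr_ge0 ltW.
exists C => // t t02.
pose f j y : \bar R := (c j * \1_(A t j) y)%:E.
have f0 j y : (0 <= f j y)%E by rewrite lee_fin mulr_ge0.
have mf j : measurable_fun setT (f j).
  by apply/measurable_EFinP; apply: measurable_funM => //; exact: measurable_indic.
have dom y : ((`|sin ((t - y) / 2)| `^ (e - 1))%:E <= \sum_(j <oo) f j y)%E.
  (* At s = 0 the negative power takes the conventional value 0, so the singular points need no
     separate treatment. *)
  set s := `|_|; have [s0|s0] := eqVneq s 0.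
    by rewrite s0 powR0 ?nneseries_ge0// lt_eqF// subr_lt0.
  have sgt0 : 0 < s by rewrite lt_neqAle eq_sym s0 normr_ge0.
  have sle1 : s <= 1 by rewrite /s sin_max.
  have [j jP] : exists j : nat, (2 ^+ j.+1)^-1 < s <= (2 ^+ j)^-1.
    have ex : exists j : nat, (2 ^+ j)^-1 < s.
      exists (Num.trunc s^-1).+1; rewrite invf_plt ?posrE ?exprn_gt0//.
      rewrite (lt_le_trans (truncnS_gt _))// -natrX ler_nat.
      by rewrite ltnW// ltn_expl.
    case: (ex_minnP ex) => -[|j] jlt jmin.
      by move: jlt; rewrite expr0 invr1 ltNge sle1.
    exists j; rewrite jlt/= leNgt; apply/negP => /jmin; by rewrite ltnn.
  have /andP[j1 j2] := jP.
  apply: (@le_trans _ _ (f j y)).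
    rewrite lee_fin indicE mem_set// mulr1 /c.
    rewrite -opprB powRN -[leRHS]invrK lef_pV2 ?posrE ?powR_gt0 ?invr_gt0 ?powR_gt0 ?exprn_gt0//.
    rewrite -powRN -mulN1r powRrM powR_inv1 ?exprn_ge0//.
    by rewrite ge0_ler_powR ?nnegrE ?invr_ge0 ?exprn_ge0// ?subr_ge0 ltW.
  have := @nneseries_lim_ge R (f^~ y) xpredT 0%N j.+1 (fun n _ _ => f0 n y).
  by apply: le_trans; rewrite big_nat_recr//= leeDr// sume_ge0.
have mg : measurable_fun [set: R] (fun y => (`|sin ((t - y) / 2)| `^ (e - 1))%:E).
  apply/measurable_EFinP; exact: (measurableT_comp (@measurable_powR R (e - 1)) (mS t)).
apply: (@le_trans _ _ (\int[U]_y \sum_(j <oo) f j y)%E).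
  apply: ge0_le_integral => //.
  exact: (ge0_emeasurable_sum (fun j y _ _ => f0 j y) (fun j _ => mf j)).
rewrite integral_nneseries//.
apply: lime_le.
  by apply: is_cvg_nneseries => j _ _; apply: integral_ge0 => y _; exact: f0.
apply: nearW => n.
have term j : (\int[U]_y f j y <= (32 * q ^+ j.+1)%:E)%E.
  rewrite /f; under eq_integral do rewrite EFinM.
  have mind : measurable_fun [set: R] (fun y => (\1_(A t j) y : R)%:E).
    exact/measurable_EFinP/measurable_indic.
  rewrite ge0_integralZl//; last by rewrite lee_fin.
  have -> : (\int[U]_y (\1_(A t j) y)%:E = U (A t j))%E.
    have := mA t j; move: (A t j) => B mB; by rewrite integral_indic// setIT.
  have := @uniform_prob_sin_small t (2 ^+ j)^-1 t02; rewrite invr_ge0 exprn_ge0// => /(_ isT) h.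
  apply: (le_trans (lee_wpmul2l _ h)); first by rewrite lee_fin.
  rewrite -EFinM lee_fin.
  have -> : q ^+ j.+1 = c j * (2 ^+ j.+1)^-1.
    have -> : q ^+ j.+1 = (2 ^+ j.+1) `^ (- e).
      by rewrite -powR_mulrn ?powR_ge0// /q powRAC powR_mulrn.
    have -> : - e = (1 - e) - 1 by ring.
    by rewrite powRB ?expf_neq0 ?implybT// powRr1 ?exprn_ge0.
  by rewrite le_eqVlt; apply/orP; left; apply/eqP; rewrite exprS; field; rewrite expf_neq0.
apply: (@le_trans _ _ (\sum_(0 <= j < n) (32 * q ^+ j.+1)%:E)%E); first exact: lee_sum.
rewrite sumEFin lee_fin -mulr_sumr /C ler_wpM2l//.
rewrite -[leRHS]mul1r ler_pdivlMr ?subr_gt0//.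
have -> : \sum_(0 <= j < n) q ^+ j.+1 = q * \sum_(j < n) q ^+ j.
  by rewrite big_mkord mulr_sumr; apply: eq_bigr => j _; rewrite exprS.
have h : (1 - q) * (\sum_(j < n) q ^+ j) = 1 - q ^+ n.
  by rewrite -opprB mulNr -subrX1 opprB.
rewrite -mulrA [X in q * X]mulrC h.
have : 0 <= q ^+ n by rewrite exprn_ge0// ltW.
nra.
Qed.

End UniformIntegrals.

Definition bounded_measurable d (T : measurableType d) (R : realType) (f : T -> R) :=
  measurable_fun setT f /\ exists C, forall x, `|f x| <= C.

Section BoundedMeasurable.
Context d (T : measurableType d) (R : realType).
Implicit Types f g : T -> R.

Lemma bounded_measurable_integrable (P : probability T R) f :
  bounded_measurable f -> P.-integrable setT (EFin \o f).
Proof.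
move=> [mf [C fC]]; apply: measurable_bounded_integrable => //.
  by rewrite (le_lt_trans (probability_le1 P _)) ?ltry.
exists C; split; first exact: num_real.
by move=> M CM x _; apply: (le_trans (fC x)); exact: ltW.
Qed.

Lemma bounded_measurableM f g : bounded_measurable f -> bounded_measurable g ->
  bounded_measurable (fun x => f x * g x).
Proof.
move=> [mf [C fC]] [mg [C' gC]]; split; first exact: measurable_funM.
by exists (C * C') => x; rewrite normrM ler_pM.
Qed.

Lemma bounded_measurableD f g : bounded_measurable f -> bounded_measurable g ->
  bounded_measurable (fun x => f x + g x).
Proof.
move=> [mf [C fC]] [mg [C' gC]]; split; first exact: measurable_funD.
by exists (C + C') => x; rewrite (le_trans (ler_normD _ _))// lerD.
Qed.

Lemma bounded_measurable_cst (c : R) : bounded_measurable (fun _ : T => c).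
Proof. by split; [exact: measurable_cst|exists `|c|]. Qed.

Lemma bounded_measurable_sum I (r : seq I) (F : I -> T -> R) :
  (forall i, bounded_measurable (F i)) -> bounded_measurable (fun x => \sum_(i <- r) F i x).
Proof.
move=> bF; elim: r => [|i r IH].
  rewrite (_ : (fun x => _) = (fun=> 0)); first exact: bounded_measurable_cst.
  by apply/funext => x; rewrite big_nil.
rewrite (_ : (fun x => _) = (fun x => F i x + \sum_(i <- r) F i x)).
  exact: bounded_measurableD.
by apply/funext => x; rewrite big_cons.
Qed.

Lemma bounded_measurable_prod I (r : seq I) (F : I -> T -> R) :
  (forall i, bounded_measurable (F i)) -> bounded_measurable (fun x => \prod_(i <- r) F i x).
Proof.
move=> bF; elim: r => [|i r IH].
  rewrite (_ : (fun x => _) = (fun=> 1)); first exact: bounded_measurable_cst.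
  by apply/funext => x; rewrite big_nil.
rewrite (_ : (fun x => _) = (fun x => F i x * \prod_(i <- r) F i x)).
  exact: bounded_measurableM.
by apply/funext => x; rewrite big_cons.
Qed.

End BoundedMeasurable.

(** * Orthonormality of the trigonometric system *)

Section Trigonometric.
Context {R : realType}.
Implicit Types (x y th p q : R).

Local Notation U := (uniform_prob (two_pi_gt0 R)).
Local Notation T1 := (measurableTypeR R).

Lemma bounded_measurable_cos p q : bounded_measurable (fun x : T1 => cos (p * x + q)).
Proof.
split; first exact: (measurable_affine p q measurable_cos).
by exists 1 => x; exact: cos_max.
Qed.

Lemma cos_add_period n q : cos (n%:R * (2 * pi) + q) = cos q :> R /\
  sin (n%:R * (2 * pi) + q) = sin q :> R.
Proof.
have [| c s] := @sin_half_eq0 R (2 * pi) _ n; first by rewrite mulrC mulKf// sinpi.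
by rewrite cosD sinD c s; split; ring.
Qed.

(** The primitive is applied to cos + 1, because the formula for integrals against the uniform
    probability is available for nonnegative functions; the added 1 is removed afterwards. *)
Lemma Rintegral_cos (n : nat) q : (0 < n)%N -> \int[U]_x cos (n%:R * x + q) = 0 :> R.
Proof.
move=> n0; pose G x := sin (n%:R * x + q) / n%:R + x.
have n0R : n%:R != 0 :> R by rewrite pnatr_eq0 -lt0n.
have dG x : is_derive x 1 G (cos (n%:R * x + q) + 1).
  by rewrite /G; apply: is_derive_eq; rewrite /GRing.scale/=; field.
have E1 : (\int[U]_x (cos (n%:R * x + q) + 1)%:E = 1)%E.
  rewrite integral_uniformE; last 2 first.
  - apply/measurable_EFinP; apply: measurable_funD => //.
    exact: measurable_affine measurable_cos.
  - by move=> t; rewrite lee_fin; have := cos_geN1 (n%:R * t + q); lra.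
  have cG x : {for x, continuous G}.
    by apply: differentiable_continuous; apply/derivable1_diffP; have [] := dG x.
  rewrite (@continuous_FTC2 _ (fun x => cos (n%:R * x + q) + 1) G).
  - rewrite /G -EFinB -EFinM; congr EFin.
    have [_ ->] := cos_add_period n q; rewrite mulr0 add0r addr0.
    have := lt0r_neq0 (pi_gt0 R); move: pi => z z0; field.
    by rewrite n0R z0.
  - exact: two_pi_gt0.
  - apply: continuous_subspaceT => x; apply: continuousD; last exact: cst_continuous.
    apply: (continuous_comp (f := fun x => n%:R * x + q)); last exact: continuous_cos.
    apply: continuousD; last exact: cst_continuous.
    by apply: continuousM; [exact: cst_continuous|exact: cvg_id].
  - split.
    + by move=> x _; have [] := dG x.
    + by apply: cvg_at_right_filter; exact: cG.
    + by apply: cvg_at_left_filter; exact: cG.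
  - by move=> x _; rewrite derive1E; have [_] := dG x.
have bc : bounded_measurable (fun x : T1 => cos (n%:R * x + q)).
  exact: bounded_measurable_cos.
have : \int[U]_x (cos (n%:R * x + q) + 1) = 1 by rewrite /Rintegral E1.
rewrite RintegralD//; last 2 first.
- exact: bounded_measurable_integrable.
- apply: bounded_measurable_integrable; exact: bounded_measurable_cst.
rewrite Rintegral_cst// [fine _](_ : _ = 1) ?mulr1; first by move/eqP; rewrite -[X in _ == X]add0r (inj_eq (addIr _)) => /eqP.
by rewrite [X in fine X](@probability_setT _ _ _ U).
Qed.

Lemma Rintegral_cos_diff (n m : nat) q : n != m ->
  \int[U]_x cos ((n%:R - m%:R) * x + q) = 0 :> R.
Proof.
rewrite neq_ltn => /orP[nm|mn].
  rewrite -[RHS](@Rintegral_cos (m - n) (- q)) ?subn_gt0//.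
  apply: eq_Rintegral => x _; rewrite -cosN natrB 1?ltnW//; congr cos; ring.
rewrite -[RHS](@Rintegral_cos (n - m) q) ?subn_gt0//.
by apply: eq_Rintegral => x _; rewrite natrB 1?ltnW.
Qed.

(** Turns the sines into shifted cosines, so that one product-to-sum formula covers all pairs of
    indices. *)
Definition phase th (n : nat) : R := if odd n then th else th - pi / 2.

Lemma trigE th n x : n != 0%N -> trig th n x = Num.sqrt 2 * cos ((freq n)%:R * x + phase th n).
Proof.
move=> /negPf n0; rewrite /trig n0 /phase; case: (odd n) => //.
by rewrite addrA cosBpihalf.
Qed.

Lemma bounded_measurable_trig th n : bounded_measurable (trig th n : T1 -> R).
Proof.
have [->|n0] := eqVneq n 0%N; first exact: bounded_measurable_cst.
rewrite (_ : trig th n = fun x : T1 => Num.sqrt 2 * cos ((freq n)%:R * x + phase th n)).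
  apply: bounded_measurableM; first exact: bounded_measurable_cst.
  exact: bounded_measurable_cos.
by apply/funext => x; rewrite trigE.
Qed.

Lemma Rintegral_trig th i j :
  \int[U]_x (trig th i x * trig th j x) = (i == j)%:R :> R.
Proof.
have U1 : fine (U setT) = 1 by rewrite [X in fine X](@probability_setT _ _ _ U).
have cst1 (c : R) : \int[U]_x c = c by rewrite Rintegral_cst// U1 mulr1.
have single k : k != 0%N -> \int[U]_x trig th k x = 0.
  move=> k0; under eq_Rintegral do rewrite trigE//.
  rewrite RintegralZl//; last exact/bounded_measurable_integrable/bounded_measurable_cos.
  by rewrite Rintegral_cos ?mulr0// freq_gt0.
have t0 x : trig th 0 x = 1 by [].
have [->|i0] := eqVneq i 0%N.
  under eq_Rintegral do rewrite t0 mul1r.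
  have [->|j0] := eqVneq j 0%N; first by rewrite cst1.
  by rewrite [LHS]single.
have [->|j0] := eqVneq j 0%N.
  rewrite [X in _ = X](_ : _ = 0); last by rewrite (negPf i0).
  by under eq_Rintegral do rewrite t0 mulr1; rewrite single.
have E x : trig th i x * trig th j x =
   cos (((freq i)%:R - (freq j)%:R) * x + (phase th i - phase th j)) +
   cos ((freq i + freq j)%N%:R * x + (phase th i + phase th j)).
  rewrite !trigE// mulrACA -expr2 sqr_sqrtr// natrD.
  set A := _ * x + phase th i; set B := _ * x + phase th j.
  have -> : ((freq i)%:R - (freq j)%:R) * x + (phase th i - phase th j) = A - B.
    by rewrite /A /B; ring.
  have -> : ((freq i)%:R + (freq j)%:R) * x + (phase th i + phase th j) = A + B.
    by rewrite /A /B; ring.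
  rewrite (cosB A) (cosD A); ring.
under eq_Rintegral do rewrite E.
rewrite RintegralD//; last 2 first.
- exact/bounded_measurable_integrable/bounded_measurable_cos.
- exact/bounded_measurable_integrable/bounded_measurable_cos.
rewrite Rintegral_cos ?addr0 ?addn_gt0 ?freq_gt0//.
have [fij|fij] := eqVneq (freq i) (freq j); last first.
  rewrite Rintegral_cos_diff//; case: eqP => // eij.
  by move: fij; rewrite eij eqxx.
rewrite fij subrr; under eq_Rintegral do rewrite mul0r add0r.
rewrite cst1; have [->|ij] := eqVneq i j; first by rewrite subrr cos0.
(* Two different indices of the same frequency are a cosine and a sine; their phases differ by pi/2,
   where the cosine vanishes. *)
have : odd i != odd j.
  apply: contra ij => /eqP oij; apply/eqP; move: fij; rewrite /freq; lia.
rewrite /phase; case: (odd i); case: (odd j) => // _.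
  by rewrite opprB addrC subrK cos_pihalf.
by rewrite addrAC subrr add0r cosN cos_pihalf.
Qed.

End Trigonometric.

Section IntegralMonotone.
Context d (T : measurableType d) (R : realType) (mu : {measure set T -> \bar R}).

(* No measurability: the integral of a nonnegative function is a supremum over the
   simple functions below it. *)
Lemma ge0_le_integral_any (f g : T -> \bar R) : (forall x, (0 <= f x)%E) ->
  (forall x, (f x <= g x)%E) -> (\int[mu]_x f x <= \int[mu]_x g x)%E.
Proof.
move=> f0 fg; have g0 x : (0 <= g x)%E by exact: le_trans (fg x).
rewrite !ge0_integralTE//; apply: ereal_sup_le => _ [h hf <-].
by exists h => // x; exact: le_trans (hf x) (fg x).
Qed.

End IntegralMonotone.

(** * Product structure of the measure on the torus *)

Section TorusMeasure.
Context {R : realType}.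

Local Notation U := (uniform_prob (two_pi_gt0 R)).
Local Notation T1 := (measurableTypeR R).
Local Notation mu v := (torus_measure R v).

Lemma ge0_integral_torusS v (f : v.+1.-tuple R -> \bar R) :
  measurable_fun setT f -> (forall x, (0 <= f x)%E) ->
  (\int[mu v.+1]_x f x = \int[U]_p \int[mu v]_x f (cons_tuple (p, x)))%E.
Proof.
move=> mf f0; rewrite /= ge0_integral_distribution//.
rewrite fubini_tonelli1//; last by move=> x; exact: f0.
by apply: measurableT_comp => //; exact: measurable_cons_tuple.
Qed.

Lemma measurable_cons_tuple1 v (p : R) : measurable_fun setT (fun x : v.-tuple R => cons_tuple (p, x)).
Proof.
apply: (measurableT_comp (@measurable_cons_tuple R v)).
exact: (@pair1_measurable _ _ T1 (v.-tuple R) p).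
Qed.

Lemma Rintegral_torusS v (f : v.+1.-tuple R -> R) : bounded_measurable f ->
  \int[mu v.+1]_x f x = \int[U]_p \int[mu v]_x f (cons_tuple (p, x)).
Proof.
move=> bf; have [mf [C fC]] := bf.
have mfc : measurable_fun setT (f \o @cons_tuple R v).
  by apply: measurableT_comp => //; exact: measurable_cons_tuple.
have bfc : bounded_measurable (f \o @cons_tuple R v).
  by split=> //; exists C => x; exact: fC.
have bfp p : bounded_measurable (fun x => f (cons_tuple (p, x))).
  split; last by exists C => x; exact: fC.
  by apply: measurableT_comp => //; exact: measurable_cons_tuple1.
rewrite /Rintegral; congr fine.
rewrite [torus_measure R v.+1]/=.
rewrite integral_distribution; last 2 first.
- exact/measurable_EFinP.
- exact: (bounded_measurable_integrable _ bfc).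
rewrite -integral12_prod_meas1; last exact: (bounded_measurable_integrable _ bfc).
apply: eq_integral => p _; rewrite fineK//.
by apply: integrable_fin_num => //; exact: bounded_measurable_integrable.
Qed.

Lemma integral_torus_prod_le v (g : 'I_v -> R -> R) (C : 'I_v -> R) :
  (forall i, measurable_fun setT (g i)) -> (forall i x, 0 <= g i x) ->
  (forall i, 0 <= C i) ->
  (forall i, (\int[U]_x (g i x)%:E <= (C i)%:E)%E) ->
  (\int[mu v]_x (\prod_i g i (tnth x i))%:E <= (\prod_i C i)%:E)%E.
Proof.
elim: v g C => [|v IH] g C mg g0 C0 gC.
  rewrite big_ord0; under eq_integral do rewrite big_ord0.
  by rewrite integral_cst// [X in (_ * X)%E](@probability_setT _ _ _ (mu 0)) mule1.
have mprod : measurable_fun setT (fun x : v.+1.-tuple R => (\prod_i g i (tnth x i))%:E).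
  apply/measurable_EFinP; apply: measurable_prod => i _.
  by apply: measurableT_comp => //; exact: measurable_tnth.
rewrite ge0_integral_torusS//; last by move=> x; rewrite lee_fin prodr_ge0.
have tailm : measurable_fun setT (fun x : v.-tuple R => (\prod_i g (lift ord0 i) (tnth x i))%:E).
  apply/measurable_EFinP; apply: measurable_prod => i _.
  by apply: measurableT_comp => //; exact: measurable_tnth.
have E p : (\int[mu v]_x (\prod_i g i (tnth (cons_tuple (p, x)) i))%:E =
   (g ord0 p)%:E * \int[mu v]_x (\prod_i g (lift ord0 i) (tnth x i))%:E)%E.
  rewrite -ge0_integralZl//; last 2 first.
  - by move=> x _; rewrite lee_fin prodr_ge0.
  - by rewrite lee_fin.
  apply: eq_integral => x _; rewrite big_ord_recl -EFinM; congr (_ * _)%:E.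
  by apply: eq_bigr => i _; rewrite tnthS.
under eq_integral do rewrite E.
have mg0 : measurable_fun [set: R] (fun x => (g ord0 x)%:E) by exact/measurable_EFinP.
rewrite ge0_integralZr//; last 2 first.
- by move=> x _; rewrite lee_fin.
- by apply: integral_ge0 => x _; rewrite lee_fin prodr_ge0.
rewrite big_ord_recl EFinM; apply: lee_pmul => //.
- by apply: integral_ge0 => x _; rewrite lee_fin.
- by apply: integral_ge0 => x _; rewrite lee_fin prodr_ge0.
- by apply: (IH (fun i => g (lift ord0 i)) (fun i => C (lift ord0 i))).
Qed.

Lemma torus_coord_negligible v (i : 'I_v) (A : set R) : measurable A -> U A = 0%E ->
  mu v [set x | A (tnth x i)] = 0%E.
Proof.
move=> mA A0.
have mS : measurable [set x : v.-tuple R | A (tnth x i)].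
  by rewrite -[X in measurable X]setTI; exact: (measurable_tnth i).
apply/eqP; rewrite eq_le measure_ge0 andbT.
pose g (j : 'I_v) (x : R) : R := if j == i then \1_A x else 1.
pose C (j : 'I_v) : R := if j == i then 0 else 1.
have -> : mu v [set x | A (tnth x i)] = (\int[mu v]_x (\prod_j g j (tnth x j))%:E)%E.
  rewrite -[in LHS](setIT [set x : v.-tuple R | A (tnth x i)]) -integral_indic//.
  apply: eq_integral => x _; congr EFin.
  rewrite (bigD1 i)//= big1 => [|j /negPf ji]; last by rewrite /g ji.
  by rewrite /g eqxx mulr1 !indicE.
have -> : 0%E = (\prod_j C j)%:E.
  by rewrite (bigD1 i)//= /C eqxx mul0r.
apply: integral_torus_prod_le.
- by move=> j; rewrite /g; case: (j == i) => //; exact: measurable_indic.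
- by move=> j x; rewrite /g; case: (j == i).
- by move=> j; rewrite /C; case: (j == i).
- move=> j; rewrite /g /C; case: (j == i).
    have : (\int[U]_x (\1_A x)%:E = U A)%E by rewrite integral_indic// setIT.
    by rewrite A0 => ->.
  by rewrite integral_cst// mul1e probability_le1.
Qed.

Lemma Rintegral_torus_prod v (g : 'I_v -> R -> R) :
  (forall i, bounded_measurable (g i : T1 -> R)) ->
  \int[mu v]_x (\prod_i g i (tnth x i)) = \prod_i \int[U]_x g i x.
Proof.
elim: v g => [|v IH] g bg.
  rewrite big_ord0; under eq_Rintegral do rewrite big_ord0.
  by rewrite Rintegral_cst// [X in fine X](@probability_setT _ _ _ (mu 0)) mulr1.
have bcoord n (h : 'I_n -> R -> R) : (forall i, bounded_measurable (h i : T1 -> R)) ->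
    bounded_measurable (fun x : n.-tuple R => \prod_i h i (tnth x i)).
  move=> bh; apply: bounded_measurable_prod => i; have [mh [C hC]] := bh i; split.
    by apply: measurableT_comp => //; exact: measurable_tnth.
  by exists C => x; exact: hC.
rewrite Rintegral_torusS; last exact: bcoord.
have E p : \int[mu v]_x (\prod_i g i (tnth (cons_tuple (p, x)) i)) =
   g ord0 p * \prod_i \int[U]_x g (lift ord0 i) x.
  rewrite -(IH (fun i => g (lift ord0 i)))// -RintegralZl//; last first.
    by apply: bounded_measurable_integrable; apply: (bcoord v (fun i => g (lift ord0 i))).
  apply: eq_Rintegral => x _; rewrite big_ord_recl; congr (_ * _).
  by apply: eq_bigr => i _; rewrite tnthS.
under eq_Rintegral do rewrite E.
rewrite RintegralZr//; last exact: bounded_measurable_integrable.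
by rewrite [RHS]big_ord_recl.
Qed.

Lemma measurable_cat_tuple a b :
  measurable_fun setT (fun p : a.-tuple R * b.-tuple R => cat_tuple p.1 p.2).
Proof.
apply/measurable_fun_tnthP => i; case: (split_ordP i) => j ->.
- rewrite (_ : _ \o _ = fun p : a.-tuple R * b.-tuple R => tnth p.1 j); last first.
    by apply/funext => p /=; rewrite tnth_lshift.
  apply: (@measurableT_comp _ _ _ _ _ _ (fun x : a.-tuple R => tnth x j)) => //.
  exact: measurable_tnth.
- rewrite (_ : _ \o _ = fun p : a.-tuple R * b.-tuple R => tnth p.2 j); last first.
    by apply/funext => p /=; rewrite tnth_rshift.
  apply: (@measurableT_comp _ _ _ _ _ _ (fun x : b.-tuple R => tnth x j)) => //.
  exact: measurable_tnth.
Qed.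

Lemma measurable_cat_tuple1 a b (x : a.-tuple R) :
  measurable_fun setT (fun y : b.-tuple R => cat_tuple x y).
Proof.
rewrite (_ : (fun y => _) = (fun p : a.-tuple R * b.-tuple R => cat_tuple p.1 p.2) \o pair x)//.
apply: (measurableT_comp (@measurable_cat_tuple a b)).
exact: (@pair1_measurable _ _ (a.-tuple R) (b.-tuple R) x).
Qed.

Lemma ge0_integral_torusD a b (f : (a + b).-tuple R -> \bar R) :
  measurable_fun setT f -> (forall x, (0 <= f x)%E) ->
  (\int[mu (a + b)]_z f z = \int[mu a]_x \int[mu b]_y f (cat_tuple x y))%E.
Proof.
elim: a f => [|a IH] f mf f0.
  have E : [tuple] = [tuple] :> 0.-tuple R by [].
  rewrite [X in _ = X]integral_dirac//; last first.
    pose F (p : 0.-tuple R * b.-tuple R) := f (cat_tuple p.1 p.2).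
    apply: (@measurable_fun_fubini_tonelli_F _ _ (0.-tuple R) (b.-tuple R) R (mu b) F).
      by apply: (measurableT_comp mf); exact: measurable_cat_tuple.
    by move=> p; exact: f0.
  rewrite diracE mem_set// mul1e; apply: eq_integral => y _; congr f.
  exact: val_inj.
rewrite (ge0_integral_torusS (v := a + b) mf f0).
rewrite ge0_integral_torusS; last 2 first.
- pose F (p : a.+1.-tuple R * b.-tuple R) := f (cat_tuple p.1 p.2).
  apply: (@measurable_fun_fubini_tonelli_F _ _ (a.+1.-tuple R) (b.-tuple R) R (mu b) F).
    by apply: (measurableT_comp mf); exact: measurable_cat_tuple.
  by move=> p; exact: f0.
- by move=> x; apply: integral_ge0 => y _; exact: f0.
apply: eq_integral => p _.
rewrite IH//; last first.
  by apply: (measurableT_comp mf); exact: (measurable_cons_tuple1 (v := a + b) p).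
apply: eq_integral => x _; apply: eq_integral => y _; congr f.
exact: val_inj.
Qed.

Lemma fst_half_cat d (x y : d.-tuple R) : fst_half (cat_tuple x y) = x.
Proof. by apply: eq_from_tnth => i; rewrite tnth_mktuple tnth_lshift. Qed.

Lemma snd_half_cat d (x y : d.-tuple R) : snd_half (cat_tuple x y) = y.
Proof. by apply: eq_from_tnth => i; rewrite tnth_mktuple tnth_rshift. Qed.

Lemma cat_halves d (z : (d + d).-tuple R) : cat_tuple (fst_half z) (snd_half z) = z.
Proof.
apply: eq_from_tnth => i; case: (split_ordP i) => j ->.
  by rewrite tnth_lshift tnth_mktuple.
by rewrite tnth_rshift tnth_mktuple.
Qed.

Lemma measurable_fst_half d : measurable_fun setT (@fst_half R d).
Proof.
apply/measurable_fun_tnthP => i.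
rewrite (_ : _ \o _ = (fun z : (d + d).-tuple R => tnth z (lshift d i))).
  exact: measurable_tnth.
by apply/funext => z /=; rewrite tnth_mktuple.
Qed.

Lemma measurable_snd_half d : measurable_fun setT (@snd_half R d).
Proof.
apply/measurable_fun_tnthP => i.
rewrite (_ : _ \o _ = (fun z : (d + d).-tuple R => tnth z (rshift d i))).
  exact: measurable_tnth.
by apply/funext => z /=; rewrite tnth_mktuple.
Qed.

Lemma torus_coord_ae v (A : 'I_v -> set R) : (forall i, measurable (A i)) ->
  (forall i, U (A i) = 0%E) -> {ae mu v, forall x, forall i, ~ A i (tnth x i)}.
Proof.
move=> mA A0; apply: filter_forall => i.
exists [set x | A i (tnth x i)]; split.
- by rewrite -[X in measurable X]setTI; exact: (measurable_tnth i).
- exact: torus_coord_negligible.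
- by move=> x /= /contrapT.
Qed.

(** The uniform probability lives on the closed interval, and all the kernel estimates hold on the
    closed cube; [torus] itself is half-open. *)
Definition closed_cube v : set (v.-tuple R) := [set x | forall i, 0 <= tnth x i <= 2 * pi].

Lemma ae_closed_cube v : {ae mu v, forall x, @closed_cube v x}.
Proof.
pose A : set R := ~` [set` `[0, 2 * pi]].
have mA : measurable A by apply: measurableC; exact: measurable_itv.
have A0 : U A = 0%E.
  have -> : (U A = \int[U]_x (\1_A x)%:E)%E by rewrite integral_indic// setIT.
  rewrite integral_uniformE; last 2 first.
  - exact/measurable_EFinP/measurable_indic.
  - by move=> x; rewrite lee_fin.
  rewrite integral0_eq ?mule0// => x xI.
  by rewrite indicE memNset//= => /(_ xI).
have := @torus_coord_ae v (fun=> A) (fun=> mA) (fun=> A0).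
apply: filterS => x Ax i; have /contrapT := Ax i.
by rewrite /= in_itv.
Qed.

Lemma measurable_closed_cube v : measurable (@closed_cube v).
Proof.
rewrite (_ : closed_cube (v:=v) = \bigcap_(i in [set: 'I_v]) [set x | 0 <= tnth x i <= 2 * pi]).
  apply: fin_bigcap_measurable => // i _.
  rewrite -[X in measurable X]setTI.
  have := @measurable_tnth _ R v i measurableT [set` `[0, 2 * pi]] (measurable_itv _).
  by rewrite set_itvcc.
by apply/seteqP; split=> x /= H i; [move=> _; exact: H|exact: H].
Qed.

(** No measurability of [f] is asked for. Adding infinity to [g] off the full set [S] leaves its
    integral unchanged and makes the comparison hold everywhere. *)
Lemma le_integral_full v (S : set (v.-tuple R)) (f g : v.-tuple R -> \bar R) :
  measurable S -> {ae mu v, forall x, S x} ->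
  (forall x, (0 <= f x)%E) -> measurable_fun setT g -> (forall x, (0 <= g x)%E) ->
  (forall x, S x -> (f x <= g x)%E) ->
  (\int[mu v]_x f x <= \int[mu v]_x g x)%E.
Proof.
move=> mS aeS f0 mg g0 fg.
pose h x := (g x + (if x \in S then 0 else +oo))%E.
have mc : measurable_fun setT (fun x : v.-tuple R => if x \in S then 0%E else +oo%E : \bar R).
  apply: measurable_fun_ifT => //.
  apply: (measurable_fun_bool true); rewrite setTI.
  rewrite (_ : _ @^-1` _ = S)//.
  by apply/seteqP; split=> x /=; [move/set_mem|move/mem_set].
have mh : measurable_fun setT h by exact: emeasurable_funD.
have -> : (\int[mu v]_x g x = \int[mu v]_x h x)%E.
  apply: ae_eq_integral => //.
  by apply: filterS aeS => x Sx _; rewrite /h mem_set// adde0.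
apply: ge0_le_integral_any => // x; rewrite /h.
case: ifPn => [|_]; first by rewrite inE adde0 => /fg.
by rewrite addey ?leey// gt_eqF// (lt_le_trans _ (g0 x)).
Qed.

Lemma le_integral_closed_cube v (f g : v.-tuple R -> \bar R) :
  (forall x, (0 <= f x)%E) -> measurable_fun setT g -> (forall x, (0 <= g x)%E) ->
  (forall x, closed_cube x -> (f x <= g x)%E) ->
  (\int[mu v]_x f x <= \int[mu v]_x g x)%E.
Proof. exact: le_integral_full (@measurable_closed_cube v) (@ae_closed_cube v). Qed.

End TorusMeasure.

(** * Majorants of the convolution kernel *)

Section CauchySchwarz.
Context d (T : measurableType d) (R : realType) (mu : {measure set T -> \bar R}).

Lemma poweR2 (x : \bar R) : (0 <= x)%E -> (x `^ 2 = x * x)%E.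
Proof.
case: x => [r| |]//; last by rewrite poweRyr.
by rewrite lee_fin poweR_EFin -EFinM => r0; rewrite powR_mulrn.
Qed.

Lemma Lnorm2_sqr (f : T -> R) :
  ('N[mu]_2%:E [EFin \o f] * 'N[mu]_2%:E [EFin \o f] = \int[mu]_x ((f x) ^+ 2)%:E)%E.
Proof.
rewrite -poweR2 ?Lnorm_ge0// poweR_Lnorm//; apply: eq_integral => x _ /=.
by rewrite powR_mulrn// real_normK// num_real.
Qed.

Lemma ge0_cauchy_schwarz (f g : T -> R) : measurable_fun setT f -> measurable_fun setT g ->
  (forall x, 0 <= f x) -> (forall x, 0 <= g x) ->
  ((\int[mu]_x (f x * g x)%:E) * (\int[mu]_x (f x * g x)%:E) <=
    (\int[mu]_x (f x ^+ 2)%:E) * (\int[mu]_x (g x ^+ 2)%:E))%E.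
Proof.
move=> mf mg f0 g0.
have := @hoelder _ _ _ mu f g 2 2 mf mg (ltr0n _ 2) (ltr0n _ 2) _.
rewrite Lnorm1 [_ + _](_ : _ = 1); last by field.
move=> /(_ erefl) h.
have E : (\int[mu]_x (f x * g x)%:E = \int[mu]_x `|(EFin \o (f \* g)%R) x|)%E.
  by apply: eq_integral => x _ /=; rewrite ger0_norm// mulr_ge0.
rewrite E -!Lnorm2_sqr muleACA; apply: lee_pmul => //; exact: integral_ge0.
Qed.

End CauchySchwarz.

Section Majorant.
Context {R : realType}.
Implicit Types C e : R.

Local Notation U := (uniform_prob (two_pi_gt0 R)).
Local Notation mu v := (torus_measure R v).

Definition majorant C e v (x s : v.-tuple R) : R :=
  \prod_(i < v) (C * (1 + `|sin ((tnth x i - tnth s i) / 2)| `^ (e - 1))).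

Lemma majorant_ge0 C e v (x s : v.-tuple R) : 0 <= C -> 0 <= majorant C e x s.
Proof.
by move=> C0; apply: prodr_ge0 => i _; rewrite mulr_ge0// addr_ge0// powR_ge0.
Qed.

Lemma majorantC C e v (x s : v.-tuple R) : majorant C e x s = majorant C e s x.
Proof.
apply: eq_bigr => i _; rewrite -(opprB (tnth s i)) mulNr sinN normrN//.
Qed.

Lemma measurable_majorant_factor C e : measurable_fun setT
  (fun u : R => C * (1 + `|sin (u / 2)| `^ (e - 1))).
Proof.
apply: measurable_funM => //; apply: measurable_funD => //.
apply: (measurableT_comp (@measurable_powR R (e - 1))).
by apply: measurableT_comp => //; exact: measurable_sin_half.
Qed.

Lemma measurable_majorant C e d (T : measurableType d) v (f g : T -> v.-tuple R) :
  measurable_fun setT f -> measurable_fun setT g ->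
  measurable_fun setT (fun t => majorant C e (f t) (g t)).
Proof.
move=> mf mg; apply: measurable_prod => i _.
apply: (measurableT_comp (@measurable_majorant_factor C e)).
by apply: measurable_funB; apply: (measurableT_comp (measurable_tnth i)).
Qed.

Lemma integral_majorant_le C e : 0 <= C -> 0 < e -> e < 1 -> exists2 M : R, 0 <= M &
  forall v (x : v.-tuple R), closed_cube x ->
  (\int[mu v]_s (majorant C e x s)%:E <= (M ^+ v)%:E)%E.
Proof.
move=> C0 e0 e1; have [D D0 HD] := integral_sin_powR e0 e1.
have M0 : 0 <= C * (1 + D) by rewrite mulr_ge0// addr_ge0.
exists (C * (1 + D)) => // v x cx.
have := @integral_torus_prod_le R v
  (fun i y => C * (1 + `|sin ((tnth x i - y) / 2)| `^ (e - 1))) (fun=> C * (1 + D)).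
rewrite prodr_const card_ord; apply=> // i.
- apply: (measurableT_comp (@measurable_majorant_factor C e)).
  exact: measurable_funB.
- by move=> y; rewrite mulr_ge0// addr_ge0// powR_ge0.
- have mp : measurable_fun [set: R] (fun y => (`|sin ((tnth x i - y) / 2)| `^ (e - 1))%:E).
    apply/measurable_EFinP; apply: (measurableT_comp (@measurable_powR R (e - 1))).
    apply: measurableT_comp => //.
    apply: (measurableT_comp (@measurable_sin_half R)).
    exact: measurable_funB.
  under eq_integral do rewrite EFinM EFinD.
  have mp1 : measurable_fun [set: R]
      (fun y => 1%:E + (`|sin ((tnth x i - y) / 2)| `^ (e - 1))%:E)%E.
    exact: emeasurable_funD.
  rewrite ge0_integralZl//; last first.
    by move=> y _; rewrite -EFinD lee_fin addr_ge0// powR_ge0.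
  rewrite EFinM; apply: lee_wpmul2l; first by rewrite lee_fin.
  rewrite ge0_integralD//.
  rewrite EFinD integral_cst// mul1e; apply: leeD; last exact: HD.
  exact: (@probability_le1 _ _ _ U).
Qed.

(** Factor by factor (1 + p)^2 <= 2 (1 + p^2). The squared singularity has exponent 2(e - 1) = (2e -
    1) - 1, so the square is integrable as soon as e > 1/2; here r1 > 1/2 enters. *)
Lemma majorant_sqr_le C e v (x s : v.-tuple R) :
  majorant C e x s ^+ 2 <= majorant (2 * C ^+ 2) (2 * e - 1) x s.
Proof.
rewrite /majorant -prodrXl; apply: ler_prod => i _; rewrite sqr_ge0/=.
set t := `|_|.
have -> : t `^ (2 * e - 1 - 1) = (t `^ (e - 1)) ^+ 2.
  by rewrite -powR_mulrn ?powR_ge0// -powRrM; congr (_ `^ _); ring.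
have := sqr_ge0 (C * (1 - t `^ (e - 1))); nra.
Qed.

Definition kernel_majorant C1 e1 C2 e2 d (z w : (d + d).-tuple R) : R :=
  majorant C1 e1 (fst_half z) (fst_half w) * majorant C2 e2 (snd_half z) (snd_half w).

Lemma kernel_majorant_ge0 C1 e1 C2 e2 d (z w : (d + d).-tuple R) : 0 <= C1 -> 0 <= C2 ->
  0 <= kernel_majorant C1 e1 C2 e2 z w.
Proof. by move=> ? ?; rewrite mulr_ge0// majorant_ge0. Qed.

Lemma measurable_kernel_majorant C1 e1 C2 e2 d :
  measurable_fun setT (fun p : (d + d).-tuple R * (d + d).-tuple R =>
    kernel_majorant C1 e1 C2 e2 p.1 p.2).
Proof.
have m1 : measurable_fun setT (fun p : (d + d).-tuple R * (d + d).-tuple R => fst_half p.1).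
  exact: (measurableT_comp (@measurable_fst_half R d)).
have m2 : measurable_fun setT (fun p : (d + d).-tuple R * (d + d).-tuple R => fst_half p.2).
  exact: (measurableT_comp (@measurable_fst_half R d)).
have m3 : measurable_fun setT (fun p : (d + d).-tuple R * (d + d).-tuple R => snd_half p.1).
  exact: (measurableT_comp (@measurable_snd_half R d)).
have m4 : measurable_fun setT (fun p : (d + d).-tuple R * (d + d).-tuple R => snd_half p.2).
  exact: (measurableT_comp (@measurable_snd_half R d)).
by apply: measurable_funM; exact: measurable_majorant.
Qed.

Lemma measurable_kernel_majorant1 C1 e1 C2 e2 d (z : (d + d).-tuple R) :
  measurable_fun setT (kernel_majorant C1 e1 C2 e2 z).
Proof.
exact: (@measurable_fun_pair2 _ _ _ ((d + d).-tuple R) ((d + d).-tuple R) R _ z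
  (@measurable_kernel_majorant C1 e1 C2 e2 d)).
Qed.

(** Extended-valued, since for given x it may be infinite at some y. Where finite, it bounds the
    convolution kernel and all its truncations at z. *)
Definition dominating C1 e1 C2 e2 d (rho : (d + d).-tuple R -> R) (z : (d + d).-tuple R) : \bar R :=
  (\int[mu (d + d)]_w (kernel_majorant C1 e1 C2 e2 z w * rho w)%:E)%E.

Lemma dominating_ge0 C1 e1 C2 e2 d (rho : (d + d).-tuple R -> R) z : 0 <= C1 -> 0 <= C2 ->
  (forall w, 0 <= rho w) -> (0 <= dominating C1 e1 C2 e2 rho z)%E.
Proof.
move=> C10 C20 r0; apply: integral_ge0 => w _.
by rewrite lee_fin mulr_ge0// kernel_majorant_ge0.
Qed.

Lemma measurable_dominating C1 e1 C2 e2 d (rho : (d + d).-tuple R -> R) :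
  0 <= C1 -> 0 <= C2 -> measurable_fun setT rho -> (forall w, 0 <= rho w) ->
  measurable_fun setT (dominating C1 e1 C2 e2 rho).
Proof.
move=> C10 C20 mr r0.
pose F (p : (d + d).-tuple R * (d + d).-tuple R) :=
  (kernel_majorant C1 e1 C2 e2 p.1 p.2 * rho p.2)%:E.
apply: (@measurable_fun_fubini_tonelli_F _ _ ((d + d).-tuple R) ((d + d).-tuple R) R (mu (d + d)) F).
  apply/measurable_EFinP; apply: measurable_funM; first exact: measurable_kernel_majorant.
  exact: (measurableT_comp mr).
by move=> p; rewrite lee_fin mulr_ge0// kernel_majorant_ge0.
Qed.

(** Cauchy-Schwarz with the second majorant G2 split evenly between the factors bounds the square of
    the dominating function by the integral of G1^2 G2 times the integral of G2 rho^2; the latter is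
    then integrated over y. Only G1 gets squared, so e1 > 1/2 is required while e2 > 0 suffices. *)
Lemma integral_dominating_sqr_le C1 e1 C2 e2 d : 0 <= C1 -> 0 <= C2 ->
  1 / 2 < e1 -> e1 < 1 -> 0 < e2 -> e2 < 1 ->
  exists2 M : R, 0 <= M & forall rho : (d + d).-tuple R -> R,
  measurable_fun setT rho -> (forall w, 0 <= rho w) ->
  (\int[mu (d + d)]_w ((rho w) ^+ 2)%:E <= 1)%E -> forall x : d.-tuple R, closed_cube x ->
  (\int[mu d]_y (dominating C1 e1 C2 e2 rho (cat_tuple x y) *
                 dominating C1 e1 C2 e2 rho (cat_tuple x y)) <= M%:E)%E.
Proof.
move=> C10 C20 e1l e1u e2l e2u.
have [||| M1 M10 HM1] := @integral_majorant_le (2 * C1 ^+ 2) (2 * e1 - 1); try lra.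
  by rewrite mulr_ge0// sqr_ge0.
have [M2 M20 HM2] := integral_majorant_le C20 e2l e2u.
pose m1 := M1 ^+ d; pose m2 := M2 ^+ d.
have m10 : 0 <= m1 by rewrite exprn_ge0.
have m20 : 0 <= m2 by rewrite exprn_ge0.
(* One factor for the integral of G1^2, one for that of G2 in its second argument, one for that of
   G2 in y. *)
exists (m1 * m2 * m2); first by rewrite !mulr_ge0.
move=> rho mr r0 r1 x cx.
pose G1 (s : d.-tuple R) := majorant C1 e1 x s.
have G10 s : 0 <= G1 s by exact: majorant_ge0.
have mG1 : measurable_fun setT G1 by apply: measurable_majorant => //; exact: measurable_cst.
pose G2 (y t : d.-tuple R) := majorant C2 e2 y t.
have G20 y t : 0 <= G2 y t by exact: majorant_ge0.
have mG2 y : measurable_fun setT (G2 y) by apply: measurable_majorant => //; exact: measurable_cst.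
have mG2' : measurable_fun setT (fun p : d.-tuple R * d.-tuple R => G2 p.1 p.2).
  exact: measurable_majorant.
have mrho2 : measurable_fun setT (fun w => rho w ^+ 2) by exact: measurable_funX.
pose B y := (\int[mu (d + d)]_w (G2 y (snd_half w) * rho w ^+ 2)%:E)%E.
pose FB (p : d.-tuple R * (d + d).-tuple R) := (G2 p.1 (snd_half p.2) * rho p.2 ^+ 2)%:E.
have mFB : measurable_fun setT FB.
  apply/measurable_EFinP; apply: measurable_funM; last exact: (measurableT_comp mrho2).
  apply: measurable_majorant => //.
  exact: (measurableT_comp (@measurable_snd_half R d)).
have FB0 p : (0 <= FB p)%E by rewrite lee_fin mulr_ge0// sqr_ge0.
have mB : measurable_fun setT B.
  exact: (@measurable_fun_fubini_tonelli_F _ _ (d.-tuple R) ((d + d).-tuple R) R (mu (d + d)) FB).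
have B0 y : (0 <= B y)%E by apply: integral_ge0 => w _; exact: (FB0 (y, w)).
have step y : closed_cube y -> (dominating C1 e1 C2 e2 rho (cat_tuple x y) *
    dominating C1 e1 C2 e2 rho (cat_tuple x y) <= (m1 * m2)%:E * B y)%E.
  move=> cy.
  pose f (w : (d + d).-tuple R) := G1 (fst_half w) * Num.sqrt (G2 y (snd_half w)).
  pose g (w : (d + d).-tuple R) := Num.sqrt (G2 y (snd_half w)) * rho w.
  have mG1f : measurable_fun setT (fun w : (d + d).-tuple R => G1 (fst_half w)).
    exact: (measurableT_comp mG1 (@measurable_fst_half R d)).
  have mG2f : measurable_fun setT (fun w : (d + d).-tuple R => G2 y (snd_half w)).
    exact: (measurableT_comp (mG2 y) (@measurable_snd_half R d)).
  have msq : measurable_fun setT (fun w : (d + d).-tuple R => Num.sqrt (G2 y (snd_half w))).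
    rewrite (_ : (fun w => _) = (fun w => (G2 y (snd_half w)) `^ (2^-1))).
      exact: (measurableT_comp (@measurable_powR R (2^-1)) mG2f).
    by apply/funext => w; rewrite powR12_sqrt.
  have := @ge0_cauchy_schwarz _ _ _ (mu (d + d)) f g _ _ _ _.
  have -> : (\int[mu (d + d)]_w (f w * g w)%:E = dominating C1 e1 C2 e2 rho (cat_tuple x y))%E.
    apply: eq_integral => w _; congr EFin; rewrite /f /g /kernel_majorant fst_half_cat snd_half_cat.
    rewrite -/(G1 _) -/(G2 _ _) mulrA; congr (_ * _).
    by rewrite -mulrA -expr2 sqr_sqrtr.
  have -> : (\int[mu (d + d)]_w (g w ^+ 2)%:E = B y)%E.
    by apply: eq_integral => w _; rewrite /g exprMn sqr_sqrtr.
  move=> CS; apply: le_trans (CS _ _ _ _) _.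
  - exact: measurable_funM.
  - exact: measurable_funM.
  - by move=> w; rewrite mulr_ge0// sqrtr_ge0.
  - by move=> w; rewrite mulr_ge0// sqrtr_ge0.
  apply: lee_wpmul2r; first exact: B0.
  have f2E w : f w ^+ 2 = G1 (fst_half w) ^+ 2 * G2 y (snd_half w).
    by rewrite /f exprMn sqr_sqrtr.
  under eq_integral do rewrite f2E.
  rewrite ge0_integral_torusD; last 2 first.
  - apply/measurable_EFinP; apply: measurable_funM => //; exact: measurable_funX.
  - by move=> w; rewrite lee_fin mulr_ge0// sqr_ge0.
  have inner s : (\int[mu d]_t (G1 (fst_half (cat_tuple s t)) ^+ 2 *
       G2 y (snd_half (cat_tuple s t)))%:E <= (G1 s ^+ 2)%:E * m2%:E)%E.
    under eq_integral do rewrite fst_half_cat snd_half_cat EFinM.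
    rewrite ge0_integralZl//; last 3 first.
    - exact/measurable_EFinP.
    - by move=> t _; rewrite lee_fin.
    - by rewrite lee_fin sqr_ge0.
    by apply: lee_wpmul2l; [rewrite lee_fin sqr_ge0|exact: HM2].
  have mG12 : measurable_fun setT (fun s => (G1 s ^+ 2)%:E).
    by apply/measurable_EFinP; exact: measurable_funX.
  apply: (@le_trans _ _ (\int[mu d]_s ((G1 s ^+ 2)%:E * m2%:E))%E).
    apply: ge0_le_integral_any => // s; apply: integral_ge0 => t _.
    by rewrite lee_fin mulr_ge0// sqr_ge0.
  rewrite ge0_integralZr//; last by move=> s _; rewrite lee_fin sqr_ge0.
  rewrite EFinM; apply: lee_wpmul2r; first by rewrite lee_fin.
  apply: le_trans (HM1 d x cx).
  apply: ge0_le_integral_any => s; rewrite lee_fin ?sqr_ge0//.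
  exact: majorant_sqr_le.
apply: (@le_trans _ _ (\int[mu d]_y ((m1 * m2)%:E * B y))%E).
  apply: le_integral_closed_cube => //.
  - by move=> y; rewrite mule_ge0//; apply: dominating_ge0.
  - by apply: emeasurable_funM => //; exact: measurable_cst.
  - by move=> y; rewrite mule_ge0// lee_fin mulr_ge0.
rewrite ge0_integralZl//; last by rewrite lee_fin mulr_ge0.
rewrite [in leRHS]EFinM; apply: lee_wpmul2l; first by rewrite lee_fin mulr_ge0.
have -> : (\int[mu d]_y B y = \int[mu (d + d)]_w \int[mu d]_y FB (y, w))%E.
  exact: (@fubini_tonelli _ _ (d.-tuple R) ((d + d).-tuple R) R (mu d) (mu (d + d)) FB).
apply: (@le_trans _ _ (\int[mu (d + d)]_w (m2%:E * (rho w ^+ 2)%:E))%E); last first.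
  have mrE : measurable_fun setT (fun w => (rho w ^+ 2)%:E) by exact/measurable_EFinP.
  rewrite ge0_integralZl//; last by move=> w _; rewrite lee_fin sqr_ge0.
  by rewrite -[leRHS]mule1; apply: lee_wpmul2l => //; rewrite lee_fin.
apply: le_integral_closed_cube.
- by move=> w; apply: integral_ge0 => y _; exact: FB0.
- apply: emeasurable_funM; first exact: measurable_cst.
  exact/measurable_EFinP.
- by move=> w; rewrite mule_ge0// lee_fin// sqr_ge0.
- move=> w cw; rewrite /FB/=.
  have cs : closed_cube (snd_half w) by move=> i; rewrite tnth_mktuple; exact: cw.
  under eq_integral do rewrite EFinM.
  have mGs : measurable_fun setT (fun y => (G2 y (snd_half w))%:E).
    apply/measurable_EFinP; apply: measurable_majorant => //; exact: measurable_cst.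
  rewrite ge0_integralZr//; last 2 first.
  - by move=> y _; rewrite lee_fin.
  - by rewrite lee_fin sqr_ge0.
  apply: lee_wpmul2r; first by rewrite lee_fin sqr_ge0.
  under eq_integral do rewrite /G2 majorantC.
  exact: HM2.
Qed.

End Majorant.

(** * Bessel's inequality and dominated integrals *)

Section Bessel.
Context d (T : measurableType d) (R : realType) (P : probability T R).
Implicit Types (f g b psi : T -> R).

Local Notation integrable f := (P.-integrable setT (EFin \o f)).

Lemma integrable_of_sqr psi : measurable_fun setT psi ->
  (\int[P]_x (psi x ^+ 2)%:E < +oo)%E -> integrable psi /\ integrable (fun x => psi x ^+ 2).
Proof.
move=> mpsi fin.
have i2 : integrable (fun x => psi x ^+ 2).
  apply/integrableP; split; first by apply/measurable_EFinP; exact: measurable_funX.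
  rewrite (le_lt_trans _ fin)// le_eqVlt; apply/orP; left; apply/eqP.
  by apply: eq_integral => x _ /=; rewrite ger0_norm// sqr_ge0.
split=> //; have i1 : integrable (fun x => 1 + psi x ^+ 2).
  rewrite (_ : EFin \o _ = (EFin \o cst 1%R) \+ (EFin \o (fun x => psi x ^+ 2)%R))%E; last first.
    exact/funext.
  apply: integrableD => //; apply: bounded_measurable_integrable.
  exact: bounded_measurable_cst.
apply: le_integrable i1 => //; first exact/measurable_EFinP.
move=> x _ /=; rewrite lee_fin [leRHS]ger0_norm ?addr_ge0 ?sqr_ge0//.
by rewrite -[psi x ^+ 2]real_normK ?num_real//; have := sqr_ge0 (`|psi x| - 1); nra.
Qed.

Lemma integrable_boundedM b psi : bounded_measurable b -> integrable psi ->
  integrable (fun x => b x * psi x).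
Proof.
move=> [mb [C bC]] ipsi.
have mpsi : measurable_fun setT psi by apply/measurable_EFinP; case/integrableP: ipsi.
have iC : integrable (fun x => C * psi x).
  rewrite (_ : EFin \o _ = (fun x => C%:E * (EFin \o psi) x))%E; last exact/funext.
  exact: integrableZl.
apply: le_integrable iC => //.
  by apply/measurable_EFinP; exact: measurable_funM.
move=> x _ /=; rewrite lee_fin !normrM ler_wpM2r// (le_trans (bC x))//.
exact: ler_norm.
Qed.

Lemma integrable_sum I (r : seq I) (F : I -> T -> R) : (forall i, integrable (F i)) ->
  integrable (fun x => \sum_(i <- r) F i x).
Proof.
move=> iF; elim: r => [|i r IH].
  rewrite (_ : _ \o _ = EFin \o cst 0); last by apply/funext => x /=; rewrite big_nil.
  apply: bounded_measurable_integrable; exact: bounded_measurable_cst.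
rewrite (_ : _ \o _ = (EFin \o F i) \+ (EFin \o fun x => \sum_(i <- r) F i x)%R)%E.
  exact: integrableD.
by apply/funext => x /=; rewrite big_cons.
Qed.

Lemma Rintegral_sum I (r : seq I) (F : I -> T -> R) : (forall i, integrable (F i)) ->
  \int[P]_x (\sum_(i <- r) F i x) = \sum_(i <- r) \int[P]_x F i x.
Proof.
move=> iF; elim: r => [|i r IH].
  rewrite big_nil; under eq_Rintegral do rewrite big_nil.
  by rewrite Rintegral_cst// mul0r.
rewrite big_cons -IH -RintegralD//; last exact: integrable_sum.
by apply: eq_Rintegral => x _; rewrite big_cons.
Qed.

Lemma bessel (I : finType) (b : I -> T -> R) psi :
  (forall i, bounded_measurable (b i)) ->
  (forall i j, \int[P]_x (b i x * b j x) = (i == j)%:R) ->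
  measurable_fun setT psi -> (\int[P]_x (psi x ^+ 2)%:E < +oo)%E ->
  ((\sum_i (\int[P]_x (b i x * psi x)) ^+ 2)%:E <= \int[P]_x (psi x ^+ 2)%:E)%E.
Proof.
move=> bb ortho mpsi fin; have [ipsi ipsi2] := integrable_of_sqr mpsi fin.
pose c i := \int[P]_x (b i x * psi x).
have ibpsi i : integrable (fun x => b i x * psi x) by exact: integrable_boundedM.
have ibb i j : integrable (fun x => b i x * b j x).
  by apply: bounded_measurable_integrable; exact: bounded_measurableM.
have iZ r f : integrable f -> integrable (fun x => r * f x).
  move=> iff; rewrite (_ : EFin \o _ = (fun x => r%:E * (EFin \o f) x))%E; last exact/funext.
  exact: integrableZl.
pose S x := \sum_i c i * b i x.
have intS : \int[P]_x (\sum_i (2 * c i) * (b i x * psi x)) = 2 * \sum_i c i ^+ 2.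
  rewrite Rintegral_sum; last by move=> i; exact: iZ.
  rewrite mulr_sumr; apply: eq_bigr => i _.
  by rewrite RintegralZl// -mulrA -expr2.
have intSS : \int[P]_x (\sum_i \sum_j (c i * c j) * (b i x * b j x)) = \sum_i c i ^+ 2.
  rewrite Rintegral_sum; last by move=> i; apply: integrable_sum => j; exact: iZ.
  apply: eq_bigr => i _; rewrite Rintegral_sum; last by move=> j; exact: iZ.
  rewrite (bigD1 i)//= big1 => [|j ji].
    by rewrite RintegralZl// ortho eqxx mulr1 addr0 expr2.
  by rewrite RintegralZl// ortho eq_sym (negPf ji) mulr0.
have iA : integrable (fun x => \sum_i (2 * c i) * (b i x * psi x)).
  by apply: integrable_sum => i; exact: iZ.
have iB : integrable (fun x => \sum_i \sum_j (c i * c j) * (b i x * b j x)).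
  by apply: integrable_sum => i; apply: integrable_sum => j; exact: iZ.
have iAB : integrable (fun x => psi x ^+ 2 - \sum_i (2 * c i) * (b i x * psi x)).
  rewrite (_ : EFin \o _ = (EFin \o (fun x => psi x ^+ 2)%R) \-
    (EFin \o (fun x => \sum_i (2 * c i) * (b i x * psi x))%R))%E; last exact/funext.
  exact: integrableB.
(* The integrand is the square of [psi] minus its partial expansion, expanded so that orthonormality
   can be applied term by term. *)
have : 0 <= \int[P]_x ((psi x ^+ 2 - \sum_i (2 * c i) * (b i x * psi x)) +
    \sum_i \sum_j (c i * c j) * (b i x * b j x)).
  apply: Rintegral_ge0 => x _.
  rewrite (_ : _ + _ = (psi x - S x) ^+ 2) ?sqr_ge0// sqrrB.
  congr (_ - _ + _).
    by rewrite /S mulr_sumr -sumrMnl; apply: eq_bigr => i _; ring.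
  rewrite /S expr2 mulr_suml; apply: eq_bigr => i _; rewrite mulr_sumr.
  by apply: eq_bigr => j _; ring.
rewrite RintegralD// RintegralB// intS intSS => h.
have -> : (\int[P]_x (psi x ^+ 2)%:E = (\int[P]_x (psi x ^+ 2))%:E)%E.
  by rewrite fineK//; exact: integrable_fin_num.
by rewrite lee_fin -/c; lra.
Qed.

End Bessel.

Section Comparison.
Context d (T : measurableType d) (R : realType) (P : probability T R).

Lemma norm_Rintegral_le (f g : T -> R) : measurable_fun setT f -> measurable_fun setT g ->
  {ae P, forall x, `|f x| <= g x} -> (\int[P]_x (g x)%:E < +oo)%E -> (forall x, 0 <= g x) ->
  P.-integrable setT (EFin \o f) /\ `|\int[P]_x f x| <= \int[P]_x g x.
Proof.
move=> mf mg fg fin g0.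
have ig : P.-integrable setT (EFin \o g).
  apply/integrableP; split; first exact/measurable_EFinP.
  rewrite (le_lt_trans _ fin)// le_eqVlt; apply/orP; left; apply/eqP.
  by apply: eq_integral => x _ /=; rewrite ger0_norm.
have le : (\int[P]_x `|(f x)%:E| <= \int[P]_x (g x)%:E)%E.
  apply: ae_ge0_le_integral => //.
  - apply: measurableT_comp => //; exact/measurable_EFinP.
  - by move=> x _; rewrite lee_fin.
  - exact/measurable_EFinP.
  - by apply: filterS fg => x fgx _; rewrite lee_fin.
have fi : P.-integrable setT (EFin \o f).
  by apply/integrableP; split; [exact/measurable_EFinP|exact: le_lt_trans le fin].
split=> //; rewrite (le_trans (le_normr_Rintegral _ fi))//.
rewrite /Rintegral fine_le//.
- by have /integrable_abse := fi; exact: integrable_fin_num.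
- exact: integrable_fin_num.
Qed.

End Comparison.

(** * Fourier truncation of the kernel *)

Section TrigProducts.
Context {R : realType}.

Local Notation mu v := (torus_measure R v).

Definition trig_prod v (th : 'I_v -> R) (k : 'I_v -> nat) (x : v.-tuple R) : R :=
  \prod_i trig (th i) (k i) (tnth x i).

Definition weight_prod (a : R) v (k : 'I_v -> nat) : R := \prod_i weight a (k i).

Lemma weight_prod_ge0 a v (k : 'I_v -> nat) : 0 <= weight_prod a k.
Proof. by apply: prodr_ge0 => i _; exact: powR_ge0. Qed.

(** Each frequency is at least 2 to its dyadic level, so the exponents add up to the sum of the
    levels. Off the hyperbolic cross the product of weights is therefore small. *)
Lemma weight_prod_le a J v (k : 'I_v -> nat) : 0 <= a ->
  (J <= \sum_i dyadic (k i))%N -> weight_prod a k <= (2 `^ (- a)) ^+ J.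
Proof.
move=> a0 Jk; apply: (@le_trans _ _ (\prod_i (2 `^ (- a)) ^+ dyadic (k i))).
  apply: ler_prod => i _; rewrite powR_ge0/= /weight.
  rewrite -powR_mulrn ?powR_ge0// powRAC powR_mulrn//.
  rewrite !powRN lef_pV2 ?posrE ?powR_gt0 ?ltr0n ?freq_gt0 ?exprn_gt0//.
  by rewrite ge0_ler_powR ?nnegrE ?exprn_ge0// -natrX ler_nat dyadic_le.
rewrite -expr_sum ler_wiXn2l ?powR_ge0//.
rewrite powRN invf_le1 ?powR_gt0//.
by rewrite -[leLHS](powRr0 2) ler_powR// ler1n.
Qed.

Lemma bounded_measurable_trig_prod v (th : 'I_v -> R) (k : 'I_v -> nat) :
  bounded_measurable (trig_prod th k).
Proof.
apply: bounded_measurable_prod => i; have [m [C hC]] := bounded_measurable_trig (th i) (k i).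
split; last by exists C => x; exact: hC.
exact: (measurableT_comp m (measurable_tnth i)).
Qed.

Lemma Rintegral_trig_prod v (th : 'I_v -> R) (k k' : 'I_v -> nat) :
  \int[mu v]_x (trig_prod th k x * trig_prod th k' x) = [forall i, k i == k' i]%:R.
Proof.
rewrite /trig_prod; under eq_Rintegral do rewrite -big_split.
rewrite (Rintegral_torus_prod (g := fun i y => trig (th i) (k i) y * trig (th i) (k' i) y)).
  under eq_bigr do rewrite Rintegral_trig.
  have [/forallP H|/forallPn[i /negPf ki]] := boolP [forall i, k i == k' i].
    by rewrite big1// => i _; rewrite H.
  by rewrite (bigD1 i)//= ki mul0r.
by move=> i; apply: bounded_measurableM; exact: bounded_measurable_trig.
Qed.

Lemma eq_ffun_forall v N (f g : {ffun 'I_v -> 'I_N}) :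
  [forall i, (f i : nat) == g i] = (f == g).
Proof.
apply/forallP/eqP => [H|-> //]; apply/ffunP => i; apply: val_inj; exact: (eqP (H i)).
Qed.

Definition trig_prod2 d (t1 t2 : R) (k l : 'I_d -> nat) (w : (d + d).-tuple R) : R :=
  trig_prod (fun=> t1) k (fst_half w) * trig_prod (fun=> t2) l (snd_half w).

Lemma trig_prod2E d (t1 t2 : R) (k l : 'I_d -> nat) (w : (d + d).-tuple R) :
  trig_prod2 t1 t2 k l w = trig_prod
    (fun i => match fintype.split i with inl _ => t1 | inr _ => t2 end)
    (fun i => match fintype.split i with inl j => k j | inr j => l j end) w.
Proof.
rewrite /trig_prod2 /trig_prod big_split_ord/=; congr (_ * _); apply: eq_bigr => i _.
  by rewrite (unsplitK (inl i)) tnth_mktuple.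
by rewrite (unsplitK (inr i)) tnth_mktuple.
Qed.

Lemma bounded_measurable_trig_prod2 d (t1 t2 : R) (k l : 'I_d -> nat) :
  bounded_measurable (trig_prod2 t1 t2 k l).
Proof.
rewrite (funext (trig_prod2E t1 t2 k l)); exact: bounded_measurable_trig_prod.
Qed.

Lemma Rintegral_trig_prod2 d N (t1 t2 : R) (f g f' g' : {ffun 'I_d -> 'I_N}) :
  \int[mu (d + d)]_w (trig_prod2 t1 t2 (fun i => f i) (fun i => g i) w *
    trig_prod2 t1 t2 (fun i => f' i) (fun i => g' i) w) = ((f, g) == (f', g'))%:R.
Proof.
under eq_Rintegral do rewrite !trig_prod2E.
rewrite Rintegral_trig_prod; congr ((nat_of_bool _)%:R); apply/esym.
apply/eqP/forallP => [[-> ->] i //|H]; congr (_, _); apply/ffunP => i; apply: val_inj.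
  by have /eqP := H (lshift d i); rewrite (unsplitK (inl i)).
by have /eqP := H (rshift d i); rewrite (unsplitK (inr i)).
Qed.

Definition bernoulli_sum_prod v (a : 'I_v -> R) N (x : v.-tuple R) : R :=
  \prod_j bernoulli_sum (a j) N (tnth x j).

Lemma bernoulli_sum_prodE d (r1 r2 : R) N (z w : (d + d).-tuple R) :
  bernoulli_sum_prod (pair_exponent (d := d) r1 r2) N (tuple_sub z w) =
  \sum_(f : {ffun 'I_d -> 'I_(N.*2.+1)}) \sum_(g : {ffun 'I_d -> 'I_(N.*2.+1)})
    weight_prod r1 (fun i => f i) * weight_prod r2 (fun i => g i) *
    trig_prod2 0 0 (fun i => f i) (fun i => g i) z *
    trig_prod2 (r1 * pi / 2) (r2 * pi / 2) (fun i => f i) (fun i => g i) w.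
Proof.
rewrite /bernoulli_sum_prod big_split_ord/=.
have E1 (i : 'I_d) : bernoulli_sum (pair_exponent (d := d) r1 r2 (lshift d i)) N
    (tnth (tuple_sub z w) (lshift d i)) =
    \sum_(j < N.*2.+1) weight r1 j * trig 0 j (tnth (fst_half z) i) *
      trig (r1 * pi / 2) j (tnth (fst_half w) i).
  by rewrite /pair_exponent/= ltn_ord !tnth_mktuple bernoulli_sumE.
have E2 (i : 'I_d) : bernoulli_sum (pair_exponent (d := d) r1 r2 (rshift d i)) N
    (tnth (tuple_sub z w) (rshift d i)) =
    \sum_(j < N.*2.+1) weight r2 j * trig 0 j (tnth (snd_half z) i) *
      trig (r2 * pi / 2) j (tnth (snd_half w) i).
  by rewrite /pair_exponent/= ltnNge leq_addr/= !tnth_mktuple bernoulli_sumE.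
rewrite (eq_bigr _ (fun i _ => E1 i)) [X in _ * X](eq_bigr _ (fun i _ => E2 i)).
rewrite !bigA_distr_bigA/= mulr_suml; apply: eq_bigr => f _; rewrite mulr_sumr.
apply: eq_bigr => g _; rewrite !big_split/= /trig_prod2 /trig_prod /weight_prod.
ring.
Qed.

End TrigProducts.

Section KernelApproximation.
Context {R : realType}.
Implicit Types (C e r eta : R).

Local Notation mu v := (torus_measure R v).

(** The factors are exchanged one at a time, through A A' - B B' = (A - B) A' + B (A' - B'), the
    others being bounded by [G]. *)
Lemma prod_diff_le n (F P G : 'I_n -> R) eta : 0 <= eta ->
  (forall i, `|F i| <= G i) -> (forall i, `|P i| <= G i) ->
  (forall i, `|F i - P i| <= eta * G i) ->
  `|\prod_i F i - \prod_i P i| <= n%:R * eta * \prod_i G i.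
Proof.
move=> eta0; elim: n F P G => [|n IH] F P G FG PG FPG.
  by rewrite !big_ord0 subrr normr0 mul0r mul0r.
have G0 i : 0 <= G i by exact: le_trans (FG i).
rewrite !big_ord_recl.
set A := F ord0; set B := P ord0; set A' := \prod_(i < n) F _; set B' := \prod_(i < n) P _.
have -> : A * A' - B * B' = (A - B) * A' + B * (A' - B') by ring.
have A'G : `|A'| <= \prod_(i < n) G (lift ord0 i).
  by rewrite normr_prod; apply: ler_prod => i _; rewrite normr_ge0 FG.
have IH' := IH (fun i => F (lift ord0 i)) (fun i => P (lift ord0 i))
  (fun i => G (lift ord0 i)) (fun i => FG _) (fun i => PG _) (fun i => FPG _).
rewrite (le_trans (ler_normD _ _))// !normrM.
have h1 : `|A - B| * `|A'| <= eta * G ord0 * \prod_(i < n) G (lift ord0 i).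
  by apply: ler_pM => //; exact: FPG.
have h2 : `|B| * `|A' - B'| <= G ord0 * (n%:R * eta * \prod_(i < n) G (lift ord0 i)).
  by apply: ler_pM => //; exact: PG.
rewrite (le_trans (lerD h1 h2))// -natr1 le_eqVlt; apply/orP; left; apply/eqP; ring.
Qed.

(** Abstracts the kernel estimates with a rate [dl] common to the exponents r1 and r2, so that
    products over all coordinates can be treated uniformly. *)
Definition approximates r e C dl := forall u, sin (u / 2) != 0 ->
  let G := C * (1 + `|sin (u / 2)| `^ (e - 1)) in
  [/\ `|bernoulli_kernel r u| <= G, (forall N, `|bernoulli_sum r N u| <= G) &
      (forall N, `|bernoulli_kernel r u - bernoulli_sum r N u| <= N.+1%:R `^ (- dl) * G)].

Variables (d : nat) (r1 r2 e1 e2 C1 C2 dl : R).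
Hypotheses (r10 : 0 < r1) (r20 : 0 < r2) (C10 : 0 <= C1) (C20 : 0 <= C2).
Hypothesis approx1 : approximates r1 e1 C1 dl.
Hypothesis approx2 : approximates r2 e2 C2 dl.

Local Notation a := (pair_exponent (d := d) r1 r2).
Local Notation KM := (kernel_majorant C1 e1 C2 e2).

Lemma kernel_prod_approx (z w : (d + d).-tuple R) :
  (forall i, sin ((tnth z i - tnth w i) / 2) != 0) ->
  [/\ `|bernoulli_kernel_prod a (tuple_sub z w)| <= KM z w,
      (forall N, `|bernoulli_sum_prod a N (tuple_sub z w)| <= KM z w) &
      (forall N, `|bernoulli_kernel_prod a (tuple_sub z w) -
                   bernoulli_sum_prod a N (tuple_sub z w)| <=
         (d + d)%:R * N.+1%:R `^ (- dl) * KM z w)].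
Proof.
move=> szw.
pose G (i : 'I_(d + d)) := pair_exponent (d := d) C1 C2 i *
  (1 + `|sin ((tnth z i - tnth w i) / 2)| `^ (pair_exponent (d := d) e1 e2 i - 1)).
have KME : KM z w = \prod_i G i.
  rewrite /KM /majorant [RHS]big_split_ord/=; congr (_ * _); apply: eq_bigr => i _.
    by rewrite /G /pair_exponent/= ltn_ord !tnth_mktuple.
  by rewrite /G /pair_exponent/= ltnNge leq_addr/= !tnth_mktuple.
have H i : [/\ `|bernoulli_kernel (a i) (tnth (tuple_sub z w) i)| <= G i,
    (forall N, `|bernoulli_sum (a i) N (tnth (tuple_sub z w) i)| <= G i) &
    (forall N, `|bernoulli_kernel (a i) (tnth (tuple_sub z w) i) -
       bernoulli_sum (a i) N (tnth (tuple_sub z w) i)| <= N.+1%:R `^ (- dl) * G i)].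
  rewrite tnth_mktuple /G /pair_exponent; case: ifP => _; [exact: approx1|exact: approx2].
rewrite KME; split=> [|N|N].
- rewrite /bernoulli_kernel_prod normr_prod; apply: ler_prod => i _.
  by rewrite normr_ge0; have [] := H i.
- rewrite /bernoulli_sum_prod normr_prod; apply: ler_prod => i _.
  by rewrite normr_ge0; have [_ + _] := H i; apply.
- apply: prod_diff_le => [|i|i|i]; first exact: powR_ge0.
  + by have [] := H i.
  + by have [_ + _] := H i; apply.
  + by have [_ _] := H i; apply.
Qed.

Lemma measurable_tuple_sub_coord (f : R -> R) (z : (d + d).-tuple R) i : measurable_fun setT f ->
  measurable_fun setT (fun w => f (tnth (tuple_sub z w) i)).
Proof.
move=> mf; rewrite (_ : (fun w => _) = (fun w => f (tnth z i - tnth w i))).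
  apply: (measurableT_comp mf); apply: measurable_funB => //; exact: measurable_tnth.
by apply/funext => w; rewrite tnth_mktuple.
Qed.

Lemma measurable_kernel_prod (z : (d + d).-tuple R) :
  measurable_fun setT (fun w => bernoulli_kernel_prod a (tuple_sub z w)).
Proof.
apply: measurable_prod => i _; apply: measurable_tuple_sub_coord.
by apply: measurable_bernoulli_kernel; rewrite /pair_exponent; case: ifP.
Qed.

Lemma measurable_sum_prod N (z : (d + d).-tuple R) :
  measurable_fun setT (fun w => bernoulli_sum_prod a N (tuple_sub z w)).
Proof.
apply: measurable_prod => i _; apply: measurable_tuple_sub_coord.
exact: measurable_bernoulli_sum.
Qed.

Lemma ae_nonsingular (z : (d + d).-tuple R) : closed_cube z ->
  {ae mu (d + d), forall w, forall i, sin ((tnth z i - tnth w i) / 2) != 0}.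
Proof.
move=> cz; have := @torus_coord_ae R (d + d) (fun i => [set y | sin ((tnth z i - y) / 2) = 0]).
move=> H; apply: filterS (H _ _).
- by move=> w Hw i; apply/eqP; exact: Hw.
- move=> i; have mf : measurable_fun setT (fun y : R => sin ((tnth z i - y) / 2)).
    apply: (measurableT_comp (@measurable_sin_half R)).
    exact: measurable_funB.
  have := mf measurableT [set 0] (measurable_set1 0); rewrite setTI; congr measurable.
- by move=> i; apply: uniform_prob_sin_eq0; exact: cz.
Qed.

Definition real_convolution (F : (d + d).-tuple R -> R) (psi : (d + d).-tuple R -> R) z :=
  \int[mu (d + d)]_w (F (tuple_sub z w) * psi w).

(** The estimates hold at every point of the closed cube where the dominating function is finite,
    not only almost everywhere: the kernel has to be evaluated at prescribed xi. *)
Lemma real_convolution_approx (rho psi : (d + d).-tuple R -> R) (z : (d + d).-tuple R) N :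
  closed_cube z -> measurable_fun setT rho -> measurable_fun setT psi ->
  (forall w, `|psi w| <= rho w) -> (dominating C1 e1 C2 e2 rho z < +oo)%E ->
  `|real_convolution (bernoulli_sum_prod a N) psi z| <= fine (dominating C1 e1 C2 e2 rho z) /\
  `|real_convolution (bernoulli_kernel_prod a) psi z -
    real_convolution (bernoulli_sum_prod a N) psi z| <=
    (d + d)%:R * N.+1%:R `^ (- dl) * fine (dominating C1 e1 C2 e2 rho z).
Proof.
move=> cz mrho mpsi psirho fin.
have rho0 w : 0 <= rho w by exact: le_trans (psirho w).
have KM0 w : 0 <= KM z w by exact: kernel_majorant_ge0.
pose g w := KM z w * rho w.
have g0 w : 0 <= g w by rewrite mulr_ge0.
have mg : measurable_fun setT g.
  by apply: measurable_funM => //; exact: measurable_kernel_majorant1.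
have finE : fine (dominating C1 e1 C2 e2 rho z) = \int[mu (d + d)]_w g w by [].
pose eta := (d + d)%:R * N.+1%:R `^ (- dl).
have eta0 : 0 <= eta by rewrite mulr_ge0// powR_ge0.
have [iP leP] : (mu (d + d)).-integrable setT
    (EFin \o (fun w => bernoulli_sum_prod a N (tuple_sub z w) * psi w)) /\
    `|\int[mu (d + d)]_w (bernoulli_sum_prod a N (tuple_sub z w) * psi w)| <=
    \int[mu (d + d)]_w g w.
  apply: norm_Rintegral_le => //.
    by apply: measurable_funM => //; exact: measurable_sum_prod.
  apply: filterS (ae_nonsingular cz) => w /kernel_prod_approx[_ H _].
  by rewrite normrM ler_pM.
have [iF _] : (mu (d + d)).-integrable setT
    (EFin \o (fun w => bernoulli_kernel_prod a (tuple_sub z w) * psi w)) /\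
    `|\int[mu (d + d)]_w (bernoulli_kernel_prod a (tuple_sub z w) * psi w)| <=
    \int[mu (d + d)]_w g w.
  apply: norm_Rintegral_le => //.
    by apply: measurable_funM => //; exact: measurable_kernel_prod.
  apply: filterS (ae_nonsingular cz) => w /kernel_prod_approx[H _ _].
  by rewrite normrM ler_pM.
split=> //.
rewrite /real_convolution -RintegralB// finE -/eta.
have ig : (mu (d + d)).-integrable setT (EFin \o g).
  apply/integrableP; split; first exact/measurable_EFinP.
  rewrite (le_lt_trans _ fin)// le_eqVlt; apply/orP; left; apply/eqP.
  by apply: eq_integral => x _ /=; rewrite ger0_norm.
rewrite -RintegralZl//.
have [_] : (mu (d + d)).-integrable setT
    (EFin \o (fun w => bernoulli_kernel_prod a (tuple_sub z w) * psi w -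
       bernoulli_sum_prod a N (tuple_sub z w) * psi w)) /\
    `|\int[mu (d + d)]_w (bernoulli_kernel_prod a (tuple_sub z w) * psi w -
       bernoulli_sum_prod a N (tuple_sub z w) * psi w)| <=
    \int[mu (d + d)]_w (eta * g w).
  apply: norm_Rintegral_le.
  - apply: measurable_funB; apply: measurable_funM => //.
      exact: measurable_kernel_prod.
    exact: measurable_sum_prod.
  - exact: measurable_funM.
  - apply: filterS (ae_nonsingular cz) => w /kernel_prod_approx[_ _ H].
    by rewrite -mulrBl normrM /g mulrA ler_pM.
  - rewrite (_ : (\int[mu (d + d)]_w (eta * g w)%:E)%E = (eta%:E * \int[mu (d + d)]_w (g w)%:E)%E).
      by rewrite lte_mul_pinfty// lee_fin.
    rewrite -ge0_integralZl//; first exact/measurable_EFinP.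
    by move=> w _; rewrite lee_fin.
  - by move=> w; rewrite mulr_ge0.
exact.
Qed.

End KernelApproximation.

Section FiniteKernel.
Context {R : realType}.

Local Notation mu v := (torus_measure R v).

Lemma ae_torus v : {ae mu v, forall x, @torus R v x}.
Proof.
have : {ae mu v, forall x, forall i : 'I_v, ~ [set (2 * pi : R)] (tnth x i)}.
  apply: (@torus_coord_ae R v (fun=> [set (2 * pi : R)])) => i; first exact: measurable_set1.
  apply/eqP; rewrite eq_le measure_ge0 andbT.
  by rewrite (le_trans (uniform_prob_le (measurable_set1 _)))// lebesgue_measure_set1.
apply: filterS2 (@ae_closed_cube R v) => x cx nx i.
by have /andP[-> x2] := cx i; rewrite lt_neqAle x2 andbT; apply/eqP; exact: nx.
Qed.

Lemma torus_closed_cube v (x : v.-tuple R) : torus x -> closed_cube x.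
Proof. by move=> tx i; have /andP[-> /ltW ->] := tx i. Qed.

Variables (d N : nat).
Local Notation I := {ffun 'I_d -> 'I_N}.
Local Notation n := #|{: I}|.

Definition trig_row (x : d.-tuple R) : 'rV[R]_n :=
  \row_j trig_prod (fun=> 0) (fun i => (enum_val j : I) i) x.

Lemma bounded_measurable_trig_row j : bounded_measurable (fun x => trig_row x 0 j).
Proof.
rewrite (_ : (fun x => _) = trig_prod (fun=> 0) (fun i => (enum_val j : I) i)).
  exact: bounded_measurable_trig_prod.
by apply/funext => x; rewrite mxE.
Qed.

Lemma Rintegral_trig_row i j : \int[mu d]_x (trig_row x 0 i * trig_row x 0 j) = (i == j)%:R.
Proof.
under eq_Rintegral do rewrite !mxE.
by rewrite Rintegral_trig_prod eq_ffun_forall (inj_eq enum_val_inj).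
Qed.

Lemma quad_formE (A : 'M[R]_n) (x y : d.-tuple R) :
  (trig_row x *m A *m (trig_row y)^T) 0 0 =
  \sum_i \sum_j A i j * (trig_row x 0 i * trig_row y 0 j).
Proof.
rewrite mxE exchange_big/=; apply: eq_bigr => j _; rewrite [_^T _ _]mxE mxE mulr_suml.
by apply: eq_bigr => i _; ring.
Qed.

Lemma bounded_measurable_bilin (A : 'M[R]_n) d' (T : measurableType d') (f g : T -> d.-tuple R) :
  measurable_fun setT f -> measurable_fun setT g ->
  bounded_measurable (fun t => (trig_row (f t) *m A *m (trig_row (g t))^T) 0 0).
Proof.
move=> mf mg.
rewrite (_ : (fun t => _) = (fun t => \sum_i \sum_j A i j * (trig_row (f t) 0 i * trig_row (g t) 0 j))).
  apply: bounded_measurable_sum => i; apply: bounded_measurable_sum => j.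
  apply: bounded_measurableM; first exact: bounded_measurable_cst.
  have [m1 [K1 b1]] := bounded_measurable_trig_row i.
  have [m2 [K2 b2]] := bounded_measurable_trig_row j.
  apply: bounded_measurableM; split.
  - exact: (measurableT_comp m1).
  - by exists K1 => t; exact: b1.
  - exact: (measurableT_comp m2).
  - by exists K2 => t; exact: b2.
by apply/funext => t; rewrite quad_formE.
Qed.

Lemma Rintegral_quad_form (A : 'M[R]_n) :
  \int[mu d]_x ((trig_row x *m A *m (trig_row x)^T) 0 0) = \tr A.
Proof.
under eq_Rintegral do rewrite quad_formE.
have ib i j : (mu d).-integrable setT (EFin \o (fun x => A i j * (trig_row x 0 i * trig_row x 0 j))).
  apply: bounded_measurable_integrable; apply: bounded_measurableM.
    exact: bounded_measurable_cst.
  by apply: bounded_measurableM; exact: bounded_measurable_trig_row.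
rewrite Rintegral_sum; last by move=> i; apply: integrable_sum => j; exact: ib.
apply: eq_bigr => i _; rewrite Rintegral_sum; last by move=> j; exact: ib.
have E j : \int[mu d]_x (A i j * (trig_row x 0 i * trig_row x 0 j)) = A i j * (i == j)%:R.
  rewrite RintegralZl ?Rintegral_trig_row//.
  apply: bounded_measurable_integrable.
  by apply: bounded_measurableM; exact: bounded_measurable_trig_row.
rewrite (eq_bigr _ (fun j _ => E j)) (bigD1 i)//= big1 => [|j ji].
  by rewrite eqxx mulr1 addr0.
by rewrite eq_sym (negPf ji) mulr0.
Qed.

(** By orthonormality the integral of the quadratic form is its trace, and an average is at most an
    upper bound. *)
Lemma averaging_trig_row : averaging (@torus R d) trig_row.
Proof.
move=> A t At; rewrite -Rintegral_quad_form.
pose f x := (trig_row x *m A *m (trig_row x)^T) 0 0.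
have bf : bounded_measurable f by exact: bounded_measurable_bilin.
have [mf [C fC]] := bf.
(* The bound by [t] is known on the half-open torus only. The minimum satisfies it everywhere and
   has the same integral, the torus being of full measure. *)
have bg : bounded_measurable (fun x => Num.min (f x) t).
  split; first exact: measurable_minr.
  exists (C + `|t|) => x; rewrite minEle; case: ifP => _.
    by rewrite (le_trans (fC x))// lerDl.
  by rewrite lerDr (le_trans _ (fC x)).
have i1 := bounded_measurable_integrable (mu d) bf.
have i2 := bounded_measurable_integrable (mu d) bg.
have -> : \int[mu d]_x f x = \int[mu d]_x (Num.min (f x) t).
  rewrite /Rintegral; congr fine; apply: ae_eq_integral => //.
  - by case/integrableP: i1.
  - by case/integrableP: i2.
  - by apply: filterS (@ae_torus d) => x tx _; rewrite /= min_l// At.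
have tE : \int[mu d]_x t = t.
  by rewrite Rintegral_cst// [X in fine X](@probability_setT _ _ _ (mu d)) mulr1.
have i3 := bounded_measurable_integrable (mu d) (@bounded_measurable_cst _ (d.-tuple R) R t).
rewrite -[leRHS]tE; apply: (le_Rintegral measurableT i2 i3) => // x _.
by rewrite ge_min lexx orbT.
Qed.

Lemma parseval (al : 'rV[R]_n) :
  (\int[mu d]_y (((al *m (trig_row y)^T) 0 0) ^+ 2)%:E = ((al *m al^T) 0 0)%:E)%E.
Proof.
pose A := al^T *m al.
have E y : ((al *m (trig_row y)^T) 0 0) ^+ 2 = (trig_row y *m A *m (trig_row y)^T) 0 0.
  rewrite /A !mulmxA -mulmxA [RHS]mxE big_ord1 expr2; congr (_ * _).
  by rewrite -[in RHS](trmxK (trig_row y)) -trmx_mul [RHS]mxE.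
under eq_integral do rewrite E.
have bA : bounded_measurable (fun y => (trig_row y *m A *m (trig_row y)^T) 0 0).
  exact: bounded_measurable_bilin.
have -> : ((al *m al^T) 0 0) = \int[mu d]_y ((trig_row y *m A *m (trig_row y)^T) 0 0).
  by rewrite Rintegral_quad_form /A mxtrace_mulC trace_mx11.
by rewrite fineK//; apply: integrable_fin_num => //; exact: bounded_measurable_integrable.
Qed.

Definition fourier_matrix (t1 t2 : R) (psi : (d + d).-tuple R -> R) : 'M[R]_n :=
  \matrix_(i, j) \int[mu (d + d)]_w
    (trig_prod2 t1 t2 (fun k => (enum_val i : I) k) (fun k => (enum_val j : I) k) w * psi w).

Lemma fourier_matrix_bessel t1 t2 (psi : (d + d).-tuple R -> R) : measurable_fun setT psi ->
  (\int[mu (d + d)]_w (psi w ^+ 2)%:E < +oo)%E ->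
  ((\tr (fourier_matrix t1 t2 psi *m (fourier_matrix t1 t2 psi)^T))%:E <=
     \int[mu (d + d)]_w (psi w ^+ 2)%:E)%E.
Proof.
move=> mpsi fin; rewrite mxtrace_mul_tr.
pose b (p : 'I_n * 'I_n) w :=
  trig_prod2 t1 t2 (fun k => (enum_val p.1 : I) k) (fun k => (enum_val p.2 : I) k) w.
have bb p : bounded_measurable (b p) by exact: bounded_measurable_trig_prod2.
have ortho p q : \int[mu (d + d)]_w (b p w * b q w) = (p == q)%:R.
  rewrite Rintegral_trig_prod2; congr ((nat_of_bool _)%:R).
  by case: p q => [p1 p2] [q1 q2]; rewrite !xpair_eqE !(inj_eq enum_val_inj).
have := bessel bb ortho mpsi fin; congr (_%:E <= _)%E.
rewrite pair_bigA/=; apply: eq_bigr => -[i j] _.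
by rewrite !mxE expr2.
Qed.

Definition weight_vec (a : R) (i : 'I_n) : R := weight_prod a (fun k => (enum_val i : I) k).

End FiniteKernel.

Section PartialKernel.
Context {R : realType}.
Variables (d N : nat) (r1 r2 : R).
Local Notation M := (N.*2.+1).
Local Notation n := #|{: {ffun 'I_d -> 'I_M}}|.
Local Notation mu v := (torus_measure R v).

Lemma real_convolution_bilin (psi : (d + d).-tuple R -> R) (x y : d.-tuple R) :
  (mu (d + d)).-integrable setT (EFin \o psi) ->
  real_convolution (bernoulli_sum_prod (pair_exponent (d := d) r1 r2) N) psi (cat_tuple x y) =
  (trig_row M x *m (\matrix_(i, j) (weight_vec r1 i *
     fourier_matrix (d := d) M (r1 * pi / 2) (r2 * pi / 2) psi i j * weight_vec r2 j)) *m
   (trig_row M y)^T) 0 0.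
Proof.
move=> ipsi; rewrite quad_formE /real_convolution.
pose t f g (w : (d + d).-tuple R) := trig_prod2 (r1 * pi / 2) (r2 * pi / 2)
  (fun i => (f : {ffun 'I_d -> 'I_M}) i) (fun i => (g : {ffun 'I_d -> 'I_M}) i) w.
pose c (f g : {ffun 'I_d -> 'I_M}) := weight_prod r1 (fun i => f i) * weight_prod r2 (fun i => g i) *
  trig_prod2 0 0 (fun i => f i) (fun i => g i) (cat_tuple x y).
have itp f g : (mu (d + d)).-integrable setT (EFin \o (fun w => t f g w * psi w)).
  by apply: integrable_boundedM => //; exact: bounded_measurable_trig_prod2.
have ictp f g : (mu (d + d)).-integrable setT (EFin \o (fun w => c f g * (t f g w * psi w))).
  rewrite (_ : EFin \o _ = (fun w => (c f g)%:E * (EFin \o (fun w => t f g w * psi w)%R) w))%E.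
    exact: integrableZl.
  exact/funext.
have -> : \int[mu (d + d)]_w (bernoulli_sum_prod (pair_exponent (d := d) r1 r2) N
     (tuple_sub (cat_tuple x y) w) * psi w) =
   \int[mu (d + d)]_w (\sum_f \sum_g c f g * (t f g w * psi w)).
  apply: eq_Rintegral => w _; rewrite bernoulli_sum_prodE mulr_suml; apply: eq_bigr => f _.
  by rewrite mulr_suml; apply: eq_bigr => g _; rewrite mulrA.
rewrite Rintegral_sum; last by move=> f; exact: integrable_sum.
rewrite (reindex (fun k : 'I_n => enum_val k))/=; last exact: onW_bij (enum_val_bij _).
apply: eq_bigr => i _; rewrite Rintegral_sum//.
rewrite (reindex (fun k : 'I_n => enum_val k))/=; last exact: onW_bij (enum_val_bij _).
apply: eq_bigr => j _; rewrite RintegralZl// /c /trig_prod2 fst_half_cat snd_half_cat.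
rewrite !mxE -/(t _ _) /weight_vec; ring.
Qed.

End PartialKernel.

(** * Residuals and projections onto hyperbolic crosses *)

Section ResidualAlgebra.
Context {R : realType} (X : eqType) (N : nat) (c : X -> 'rV[R]_N).

Lemma residual_row_mx M1 M2 (V1 : 'M[R]_(N, M1)) (V2 : 'M[R]_(N, M2)) s :
  residual c (row_mx V1 V2) s = row_mx (residual c V1 s) (residual c V2 s).
Proof. by rewrite /residual mul_mx_row opp_row_mx add_row_mx. Qed.

Lemma mxtrace_gram_row_mx M1 M2 (V1 : 'M[R]_(N, M1)) (V2 : 'M[R]_(N, M2)) :
  \tr (row_mx V1 V2 *m (row_mx V1 V2)^T) = \tr (V1 *m V1^T) + \tr (V2 *m V2^T).
Proof. by rewrite tr_row_mx mul_row_col linearD. Qed.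

(** Reads the residual as kernel minus sum of u_j K(xi^j, .) with exactly [m] terms. A shorter list
    is padded with zero coefficients, for which the choice of [x0] is irrelevant. *)
Lemma residual_bilin M (V : 'M[R]_(N, M)) (s : seq (X * 'cV[R]_N)) x0 m (x : X) (v : 'cV[R]_M) :
  (size s <= m)%N ->
  (c x *m residual c V s *m v) 0 0 = (c x *m V *m v) 0 0 -
    \sum_(j < m) (c x *m (nth (x0, 0) s j).2) 0 0 * (c (nth (x0, 0) s j).1 *m V *m v) 0 0.
Proof.
move=> sm; rewrite /residual mulmxBr mulmxBl mxE [X in _ + X]mxE; congr (_ - _).
have E : \sum_(p <- s) p.2 *m c p.1 = \sum_(j < m) (nth (x0, 0) s j).2 *m c (nth (x0, 0) s j).1.
  rewrite (big_nth (x0, 0)) big_mkord (big_ord_widen m (fun j => (nth (x0, 0) s j).2 *m c (nth (x0, 0) s j).1))//.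
  rewrite [RHS](bigID (fun j : 'I_m => (j < size s)%N))/= [X in _ = _ + X]big1 ?addr0// => j.
  by rewrite -leqNgt => sj; rewrite nth_default// mul0mx.
rewrite E mulmx_suml mulmx_sumr mulmx_suml summxE; apply: eq_bigr => j _.
set p := nth _ _ _; rewrite !mulmxA (mx11_scalar (c x *m p.2)) -!mulmxA mul_scalar_mx mxE.
by rewrite [in RHS]mxE eqxx mulr1n.
Qed.

End ResidualAlgebra.

Lemma sqr_sum_le (R : realFieldType) n (x : 'I_n -> R) :
  (\sum_i x i) ^+ 2 <= n%:R * \sum_i x i ^+ 2.
Proof.
have : 0 <= \sum_i \sum_j (x i - x j) ^+ 2.
  by apply: sumr_ge0 => i _; apply: sumr_ge0 => j _; exact: sqr_ge0.
have -> : \sum_i \sum_j (x i - x j) ^+ 2 =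
   2 * (n%:R * \sum_i x i ^+ 2) - 2 * (\sum_i x i) ^+ 2.
  have E i : \sum_j (x i - x j) ^+ 2 = n%:R * x i ^+ 2 + \sum_j x j ^+ 2 - 2 * x i * \sum_j x j.
    have -> : n%:R * x i ^+ 2 = \sum_(j < n) x i ^+ 2.
      by rewrite sumr_const card_ord mulr_natl.
    rewrite mulr_sumr -big_split/= -sumrB; apply: eq_bigr => j _; ring.
  rewrite (eq_bigr _ (fun i _ => E i)) sumrB big_split/= -mulr_sumr sumr_const card_ord.
  rewrite -mulr_suml -mulr_sumr -mulr_natl; ring.
by lra.
Qed.

Section Energy.
Context {R : realType}.
Variables (d N : nat).
Local Notation n := #|{: {ffun 'I_d -> 'I_N}}|.
Local Notation mu v := (torus_measure R v).

Lemma integral_quad_form (A : 'M[R]_n) :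
  (\int[mu d]_x ((trig_row N x *m A *m (trig_row N x)^T) 0 0)%:E = (\tr A)%:E)%E.
Proof.
rewrite -Rintegral_quad_form fineK//; apply: integrable_fin_num => //.
by apply: bounded_measurable_integrable; exact: bounded_measurable_bilin.
Qed.

Lemma integral_bilin_sqr (W : 'M[R]_n) :
  (\int[mu (d + d)]_z (((trig_row N (fst_half z) *m W *m (trig_row N (snd_half z))^T) 0 0) ^+ 2)%:E =
    (\tr (W *m W^T))%:E)%E.
Proof.
rewrite ge0_integral_torusD; last 2 first.
- apply/measurable_EFinP; apply: measurable_funX.
  have [] := bounded_measurable_bilin W (@measurable_fst_half R d) (@measurable_snd_half R d).
  by [].
- by move=> z; rewrite lee_fin sqr_ge0.
rewrite -integral_quad_form; apply: eq_integral => x _.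
under eq_integral do rewrite fst_half_cat snd_half_cat.
by rewrite parseval trmx_mul !mulmxA.
Qed.

End Energy.

Section Levels.
Context {R : realType}.

Variables (d M : nat).
Local Notation n := #|{: {ffun 'I_d.+1 -> 'I_M}}|.

Lemma card_level_set J (A := [set i : 'I_n |
    (\sum_k dyadic ((enum_val i : {ffun 'I_d.+1 -> 'I_M}) k) <= J)%N]%SET) :
  (#|A| <= 4 ^ d.+1 * 2 ^ J * J.+1 ^ d)%N.
Proof.
apply: leq_trans (card_hyperbolic_cross d M J).
rewrite -(card_imset _ enum_val_inj) subset_leq_card//; apply/fintype.subsetP => f.
by case/imsetP => i; rewrite inE => iA ->; rewrite inE.
Qed.

(** The cutoffs are hyperbolic crosses of level [J] for rows and columns. The columns come in two
    copies, for real and imaginary parts, which gives the factor 3; the two weight bounds 2^(-r1 J)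
    and 2^(-r2 J) multiply and are squared. *)
Lemma orthoproj_level J (r1 r2 : R) (Phi : 'M[R]_(n, n + n)) :
  0 <= r1 -> 0 <= r2 -> \tr (Phi *m Phi^T) <= 1 ->
  let w' j := match fintype.split j with inl k => weight_vec r2 k | inr k => weight_vec r2 k end in
  let V := \matrix_(i, j) (weight_vec r1 i * Phi i j * w' j) in
  exists P, [/\ orthoproj P, \tr P <= (3 * (4 ^ d.+1 * 2 ^ J * J.+1 ^ d))%:R &
    \tr ((1%:M - P) *m (V *m V^T)) <= ((2 `^ (- (2 * (r1 + r2)))) ^+ J)].
Proof.
move=> r10 r20 Phi1 w' V.
pose A : {set 'I_n} := [set i : 'I_n |
  (\sum_k dyadic ((enum_val i : {ffun 'I_d.+1 -> 'I_M}) k) <= J)%N]%SET.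
pose A' : {set 'I_(n + n)} := ((lshift n @: A) :|: (@rshift n n @: A))%SET.
have wA (r : R) i : 0 <= r -> i \notin A -> weight_vec r i <= (2 `^ (- r)) ^+ J.
  by move=> r0; rewrite inE -ltnNge => /ltnW iA; exact: weight_prod_le.
have [|||| P [projP trP tail]] := @orthoproj_weighted R n (n + n) (weight_vec r1) w' Phi A A'
  ((2 `^ (- r1)) ^+ J) ((2 `^ (- r2)) ^+ J) Phi1.
- by move=> i; exact: weight_prod_ge0.
- by move=> j; rewrite /w'; case: (fintype.split j) => k; exact: weight_prod_ge0.
- by move=> i; exact: wA.
- move=> j; rewrite /w' inE negb_or => /andP[].
  case: (split_ordP j) => k ->.
    move=> kA _; apply: wA => //.
    by apply: contra kA => kA; apply/imsetP; exists k.
  move=> _ kA; apply: wA => //.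
  by apply: contra kA => kA; apply/imsetP; exists k.
exists P; split=> //.
- rewrite (le_trans trP)// ler_nat.
  have cA : (#|A| <= 4 ^ d.+1 * 2 ^ J * J.+1 ^ d)%N by exact: card_level_set.
  have cA' : (#|A'| <= #|A| + #|A|)%N.
    by rewrite cardsU (leq_trans (leq_subr _ _))// leq_add// leq_imset_card.
  lia.
- apply: (le_trans tail); rewrite -exprMn -exprM mulnC exprM -powRD ?pnatr_eq0 ?implybT//.
  rewrite le_eqVlt; apply/orP; left; apply/eqP; congr (_ ^+ _).
  rewrite -powR_mulrn ?powR_ge0// -powRrM; congr (_ `^ _); ring.
Qed.

End Levels.

(** * Error of the sampled approximation *)

Lemma sqr_le_split (R : realFieldType) (u v W : R) :
  (u - v) ^+ 2 <= W -> u ^+ 2 <= 2 * v ^+ 2 + 2 * W.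
Proof.
move=> h; have := sqr_ge0 (u - 2 * v).
have -> : (u - 2 * v) ^+ 2 = 2 * v ^+ 2 + 2 * (u - v) ^+ 2 - u ^+ 2 by ring.
by lra.
Qed.

(** Here [k] is the true kernel, [h] its truncation, and [al] the coefficients, bounded by [B].
    Replacing one by the other costs at most eta B (f0 + sum f), and Cauchy-Schwarz over the m + 1
    summands passes to squares. *)
Lemma weighted_error_sqr (R : realFieldType) m (k0 h0 f0 eta B : R) (k h al f : 'I_m -> R) :
  1 <= B -> 0 < eta -> (forall j, `|al j| <= B) -> 0 <= f0 -> (forall j, 0 <= f j) ->
  `|k0 - h0| <= eta * f0 -> (forall j, `|k j - h j| <= eta * f j) ->
  (k0 - \sum_j al j * k j) ^+ 2 <= 2 * (h0 - \sum_j al j * h j) ^+ 2 +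
    2 * (eta ^+ 2 * B ^+ 2 * (m.+1%:R * (f0 ^+ 2 + \sum_j f j ^+ 2))).
Proof.
move=> B1 eta0 alB f00 fj0 D0 Dj; apply: sqr_le_split.
set u := k0 - _; set v := h0 - _.
have B0 : 0 <= B by lra.
have uv : `|u - v| <= eta * B * (f0 + \sum_j f j).
  have -> : u - v = (k0 - h0) - \sum_j al j * (k j - h j).
    under [in RHS]eq_bigr do rewrite mulrBr.
    by rewrite sumrB /u /v; ring.
  rewrite (le_trans (ler_normB _ _))// mulrDr lerD//.
    by rewrite (le_trans D0)// ler_wpM2r// ler_peMr// ltW.
  rewrite (le_trans (ler_norm_sum _ _ _))// mulr_sumr ler_sum// => j _.
  by rewrite normrM [eta * B]mulrC -mulrA ler_pM.
have S_ge : (f0 + \sum_j f j) ^+ 2 <= m.+1%:R * (f0 ^+ 2 + \sum_j f j ^+ 2).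
  have := sqr_sum_le (fun i : 'I_m.+1 => if unlift ord0 i is Some j then f j else f0).
  rewrite !big_ord_recl unlift_none.
  have -> : \sum_(i < m) (if unlift ord0 (lift ord0 i) is Some j then f j else f0) = \sum_j f j.
    by apply: eq_bigr => j _; rewrite liftK.
  have -> : \sum_(i < m) (if unlift ord0 (lift ord0 i) is Some j then f j else f0) ^+ 2 =
    \sum_j f j ^+ 2 by apply: eq_bigr => j _; rewrite liftK.
  by [].
have sum0 : 0 <= f0 + \sum_j f j by rewrite addr_ge0// sumr_ge0.
apply: (@le_trans _ _ ((eta * B * (f0 + \sum_j f j)) ^+ 2)).
  rewrite -[leLHS]real_normK ?num_real// lerXn2r ?nnegrE//.
  by rewrite !mulr_ge0// ltW.
by rewrite !exprMn ler_wpM2l// mulr_ge0 ?sqr_ge0.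
Qed.

Section Truncation.
Context {R : realType}.
Local Notation mu v := (torus_measure R v).

Lemma measurable_torus v : measurable (@torus R v).
Proof.
rewrite (_ : @torus R v = \bigcap_(i in [set: 'I_v]) [set x | 0 <= tnth x i < 2 * pi]).
  apply: fin_bigcap_measurable => // i _.
  rewrite -[X in measurable X]setTI.
  have := @measurable_tnth _ R v i measurableT [set` `[0, 2 * pi[] (measurable_itv _).
  by rewrite set_itvco.
by apply/seteqP; split=> x /= H i; [move=> _; exact: H|exact: H].
Qed.

Lemma approximation_parameters (r1 r2 : R) : 1 / 2 < r1 -> 0 < r2 ->
  exists e1 e2 C1 C2 dl, [/\ [/\ 1 / 2 < e1, e1 < 1, 0 < e2 & e2 < 1],
    [/\ 0 <= C1, 0 <= C2 & 0 < dl], approximates r1 e1 C1 dl & approximates r2 e2 C2 dl].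
Proof.
(* The midpoint of 1/2 and min(1, r1) keeps e1 above 1/2 and below both 1 and r1; e2 lies likewise
   between 0 and min(1, r2). *)
move=> r1h r20; pose e1 := (1 / 2 + Num.min 1 r1) / 2; pose e2 := Num.min 1 r2 / 2.
have m1 : 1 / 2 < Num.min 1 r1 by rewrite lt_min r1h andbT; lra.
have m2 : 0 < Num.min 1 r2 by rewrite lt_min r20 ltr01.
have m11 : Num.min 1 r1 <= 1 by rewrite ge_min lexx.
have m12 : Num.min 1 r1 <= r1 by rewrite ge_min lexx orbT.
have m21 : Num.min 1 r2 <= 1 by rewrite ge_min lexx.
have m22 : Num.min 1 r2 <= r2 by rewrite ge_min lexx orbT.
have e1l : 1 / 2 < e1 by rewrite /e1; lra.
have e1u : e1 < 1 by rewrite /e1; lra.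
have e1r : e1 < r1 by rewrite /e1; lra.
have e2l : 0 < e2 by rewrite /e2; lra.
have e2u : e2 < 1 by rewrite /e2; lra.
have e2r : e2 < r2 by rewrite /e2; lra.
have e10 : 0 < e1 by lra.
have [C1 C11 H1] := bernoulli_kernel_approx e10 e1u e1r.
have [C2 C21 H2] := bernoulli_kernel_approx e2l e2u e2r.
pose dl := Num.min (r1 - e1) (r2 - e2).
have rate (r e C : R) : 1 <= C -> dl <= r - e -> (forall u, sin (u / 2) != 0 ->
  let G := C * (1 + `|sin (u / 2)| `^ (e - 1)) in
  [/\ bernoulli_sum r ^~ u @ \oo --> bernoulli_kernel r u,
      `|bernoulli_kernel r u| <= G,
      (forall N, `|bernoulli_sum r N u| <= G) &
      (forall N, `|bernoulli_kernel r u - bernoulli_sum r N u| <=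
         N.+1%:R `^ (- (r - e)) * G)]) -> approximates r e C dl.
  move=> C_1 dle H u su; have [_ h1 h2 h3] := H u su; split=> // N.
  rewrite (le_trans (h3 N))// ler_wpM2r//.
    by rewrite mulr_ge0 ?addr_ge0 ?powR_ge0//; lra.
  by rewrite ler_powR ?ler1n// lerN2.
exists e1, e2, C1, C2, dl; split=> //.
- split; [lra|lra|].
  by rewrite lt_min !subr_gt0 e1r e2r.
- by apply: rate H1 => //; rewrite ge_min lexx.
- by apply: rate H2 => //; rewrite ge_min lexx orbT.
Qed.

Variables (d : nat) (r1 r2 e1 e2 C1 C2 dl : R).
Hypotheses (r10 : 0 < r1) (r20 : 0 < r2) (C10 : 0 <= C1) (C20 : 0 <= C2).
Hypothesis approx1 : approximates r1 e1 C1 dl.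
Hypothesis approx2 : approximates r2 e2 C2 dl.
Variables (rho : (d + d).-tuple R -> R) (phi : bool -> (d + d).-tuple R -> R).
Hypotheses (mrho : measurable_fun setT rho) (mphi : forall b, measurable_fun setT (phi b)).
Hypothesis phi_rho : forall b w, `|phi b w| <= rho w.
Hypothesis rho1 : (\int[mu (d + d)]_w ((rho w) ^+ 2)%:E <= 1)%E.
Variable MA : R.
Hypothesis MA0 : 0 <= MA.
Local Notation A := (dominating C1 e1 C2 e2 rho).
Hypothesis domA : forall x : d.-tuple R, closed_cube x ->
  (\int[mu d]_y (A (cat_tuple x y) * A (cat_tuple x y)) <= MA%:E)%E.

Local Notation a := (pair_exponent (d := d) r1 r2).
Local Notation k b := (real_convolution (bernoulli_kernel_prod a) (phi b)).
Local Notation kN N b := (real_convolution (bernoulli_sum_prod a N) (phi b)).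

Definition partial_matrix N b : 'M[R]_(#|{: {ffun 'I_d -> 'I_(N.*2.+1)}}|) :=
  \matrix_(i, j) (weight_vec r1 i *
    fourier_matrix (d := d) N.*2.+1 (r1 * pi / 2) (r2 * pi / 2) (phi b) i j * weight_vec r2 j).

Lemma rho_ge0 w : 0 <= rho w.
Proof. exact: le_trans (phi_rho true w). Qed.

Lemma integral_phi_sqr_lty b : (\int[mu (d + d)]_w (phi b w ^+ 2)%:E < +oo)%E.
Proof.
apply: (le_lt_trans _ (ltry 1)); apply: le_trans rho1.
apply: ge0_le_integral_any => w; rewrite lee_fin ?sqr_ge0//.
by rewrite -[phi b w ^+ 2]real_normK ?num_real// lerXn2r ?nnegrE// rho_ge0.
Qed.

Lemma partial_kernelE N b (x y : d.-tuple R) : kN N b (cat_tuple x y) =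
  (trig_row _ x *m partial_matrix N b *m (trig_row _ y)^T) 0 0.
Proof.
apply: real_convolution_bilin.
by have [] := integrable_of_sqr (mphi b) (integral_phi_sqr_lty b).
Qed.

Lemma closed_cube_cat (x y : d.-tuple R) : closed_cube x -> closed_cube y ->
  closed_cube (cat_tuple x y).
Proof.
move=> cx cy i; case: (split_ordP i) => j ->; first by rewrite tnth_lshift; exact: cx.
by rewrite tnth_rshift; exact: cy.
Qed.

Lemma A_ge0 z : (0 <= A z)%E.
Proof. by apply: dominating_ge0 => //; exact: rho_ge0. Qed.

Lemma measurable_A : measurable_fun setT A.
Proof. by apply: measurable_dominating => //; exact: rho_ge0. Qed.

(** By Parseval the left side is the integral over y of the squared truncated kernel, which is
    dominated by the majorant. The bound is uniform in [N], as the constant [kappa] of the greedy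
    selection has to be. *)
Lemma partial_kernel_energy N b (x : d.-tuple R) : closed_cube x ->
  (trig_row _ x *m (partial_matrix N b *m (partial_matrix N b)^T) *m (trig_row _ x)^T) 0 0 <= MA.
Proof.
move=> cx; rewrite -lee_fin (le_trans _ (domA cx))//.
have -> : (trig_row _ x *m (partial_matrix N b *m (partial_matrix N b)^T) *m (trig_row _ x)^T) =
  (trig_row _ x *m partial_matrix N b) *m (trig_row _ x *m partial_matrix N b)^T.
  by rewrite trmx_mul !mulmxA.
rewrite -parseval; apply: le_integral_closed_cube.
- by move=> y; rewrite lee_fin sqr_ge0.
- by apply: emeasurable_funM;
    apply: (measurableT_comp measurable_A (@measurable_cat_tuple1 R d d x)).
- by move=> y; rewrite mule_ge0// A_ge0.
- move=> y cy; rewrite -partial_kernelE.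
  have cz := closed_cube_cat cx cy; have A0 := A_ge0 (cat_tuple x y).
  have [fin|] := ltP (A (cat_tuple x y)) +oo%E; last first.
    by rewrite leye_eq => /eqP ->; rewrite mulyy leey.
  have [le _] := real_convolution_approx r10 r20 C10 C20 approx1 approx2 N cz mrho (mphi b) (phi_rho b) fin.
  have fA : A (cat_tuple x y) \is a fin_num by rewrite ge0_fin_numE.
  rewrite -(fineK fA) -EFinM lee_fin -expr2 -[leLHS]real_normK ?num_real//.
  by rewrite lerXn2r ?nnegrE// fine_ge0.
Qed.

Variables (m N : nat) (B eta : R) (xi : 'I_m -> d.-tuple R) (al : 'I_m -> d.-tuple R -> R).
Hypotheses (B1 : 1 <= B) (eta0 : 0 < eta).
Hypothesis etaN : (d + d)%:R * N.+1%:R `^ (- dl) <= eta.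
Hypothesis cxi : forall j, closed_cube (xi j).

Definition sampled_majorant z : \bar R := (A z * A z +
  \sum_(j < m) A (cat_tuple (xi j) (snd_half z)) * A (cat_tuple (xi j) (snd_half z)))%E.

Lemma sampled_majorant_ge0 z : (0 <= sampled_majorant z)%E.
Proof.
by rewrite adde_ge0 ?mule_ge0 ?A_ge0// sume_ge0// => j _; rewrite mule_ge0 ?A_ge0.
Qed.

Lemma measurable_A_sampled j :
  measurable_fun setT (fun z : (d + d).-tuple R => A (cat_tuple (xi j) (snd_half z))).
Proof.
apply: (measurableT_comp measurable_A).
apply: (measurableT_comp (@measurable_cat_tuple1 R d d (xi j))).
exact: measurable_snd_half.
Qed.

Lemma measurable_sampled_majorant : measurable_fun setT sampled_majorant.
Proof.
apply: emeasurable_funD; first by apply: emeasurable_funM; exact: measurable_A.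
by apply: emeasurable_sum => j; apply: emeasurable_funM; exact: measurable_A_sampled.
Qed.

Lemma integral_sampled_majorant_le :
  (\int[mu (d + d)]_z sampled_majorant z <= (m.+1%:R * MA)%:E)%E.
Proof.
have mAA : measurable_fun setT (fun z => (A z * A z)%E).
  by apply: emeasurable_funM; exact: measurable_A.
have mAj j : measurable_fun setT (fun z : (d + d).-tuple R =>
    (A (cat_tuple (xi j) (snd_half z)) * A (cat_tuple (xi j) (snd_half z)))%E).
  by apply: emeasurable_funM; exact: measurable_A_sampled.
have AA0 z : (0 <= A z * A z)%E by rewrite mule_ge0 ?A_ge0.
rewrite ge0_integralD//; last 2 first.
- by move=> z _; rewrite sume_ge0.
- apply: emeasurable_sum => j; exact: mAj.
rewrite ge0_integral_sum; [|by []|exact: mAj|by move=> j z _; rewrite mule_ge0 ?A_ge0].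
have cst1 (f : d.-tuple R -> \bar R) : (forall x, 0 <= f x)%E ->
    (forall x, closed_cube x -> (f x <= MA%:E)%E) -> (\int[mu d]_x f x <= MA%:E)%E.
  move=> f0 fM; apply: (@le_trans _ _ (\int[mu d]_x MA%:E)%E).
    by apply: le_integral_closed_cube => // x; rewrite lee_fin.
  by rewrite integral_cst// [X in (_ * X)%E](@probability_setT _ _ _ (mu d)) mule1.
rewrite -natr1 mulrDl mul1r [m%:R * MA + MA]addrC EFinD; apply: leeD.
  rewrite (ge0_integral_torusD mAA AA0).
  apply: cst1 => [x|x cx]; last exact: domA.
  by apply: integral_ge0 => y _; exact: AA0.
apply: (@le_trans _ _ (\sum_(j < m) MA%:E)%E); last first.
  by rewrite sumEFin sumr_const card_ord mulr_natl.
apply: lee_sum => j _; rewrite (ge0_integral_torusD (mAj j)); last first.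
  by move=> z; rewrite mule_ge0 ?A_ge0.
apply: cst1 => [x|x cx]; first by apply: integral_ge0 => y _; rewrite mule_ge0 ?A_ge0.
by under eq_integral do rewrite snd_half_cat; exact: domA.
Qed.

Lemma sampling_error_sqr z : closed_cube (fst_half z) -> closed_cube (snd_half z) ->
  (forall j, `|al j (fst_half z)| <= B) ->
  ((\sum_b (k b z - \sum_j al j (fst_half z) * k b (cat_tuple (xi j) (snd_half z))) ^+ 2)%:E <=
   (\sum_b 2 * (kN N b z - \sum_j al j (fst_half z) * kN N b (cat_tuple (xi j) (snd_half z))) ^+ 2)%:E +
   (4 * m.+1%:R * eta ^+ 2 * B ^+ 2)%:E * sampled_majorant z)%E.
Proof.
move=> c1 c2 alB.
set Q := 4 * m.+1%:R * eta ^+ 2 * B ^+ 2.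
have B0 : 0 < B by exact: lt_le_trans B1.
have Q0 : 0 < Q by rewrite !mulr_gt0 ?exprn_gt0.
have [fin|] := ltP (sampled_majorant z) +oo%E; last first.
  (* Where the majorant is infinite the right side is infinite, Q being positive; elsewhere all its
     summands are finite. *)
  rewrite leye_eq => /eqP ->; rewrite gt0_muley ?lte_fin// addey ?leey//.
have cz : closed_cube z by rewrite -(cat_halves z); exact: closed_cube_cat.
have sqr_lty (x : \bar R) : (0 <= x)%E -> (x * x < +oo)%E -> (x < +oo)%E.
  by case: x => [r _ _|_|//]; [rewrite ltry|rewrite mulyy ltxx].
have finz : (A z < +oo)%E.
  apply: sqr_lty; first exact: A_ge0.
  apply: le_lt_trans fin; rewrite leeDl// sume_ge0// => j _.
  by rewrite mule_ge0 ?A_ge0.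
have finj j : (A (cat_tuple (xi j) (snd_half z)) < +oo)%E.
  apply: sqr_lty; first exact: A_ge0.
  apply: le_lt_trans fin; rewrite /sampled_majorant (bigD1 j)//=.
  rewrite addeCA leeDl// adde_ge0 ?mule_ge0 ?A_ge0// sume_ge0// => i _.
  by rewrite mule_ge0 ?A_ge0.
pose f0 := fine (A z); pose f j := fine (A (cat_tuple (xi j) (snd_half z))).
have f00 : 0 <= f0 by rewrite fine_ge0 ?A_ge0.
have fj0 j : 0 <= f j by rewrite fine_ge0 ?A_ge0.
have fin0 : A z \is a fin_num by rewrite (ge0_fin_numE (A_ge0 _)).
have fin1 j : A (cat_tuple (xi j) (snd_half z)) \is a fin_num.
  by rewrite (ge0_fin_numE (A_ge0 _)); exact: finj.
have majE : sampled_majorant z = (f0 ^+ 2 + \sum_j f j ^+ 2)%:E.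
  rewrite /sampled_majorant EFinD -sumEFin; congr (_ + _)%E.
    by rewrite expr2 EFinM (fineK fin0).
  by apply: eq_bigr => j _; rewrite expr2 EFinM /f (fineK (fin1 j)).
rewrite majE -EFinM -EFinD lee_fin.
have D0 b : `|k b z - kN N b z| <= eta * f0.
  have [_ h] := real_convolution_approx r10 r20 C10 C20 approx1 approx2 N cz mrho (mphi b) (phi_rho b) finz.
  by apply: (le_trans h); apply: ler_wpM2r; [exact: f00|exact: etaN].
have Dj b j : `|k b (cat_tuple (xi j) (snd_half z)) - kN N b (cat_tuple (xi j) (snd_half z))| <= eta * f j.
  have cj := closed_cube_cat (cxi j) c2.
  have [_ h] := real_convolution_approx r10 r20 C10 C20 approx1 approx2 N cj mrho (mphi b) (phi_rho b) (finj j).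
  by apply: (le_trans h); apply: ler_wpM2r; [exact: fj0|exact: etaN].
set S := f0 ^+ 2 + _.
have each b : (k b z - \sum_j al j (fst_half z) * k b (cat_tuple (xi j) (snd_half z))) ^+ 2 <=
  2 * (kN N b z - \sum_j al j (fst_half z) * kN N b (cat_tuple (xi j) (snd_half z))) ^+ 2 +
  Q / 2 * S.
  (* The 4 in Q is 2, from splitting a square, times 2, for the real and imaginary parts. *)
  have -> : Q / 2 * S = 2 * (eta ^+ 2 * B ^+ 2 * (m.+1%:R * S)) by rewrite /Q; field.
  exact: weighted_error_sqr.
rewrite (le_trans (ler_sum _ (fun b _ => each b)))// big_split/=.
by rewrite lerD2l sumr_const card_bool -mulr_natr; lra.
Qed.

End Truncation.

(** * Complex kernels through real and imaginary parts *)

Section Complex.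
Context {R : realType}.
Local Notation mu v := (torus_measure R v).

Lemma Re_sum I (r : seq I) (F : I -> R[i]) :
  complex.Re (\sum_(i <- r) F i) = \sum_(i <- r) complex.Re (F i).
Proof. by apply: (big_morph (@complex.Re R)) => // -[? ?] [? ?]. Qed.

Lemma Im_sum I (r : seq I) (F : I -> R[i]) :
  complex.Im (\sum_(i <- r) F i) = \sum_(i <- r) complex.Im (F i).
Proof. by apply: (big_morph (@complex.Im R)) => // -[? ?] [? ?]. Qed.

Lemma Re_realM (a : R) (z : R[i]) : complex.Re (Complex a 0 * z) = a * complex.Re z.
Proof. by case: z => p q /=; rewrite mul0r subr0. Qed.

Lemma Im_realM (a : R) (z : R[i]) : complex.Im (Complex a 0 * z) = a * complex.Im z.
Proof. by case: z => p q /=; rewrite mul0r addr0. Qed.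

Lemma normc_sqr (z : R[i]) : Normc.normc z ^+ 2 = complex.Re z ^+ 2 + complex.Im z ^+ 2.
Proof. by case: z => p q /=; rewrite sqr_sqrtr// addr_ge0// sqr_ge0. Qed.

Lemma normc_ge0 (z : R[i]) : 0 <= Normc.normc z.
Proof. by case: z => p q /=; exact: sqrtr_ge0. Qed.

Lemma norm2_sqr v (f : v.-tuple R -> R[i]) :
  (norm2 f * norm2 f = \int[mu v]_x (Normc.normc (f x) ^+ 2)%:E)%E.
Proof. exact: Lnorm2_sqr. Qed.

Lemma norm2_le v (f : v.-tuple R -> R[i]) (c : R) : 0 <= c ->
  (\int[mu v]_x (Normc.normc (f x) ^+ 2)%:E <= c%:E)%E -> (norm2 f <= (Num.sqrt c)%:E)%E.
Proof.
move=> c0; rewrite -norm2_sqr.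
have : (0 <= norm2 f)%E by exact: Lnorm_ge0.
case: (norm2 f) => [r|_|//]; last by rewrite mulyy leye_eq.
rewrite -EFinM !lee_fin => r0 rc.
by rewrite -(@ger0_norm _ r)// -sqrtr_sqr ler_wsqrtr// expr2.
Qed.

Lemma sigma_LK_le d m (K : (d + d).-tuple R -> R[i]) (xi : 'I_m -> d.-tuple R)
    (u : 'I_m -> d.-tuple R -> R[i]) :
  (forall j, torus (xi j)) -> (forall j, L2 (u j)) ->
  (sigma_LK m K <= norm2 (fun z => (K z - \sum_(j < m)
     u j (fst_half z) * K (cat_tuple (xi j) (snd_half z)))%R))%E.
Proof.
move=> txi L2u; apply: le_trans.
  by apply: ereal_inf_lbound; exists xi; [exact: txi|reflexivity].
by apply: ereal_inf_lbound; exists u.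
Qed.

Lemma L2_real v (f : v.-tuple R -> R) : bounded_measurable f -> L2 (fun x => Complex (f x) 0).
Proof.
move=> [mf [C fC]]; split=> //=; rewrite (le_lt_trans _ (ltry (Num.sqrt (C ^+ 2))))//.
apply: norm2_le; first exact: sqr_ge0.
apply: (@le_trans _ _ (\int[mu v]_x (C ^+ 2)%:E)%E).
  apply: ge0_le_integral_any => x; rewrite lee_fin ?sqr_ge0// normc_sqr/= expr0n addr0.
  by rewrite -[leLHS]real_normK ?num_real// lerXn2r ?nnegrE// (le_trans _ (fC x)).
by rewrite integral_cst// [X in (_ * X)%E](@probability_setT _ _ _ (mu v)) mule1.
Qed.

Lemma measurable_normc v (f : v.-tuple R -> R[i]) : L2 f ->
  measurable_fun setT (fun x => Normc.normc (f x)).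
Proof.
move=> [mRe mIm _].
rewrite (_ : (fun x => _) = (fun x => (complex.Re (f x) ^+ 2 + complex.Im (f x) ^+ 2) `^ 2^-1)).
  apply: (measurableT_comp (@measurable_powR R 2^-1)).
  by apply: measurable_funD; exact: measurable_funX.
apply/funext => x; rewrite powR12_sqrt ?addr_ge0 ?sqr_ge0//.
by case: (f x).
Qed.

Lemma convolutionE v (F : v.-tuple R -> R) (f : v.-tuple R -> R[i]) x : convolution F f x =
  Complex (\int[mu v]_y (F (tuple_sub x y) * complex.Re (f y)))
          (\int[mu v]_y (F (tuple_sub x y) * complex.Im (f y))).
Proof.
rewrite /convolution /integral_torus; congr Complex; apply: eq_Rintegral => y _.
  by rewrite Re_realM.
by rewrite Im_realM.
Qed.

End Complex.

(** * Ranks and tails of the dyadic levels *)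

Section Level.
Context {R : realType}.
Local Notation mu v := (torus_measure R v).
Variables (d : nat) (r1 r2 : R).
Hypotheses (r1h : 1 / 2 < r1) (r20 : 0 < r2).
Local Notation D := d.+1.

(** The dimension is [d.+1] from here on, so the logarithmic factor j.+1 ^ d carries the dimension
    minus one. *)
Definition level_rank j := (3 * (4 ^ d.+1 * 2 ^ j * j.+1 ^ d))%N.
(** An integer above 2^(2(r1+r2)), the ratio of consecutive tails. *)
Definition level_ratio := (Num.trunc ((2 : R) `^ (2 * (r1 + r2)))).+1.
Definition level_tail j : R := (2 `^ (- (2 * (r1 + r2)))) ^+ j.
Definition level_steps J := (\sum_(1 <= j < J.+1) 8 * level_ratio * level_rank j)%N.

Lemma level_tail_gt0 j : 0 < level_tail j.
Proof. by rewrite exprn_gt0// powR_gt0. Qed.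

Lemma level_tailS j : level_tail j <= level_ratio%:R * level_tail j.+1.
Proof.
rewrite /level_tail exprSr mulrCA ler_peMr// ?exprn_ge0 ?powR_ge0//.
by rewrite powRN ler_pdivlMr ?powR_gt0// mul1r ltW// truncnS_gt.
Qed.

Lemma level_rank_gt0 j : (0 < level_rank j)%N.
Proof. by rewrite !muln_gt0 !expn_gt0. Qed.

Variables (phi : (D + D).-tuple R -> R[i]).
Hypotheses (L2phi : L2 phi) (phi1 : (norm2 phi <= 1)%E).

Definition complex_part (b : bool) w := if b then complex.Re (phi w) else complex.Im (phi w).
Local Notation part := complex_part.
Local Notation rho := (fun w => Normc.normc (phi w)).

Lemma measurable_modulus : measurable_fun setT rho.
Proof. exact: measurable_normc. Qed.

Lemma measurable_complex_part b : measurable_fun setT (part b).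
Proof. by have [mRe mIm _] := L2phi; case: b. Qed.

Lemma complex_part_sqr w : part true w ^+ 2 + part false w ^+ 2 = Normc.normc (phi w) ^+ 2.
Proof. by rewrite normc_sqr. Qed.

Lemma complex_part_le b w : `|part b w| <= Normc.normc (phi w).
Proof.
rewrite -(@ler_pXn2r _ 2) ?nnegrE ?normc_ge0// real_normK ?num_real// -complex_part_sqr.
by case: b; rewrite ?lerDl ?lerDr sqr_ge0.
Qed.

Lemma integral_modulus_sqr_le1 : (\int[mu (D + D)]_w (Normc.normc (phi w) ^+ 2)%:E <= 1)%E.
Proof.
rewrite -norm2_sqr -[leRHS]mule1; apply: lee_pmul => //; exact: Lnorm_ge0.
Qed.

Lemma integral_complex_part_lty b : (\int[mu (D + D)]_w (part b w ^+ 2)%:E < +oo)%E.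
Proof. exact: integral_phi_sqr_lty complex_part_le integral_modulus_sqr_le1 b. Qed.

Variable N : nat.
Local Notation M := (N.*2.+1).
Local Notation n := #|{: {ffun 'I_D -> 'I_M}}|.
Local Notation V b := (partial_matrix (d := D) r1 r2 part N b).

(** Placing the two parts side by side adds their Gram matrices, so a single greedy selection yields
    points and real coefficients valid for both. *)
Definition kernel_matrix : 'M[R]_(n, n + n) := row_mx (V true) (V false).
Local Notation VV := kernel_matrix.

Let Phi : 'M[R]_(n, n + n) := row_mx (fourier_matrix (d := D) M (r1 * pi / 2) (r2 * pi / 2) (part true))
                  (fourier_matrix (d := D) M (r1 * pi / 2) (r2 * pi / 2) (part false)).

Let Phi1 : \tr (Phi *m Phi^T) <= 1.
Proof.
rewrite mxtrace_gram_row_mx -lee_fin EFinD (le_trans _ integral_modulus_sqr_le1)//.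
have E : (\int[mu (D + D)]_w (Normc.normc (phi w) ^+ 2)%:E = \int[mu (D + D)]_w (part true w ^+ 2)%:E +
    \int[mu (D + D)]_w (part false w ^+ 2)%:E)%E.
  rewrite -ge0_integralD//.
  - by apply: eq_integral => w _; rewrite -complex_part_sqr EFinD.
  - by move=> w _; rewrite lee_fin sqr_ge0.
  - by apply/measurable_EFinP; exact: measurable_funX (measurable_complex_part true).
  - by move=> w _; rewrite lee_fin sqr_ge0.
  - by apply/measurable_EFinP; exact: measurable_funX (measurable_complex_part false).
rewrite E; apply: leeD; apply: fourier_matrix_bessel.
- exact: measurable_complex_part.
- exact: integral_complex_part_lty.
- exact: measurable_complex_part.
- exact: integral_complex_part_lty.
Qed.

Let w' (j : 'I_(n + n)) : R :=
  match fintype.split j with inl k => weight_vec r2 k | inr k => weight_vec r2 k end.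

Let kernel_matrixE : VV = \matrix_(i, j) (weight_vec r1 i * Phi i j * w' j).
Proof.
apply/matrixP => i j; rewrite [RHS]mxE /kernel_matrix /Phi /w'; case: (split_ordP j) => k ->.
  by rewrite !row_mxEl mxE.
by rewrite !row_mxEr mxE.
Qed.

Lemma kernel_matrix_projector j : exists P, [/\ orthoproj P, \tr P <= (level_rank j)%:R &
  \tr ((1%:M - P) *m (VV *m VV^T)) <= level_tail j].
Proof.
have r10 : 0 <= r1 by apply: ltW; apply: lt_trans r1h; rewrite divr_gt0.
have := orthoproj_level j r10 (ltW r20) Phi1; rewrite /= -kernel_matrixE; exact.
Qed.

(** All weights are at most 1, so Bessel's bound for the coefficients of [phi] starts the greedy
    selection at level 0. *)
Lemma mxtrace_kernel_matrix : \tr (VV *m VV^T) <= 2 * level_tail 0.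
Proof.
rewrite /level_tail expr0 mulr1 (@le_trans _ _ 1)//; last by rewrite ler1n.
apply: le_trans Phi1; rewrite kernel_matrixE !mxtrace_mul_tr; apply: ler_sum => i _; apply: ler_sum => j _.
have wle1 (r : R) (k : 'I_n) : 0 <= r -> 0 <= weight_vec r k <= 1.
  move=> r0; rewrite weight_prod_ge0/=.
  by have := @weight_prod_le R r 0 D (fun i => (enum_val k : {ffun 'I_D -> 'I_M}) i) r0 (leq0n _).
have r10 : 0 <= r1 by apply: ltW; apply: lt_trans r1h; rewrite divr_gt0.
have /andP[a0 a1] := wle1 r1 i r10.
have /andP[b0 b1] : 0 <= w' j <= 1.
  by rewrite /w'; case: (fintype.split j) => k; apply: wle1; exact: ltW.
rewrite [X in X * X <= _]mxE.
have E (p q u : R) : p * q * u * (p * q * u) = (p * u) ^+ 2 * (q * q) by ring.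
rewrite E; by rewrite ler_piMl -?expr2 ?sqr_ge0// expr_le1// ?mulr_ge0// mulr_ile1.
Qed.

End Level.

Lemma small_step (R : realFieldType) (tau Y : R) : 0 < tau -> 0 <= Y ->
  exists eta, [/\ 0 < eta & eta ^+ 2 * Y <= tau].
Proof.
move=> tau0 Y0; pose c := tau / (Y + 1).
have c0 : 0 < c by rewrite divr_gt0//; lra.
have cY : c * Y <= tau by rewrite /c mulrAC ler_pdivrMr; nra.
exists (Num.min 1 c); split; first by rewrite lt_min ltr01.
rewrite (le_trans _ cY)// ler_wpM2r// expr2.
have m1 : Num.min 1 c <= 1 by rewrite ge_min lexx.
have mc : Num.min 1 c <= c by rewrite ge_min lexx orbT.
have m0 : 0 <= Num.min 1 c by rewrite le_min ler01 ltW.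
by nra.
Qed.

Section SelectionError.
Context {R : realType}.
Local Notation mu v := (torus_measure R v).
Variables (d : nat) (r1 r2 e1 e2 C1 C2 dl : R).
Local Notation D := d.+1.
Hypotheses (r10 : 0 < r1) (r20 : 0 < r2) (C10 : 0 <= C1) (C20 : 0 <= C2).
Hypothesis approx1 : approximates r1 e1 C1 dl.
Hypothesis approx2 : approximates r2 e2 C2 dl.
Variable phi : (D + D).-tuple R -> R[i].
Hypotheses (L2phi : L2 phi) (phi1 : (norm2 phi <= 1)%E).
Variable MA : R.
Hypothesis MA0 : 0 <= MA.
Local Notation rho := (fun w => Normc.normc (phi w)).
Local Notation part := (complex_part phi).
Hypothesis domA : forall x : D.-tuple R, closed_cube x ->
  (\int[mu D]_y (dominating C1 e1 C2 e2 rho (cat_tuple x y) *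
                 dominating C1 e1 C2 e2 rho (cat_tuple x y)) <= MA%:E)%E.

Lemma kernel_matrix_energy N (x : D.-tuple R) : closed_cube x ->
  (trig_row _ x *m (kernel_matrix r1 r2 phi N *m (kernel_matrix r1 r2 phi N)^T) *m
    (trig_row _ x)^T) 0 0 <= 2 * MA.
Proof.
move=> cx; rewrite /kernel_matrix tr_row_mx mul_row_col mulmxDr mulmxDl mxE mulr_natl mulr2n.
by apply: lerD; apply: (partial_kernel_energy r10 r20 C10 C20 approx1 approx2
  (measurable_modulus L2phi) (measurable_complex_part L2phi) (@complex_part_le _ _ phi)
  (integral_modulus_sqr_le1 phi1) domA).
Qed.

Variables (m N : nat) (B eta tau : R).
Variable s : seq (D.-tuple R * 'cV[R]_#|{: {ffun 'I_D -> 'I_(N.*2.+1)}}|).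
Hypotheses (B1 : 1 <= B) (eta0 : 0 < eta).
Hypothesis etaN : (D + D)%:R * N.+1%:R `^ (- dl) <= eta.
Hypothesis sm : (size s <= m)%N.
Hypothesis sB : bounded_coefs (@torus R D) (trig_row _) B s.
Local Notation VV := (kernel_matrix r1 r2 phi N).
Local Notation res := (residual (trig_row _) VV s).
Hypothesis trs : \tr (res *m res^T) <= 2 * tau.
Hypothesis eta_tau : eta ^+ 2 * (4 * m.+1%:R * B ^+ 2 * (m.+1%:R * MA)) <= tau.

Let x0 : D.-tuple R := [tuple 0 | _ < D].
Let xi (j : 'I_m) : D.-tuple R := (nth (x0, 0) s j).1.
Let al (j : 'I_m) (x : D.-tuple R) : R := (trig_row _ x *m (nth (x0, 0) s j).2) 0 0.

Let txi j : torus (xi j).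
Proof.
rewrite /xi; have [sj|sj] := ltnP j (size s); first by have [] := sB (mem_nth (x0, 0) sj).
by rewrite nth_default// => i; rewrite /= tnth_mktuple lexx mulr_gt0// pi_gt0.
Qed.

Let alB j x : torus x -> `|al j x| <= B.
Proof.
rewrite /al; have [sj|sj] := ltnP j (size s); first by have [_ h] := sB (mem_nth (x0, 0) sj); exact: h.
by move=> _; rewrite nth_default// mulmx0 mxE normr0 (le_trans ler01).
Qed.

Let L2al j : L2 (fun x => Complex (al j x) 0).
Proof.
apply: L2_real; rewrite (_ : al j = fun x => \sum_k trig_row _ x 0 k * (nth (x0, 0) s j).2 k 0).
  apply: bounded_measurable_sum => k; apply: bounded_measurableM; first exact: bounded_measurable_trig_row.
  exact: bounded_measurable_cst.
by apply/funext => x; rewrite /al mxE.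
Qed.

Local Notation K := (convolution (bernoulli_kernel_prod (pair_exponent (d := D) r1 r2)) phi).
Local Notation k b := (real_convolution (bernoulli_kernel_prod (pair_exponent (d := D) r1 r2)) (part b)).

Let errorE z : Normc.normc (K z - \sum_(j < m) Complex (al j (fst_half z)) 0 * K (cat_tuple (xi j) (snd_half z))) ^+ 2
  = \sum_b (k b z - \sum_j al j (fst_half z) * k b (cat_tuple (xi j) (snd_half z))) ^+ 2.
Proof.
have ReB (p q : R[i]) : complex.Re (p - q) = complex.Re p - complex.Re q by case: p; case: q.
have ImB (p q : R[i]) : complex.Im (p - q) = complex.Im p - complex.Im q by case: p; case: q.
rewrite normc_sqr big_bool ReB ImB Re_sum Im_sum; congr (_ ^+ 2 + _ ^+ 2).
  by rewrite convolutionE; congr (_ - _); apply: eq_bigr => j _; rewrite Re_realM convolutionE.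
by rewrite convolutionE; congr (_ - _); apply: eq_bigr => j _; rewrite Im_realM convolutionE.
Qed.

Let V b := partial_matrix (d := D) r1 r2 part N b.
Let W b := residual (trig_row _) (V b) s.

Let partialE b z : real_convolution (bernoulli_sum_prod (pair_exponent (d := D) r1 r2) N) (part b) z -
    \sum_j al j (fst_half z) * real_convolution (bernoulli_sum_prod (pair_exponent (d := D) r1 r2) N) (part b)
       (cat_tuple (xi j) (snd_half z)) =
  (trig_row _ (fst_half z) *m W b *m (trig_row _ (snd_half z))^T) 0 0.
Proof.
have pE := partial_kernelE r1 r2 (measurable_complex_part L2phi) (@complex_part_le _ _ phi)
  (integral_modulus_sqr_le1 phi1) N b.
rewrite -{1}(cat_halves z) pE (residual_bilin _ _ x0 _ _ sm); congr (_ - _).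
by apply: eq_bigr => j _; rewrite pE.
Qed.

(** The residual trace, at most 2 tau, counts twice because of the splitting of squares; the
    truncation error adds one more [tau] by the choice of [eta]. Together this is 5 tau. *)
Lemma sigma_LK_of_selection : (sigma_LK m K <= (Num.sqrt (5 * tau))%:E)%E.
Proof.
have mrho := measurable_modulus L2phi.
have mpart := measurable_complex_part L2phi.
have rho1 := integral_modulus_sqr_le1 phi1.
have B0 : 0 < B by exact: lt_le_trans B1.
have cxi j : closed_cube (xi j) by exact/torus_closed_cube/txi.
have tau0 : 0 <= tau.
  by have := le_trans (mxtrace_mul_tr_ge0 res) trs; rewrite pmulr_rge0.
apply: (le_trans (sigma_LK_le _ txi L2al)).
apply: norm2_le; first by rewrite mulr_ge0.
rewrite (eq_integral (fun z => (\sum_b (k b z - \sum_j al j (fst_half z) *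
  k b (cat_tuple (xi j) (snd_half z))) ^+ 2)%:E)); last by move=> z _; rewrite errorE.
set Q := 4 * m.+1%:R * eta ^+ 2 * B ^+ 2.
have Q0 : 0 <= Q by rewrite /Q !mulr_ge0 ?sqr_ge0// ltW.
pose S := sampled_majorant (d := D) e1 e2 C1 C2 rho xi.
pose bil b z := (trig_row N.*2.+1 (fst_half z) *m W b *m (trig_row N.*2.+1 (snd_half z))^T) 0 0.
have mS : measurable_fun setT S by exact: (measurable_sampled_majorant e1 e2 C10 C20 mrho (@complex_part_le _ _ phi)).
have S0 z : (0 <= S z)%E by exact: (@sampled_majorant_ge0 _ _ _ _ _ _ C10 C20 _ part (@complex_part_le _ _ phi)).
have mbil2 b : measurable_fun setT (fun z => bil b z ^+ 2).
  apply: measurable_funX.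
  by have [] := bounded_measurable_bilin (W b) (@measurable_fst_half R D) (@measurable_snd_half R D).
have mbil b : measurable_fun setT (fun z => (2 * bil b z ^+ 2)%:E).
  by apply/measurable_EFinP; exact: measurable_funM.
have bil0 b z : (0 <= (2 * bil b z ^+ 2)%:E)%E by rewrite lee_fin mulr_ge0// sqr_ge0.
have mQS : measurable_fun setT (fun z => (Q%:E * S z)%E) by exact: measurable_funeM.
have QS0 z : (0 <= Q%:E * S z)%E by rewrite mule_ge0.
have mb : measurable_fun setT (fun z => \sum_b (2 * bil b z ^+ 2)%:E)%E by exact: emeasurable_sum.
have b0 z : (0 <= \sum_b (2 * bil b z ^+ 2)%:E)%E by exact: sume_ge0.
apply: (@le_trans _ _ (\int[mu (D + D)]_z (\sum_b (2 * bil b z ^+ 2)%:E + Q%:E * S z))%E).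
  apply: (le_integral_full (@measurable_torus R (D + D)) (@ae_torus R _)).
  - by move=> z; rewrite lee_fin sumr_ge0// => b _; exact: sqr_ge0.
  - exact: emeasurable_funD.
  - by move=> z; rewrite adde_ge0.
  - move=> z tz.
    have t1 : torus (fst_half z) by move=> i; rewrite tnth_mktuple; exact: tz.
    have t2 : torus (snd_half z) by move=> i; rewrite tnth_mktuple; exact: tz.
    have := sampling_error_sqr r10 r20 C10 C20 approx1 approx2 mrho mpart (@complex_part_le _ _ phi)
      B1 eta0 etaN cxi (torus_closed_cube t1) (torus_closed_cube t2) (fun j => alB j t1).
    move=> h; apply: (le_trans h); rewrite sumEFin; apply: leeD => //.
    by rewrite lee_fin; apply: ler_sum => b _; rewrite partialE.
rewrite ge0_integralD//.
rewrite ge0_integral_sum//.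
rewrite ge0_integralZl//.
apply: (@le_trans _ _ ((4 * tau)%:E + Q%:E * (m.+1%:R * MA)%:E)%E).
  apply: leeD; last first.
    apply: lee_wpmul2l; first by rewrite lee_fin.
    exact: (integral_sampled_majorant_le C10 C20 mrho (@complex_part_le _ _ phi) MA0 domA cxi).
  rewrite (eq_bigr (fun b => (2 * \tr (W b *m (W b)^T))%:E)); last first.
    move=> b _; under eq_integral do rewrite EFinM.
    rewrite ge0_integralZl//; last 2 first.
    - by apply/measurable_EFinP; exact: mbil2.
    - by move=> z _; rewrite lee_fin sqr_ge0.
    by rewrite integral_bilin_sqr -EFinM.
  rewrite sumEFin lee_fin big_bool/= -mulrDr -mxtrace_gram_row_mx -residual_row_mx.
  have -> : 4 * tau = 2 * (2 * tau) by ring.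
  by rewrite ler_pM2l//.
rewrite -EFinM -EFinD lee_fin.
have -> : 5 * tau = 4 * tau + tau by ring.
rewrite lerD2l; apply: le_trans eta_tau; rewrite le_eqVlt; apply/orP; left; apply/eqP.
by rewrite /Q; ring.
Qed.

End SelectionError.

Lemma sigma_LK_level (R : realType) d (r1 r2 : R) J m K : 1 / 2 < r1 -> 0 < r2 ->
  (level_steps d r1 r2 J <= m)%N -> W2 (pair_exponent (d := d.+1) r1 r2) K ->
  (sigma_LK m K <= (Num.sqrt (5 * level_tail r1 r2 J))%:E)%E.
Proof.
move=> r1h r20 Jm [phi [L2phi phi1] <-].
have r10 : 0 < r1 by apply: lt_trans r1h; rewrite divr_gt0.
have [e1 [e2 [C1 [C2 [dl [[e1l e1u e2l e2u] [C10 C20 dl0] approx1 approx2]]]]]] :=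
  approximation_parameters r1h r20.
have [MA MA0 HMA] := integral_dominating_sqr_le d.+1 C10 C20 e1l e1u e2l e2u.
have domA := HMA _ (measurable_modulus L2phi) (fun w => normc_ge0 (phi w)) (integral_modulus_sqr_le1 phi1).
have MA20 : 0 <= 2 * MA by rewrite mulr_ge0.
(* The energy bound 2 MA adds the two parts and is independent of the truncation, so the coefficient
   bound is fixed before [N]. *)
have [B0 HB] := greedy_levels J MA20 (level_rank_gt0 d) (@level_tail_gt0 R r1 r2)
  (@level_tailS R r1 r2).
pose B := 1 + `|B0|.
have B1 : 1 <= B by rewrite lerDl.
set tau := level_tail r1 r2 J in HB *.
have tau0 : 0 < tau by exact: level_tail_gt0.
have B_ge0 : 0 <= B by exact: le_trans B1.
have Y0 : 0 <= 4 * m.+1%:R * B ^+ 2 * (m.+1%:R * MA) by rewrite !mulr_ge0.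
(* The admissible truncation error depends on [m] and [B]; the order [N] is chosen last, small
   enough an error being available since dl > 0. *)
have [eta [eta0 eta_tau]] := small_step tau0 Y0.
have D0 : 0 < (d.+1 + d.+1)%:R + 1 :> R by rewrite ltr_wpDl// ler0n.
have [N /(_ N (leqnn N)) HN] := powRN_small dl0 (divr_gt0 eta0 D0).
have etaN : (d.+1 + d.+1)%:R * N.+1%:R `^ (- dl) <= eta.
  apply: (le_trans (ler_wpM2l (ler0n _ _) HN)); rewrite mulrCA ler_piMr//; first exact: ltW.
  by rewrite ler_pdivrMr// mul1r lerDl.
have [s [sz sB trs]] := HB _ _ _ _ _ (kernel_matrix r1 r2 phi N) (@averaging_trig_row R d.+1 N.*2.+1)
  (fun x tx => kernel_matrix_energy r10 r20 C10 C20 approx1 approx2 L2phi phi1 domA N (torus_closed_cube tx))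
  (fun j _ => kernel_matrix_projector r1h r20 L2phi phi1 N j)
  (mxtrace_kernel_matrix r1h r20 L2phi phi1 N).
apply: (sigma_LK_of_selection r10 r20 C10 C20 approx1 approx2 L2phi phi1 MA0 domA B1 eta0 etaN _ _ trs eta_tau).
- exact: leq_trans sz Jm.
- move=> p ps; have [Dp h] := sB p ps; split=> // x tx; rewrite (le_trans (h x tx))//.
  by rewrite (le_trans (ler_norm _))// /B lerDr.
Qed.

(** * Choice of the level *)

Lemma level_steps_le (R : realType) d (r1 r2 : R) J :
  (level_steps d r1 r2 J <= 48 * level_ratio r1 r2 * 4 ^ d.+1 * 2 ^ J * J.+1 ^ d)%N.
Proof.
set c := (24 * level_ratio r1 r2 * 4 ^ d.+1)%N.
(* The bound 2c (2^J - 1) (J+1)^d of a geometric sum, written without subtraction; the plain bound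
   would not be stable under induction. *)
suff : (level_steps d r1 r2 J + 2 * (c * J.+1 ^ d) <= 2 * (c * 2 ^ J * J.+1 ^ d))%N by rewrite /c; lia.
elim: J => [|J IH]; first by rewrite /level_steps big_geq// expn0; lia.
have mono : (J.+1 ^ d <= J.+2 ^ d)%N by case: {+}d => // d'; rewrite leq_exp2r.
rewrite /level_steps big_nat_recr//= -/(level_steps d r1 r2 J).
rewrite (_ : (8 * level_ratio r1 r2 * level_rank d J.+1)%N = (c * (2 * 2 ^ J) * J.+2 ^ d)%N); last first.
  rewrite /c /level_rank (expnS 2).
  by move: (4 ^ _)%N (2 ^ _)%N (_ ^ d)%N (level_ratio _ _) => x y z w; lia.
rewrite (expnS 2); have : (0 < 2 ^ J)%N by rewrite expn_gt0.
move: (2 ^ J)%N IH => [//|Q] IH _.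
have h : (c * Q * J.+1 ^ d <= c * Q * J.+2 ^ d)%N by rewrite leq_mul.
by move: (level_steps _ _ _ _) (J.+1 ^ d)%N (J.+2 ^ d)%N IH h; clear; move=> S A A' IH h; lia.
Qed.

(** The least [J] whose successor exceeds the budget. At J = 0 no points are used; otherwise level
    [J] itself fits into [m] by minimality. The bound on 2^J serves to compare J with log m. *)
Lemma level_exists (R : realType) d (r1 r2 : R) m :
  let budget J := (48 * level_ratio r1 r2 * 4 ^ d.+1 * 2 ^ J * J.+1 ^ d)%N in
  exists J, [/\ (level_steps d r1 r2 J <= m)%N, (2 ^ J <= maxn 1 m)%N & (m < budget J.+1)%N].
Proof.
move=> budget.
have b2 J : (2 ^ J <= budget J)%N.
  by rewrite /budget mulnAC leq_pmull// !muln_gt0 !expn_gt0.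
have ex : exists J, (m < budget J.+1)%N.
  by exists m; rewrite (leq_trans _ (b2 _))// (leq_trans _ (ltn_expl _ _)).
have [[|J] HJ minJ] := ex_minnP ex.
  by exists 0%N; split=> //; [rewrite /level_steps big_geq|rewrite leq_maxl].
exists J.+1; have Jm : (budget J.+1 <= m)%N by rewrite leqNgt; apply/negP => /minJ; rewrite ltnn.
split=> //; first exact: leq_trans (level_steps_le _ _ _ _) Jm.
by rewrite (leq_trans (b2 _))// (leq_trans Jm)// leq_maxr.
Qed.

Lemma ln2_gt0 (R : realType) : 0 < ln (2 : R).
Proof. by rewrite ln_gt0// ltr1n. Qed.

Lemma level_rate (R : realType) d (s : R) (b : nat) : 0 < s -> exists C : R,
  forall m J, (2 <= m)%N -> (2 ^ J <= maxn 1 m)%N -> (m < b * 2 ^ J.+1 * J.+2 ^ d)%N ->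
  2 `^ (- (J%:R * s)) <= C * m%:R `^ (- s) * ln m%:R `^ (d%:R * s + 1 / 2).
Proof.
(* From 2^J <= m one gets J ln 2 <= ln m, and 2 ln 2 <= 2 ln m since m >= 2; hence J + 2 <= 3 ln m /
   ln 2. *)
move=> s0; pose L : R := 3 / ln 2.
exists ((2 * b%:R * L ^+ d) `^ s * ln 2 `^ (- (1 / 2))) => m J m2 Jm mb.
have l2 := ln2_gt0 R.
have m0 : 0 < m%:R :> R by rewrite ltr0n; lia.
have lm : ln 2 <= ln m%:R :> R by rewrite ler_ln ?posrE// ler_nat.
have lm0 : 0 < ln m%:R :> R by exact: lt_le_trans lm.
have [lm1 m1] := (ltW lm0, ltW m0).
have JL : J.+2%:R <= L * ln m%:R :> R.
  rewrite /L mulrAC ler_pdivlMr//.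
  have J2 : J%:R * ln 2 <= ln m%:R :> R.
    rewrite mulrC mulr_natr -lnXn// ler_ln ?posrE ?exprn_gt0// -natrX ler_nat.
    by rewrite (leq_trans Jm)// geq_max leqnn; lia.
  rewrite -[J.+2]addn2 natrD mulrDl; lra.
have L0 : 0 <= L by rewrite divr_ge0// ltW.
have two : 2 `^ (- J%:R) <= (2 * b%:R * L ^+ d) * (ln m%:R ^+ d * m%:R^-1) :> R.
  rewrite powRN powR_mulrn// mulrA ler_pdivlMr// mulrC ler_pdivrMr ?exprn_gt0//.
  apply: (@le_trans _ _ (b * 2 ^ J.+1 * J.+2 ^ d)%:R); first by rewrite ler_nat ltnW.
  rewrite !natrM !natrX exprS -[_ * L ^+ d * _]mulrA -exprMn.
  have -> : b%:R * (2 * 2 ^+ J) * J.+2%:R ^+ d = 2 * b%:R * J.+2%:R ^+ d * 2 ^+ J :> R by ring.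
  rewrite ler_wpM2r ?exprn_ge0// ler_wpM2l ?mulr_ge0// lerXn2r ?nnegrE//.
  by rewrite mulr_ge0// ltW.
have -> : - (J%:R * s) = - J%:R * s by ring.
rewrite powRrM.
apply: (@le_trans _ _ (((2 * b%:R * L ^+ d) * (ln m%:R ^+ d * m%:R^-1)) `^ s)).
  apply: ge0_ler_powR => //; rewrite ?nnegrE ?powR_ge0//; first exact: ltW.
  by rewrite !mulr_ge0 ?exprn_ge0 ?invr_ge0.
have E1 : (ln m%:R ^+ d * m%:R^-1) `^ s = ln m%:R `^ (d%:R * s) * m%:R `^ (- s) :> R.
  rewrite powRM ?exprn_ge0 ?invr_ge0//; congr (_ * _).
    by rewrite -powR_mulrn// -powRrM.
  by rewrite -powR_inv1// -powRrM mulN1r.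
rewrite powRM ?E1; [|by rewrite !mulr_ge0 ?exprn_ge0|by rewrite !mulr_ge0 ?exprn_ge0 ?invr_ge0].
have E2 : ln m%:R `^ (d%:R * s + 1 / 2) = ln m%:R `^ (d%:R * s) * ln m%:R `^ (1 / 2) :> R.
  by rewrite powRD// (gt_eqF lm0) implybT.
rewrite E2.
(* The factor (ln m)^(1/2) is at least (ln 2)^(1/2), so it can be inserted at the cost of a
   constant. *)
have E3 : 1 <= ln 2 `^ (- (1 / 2)) * ln m%:R `^ (1 / 2) :> R.
  rewrite powRN mulrC ler_pdivlMr ?powR_gt0// !mul1r.
  have h : 0 <= 2^-1 :> R by rewrite invr_ge0.
  by apply: (ge0_ler_powR h); rewrite ?nnegrE// ltW.
set u := _ `^ s; set v := _ `^ (d%:R * s); set w := m%:R `^ _; set p := ln 2 `^ _ in E3 *; set q := ln m%:R `^ _ in E3 *.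
have -> : u * p * w * (v * q) = u * (v * w) * (p * q) by ring.
by rewrite ler_peMr// !mulr_ge0 ?powR_ge0.
Qed.

Theorem corollary6p2 (R : realType) (d : nat) (r1 r2 : R) (hd : (0 < d)%N)
    (hr1 : 1 / 2 < r1) (hr2 : 0 < r2) :
  exists C : R, forall m : nat, (2 <= m)%N ->
    (ereal_sup [set sigma_LK m K | K in W2 (pair_exponent (d := d) r1 r2)] <=
      (C * m%:R `^ (- r1 - r2) *
        ln m%:R `^ ((d%:R - 1) * (r1 + r2) + 1 / 2))%:E)%E.
Proof.
case: d hd => // d _.
have s0 : 0 < r1 + r2 by rewrite addr_gt0// (lt_trans _ hr1)// divr_gt0.
have [C HC] := level_rate d (48 * level_ratio r1 r2 * 4 ^ d.+1) s0.
exists (Num.sqrt 5 * C) => m m2.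
have [J [Jm J2 mb]] := level_exists d r1 r2 m.
apply: ge_ereal_sup => _ [K WK <-]; rewrite (le_trans (sigma_LK_level hr1 hr2 Jm WK))// lee_fin.
rewrite sqrtrM// -!mulrA ler_wpM2l ?sqrtr_ge0// mulrA.
have -> : - r1 - r2 = - (r1 + r2) by ring.
have -> : d.+1%:R - 1 = d%:R :> R by rewrite -natr1 addrK.
apply: le_trans (HC _ _ m2 J2 mb).
rewrite le_eqVlt; apply/orP; left; apply/eqP.
(* The level tail is a squared error; its square root is exactly 2^(-J(r1+r2)). *)
rewrite /level_tail -(@sqr_sqrtr _ (2 `^ _ ^+ J)) ?exprn_ge0 ?powR_ge0//.
have -> : (2 `^ (- (2 * (r1 + r2)))) ^+ J = (2 `^ (- (J%:R * (r1 + r2)))) ^+ 2 :> R.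
  rewrite -!powR_mulrn ?powR_ge0// -!powRrM; congr (_ `^ _); ring.
by rewrite !sqrtr_sqr !ger0_norm ?powR_ge0.
Qed.
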